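(* Let $T\in(0,\infty)$, $q\in(1,\infty)$, $\delta=1/q<1$ and $p\in(q,\infty)$. (i) For every metric space $(E,d)$ (in particular for $E=G^{\lfloor q\rfloor}(\mathbb{R}^n)$ with the Carnot-Caratheodory metric $d=d_{cc}$) the three sets of continuous paths coincide: $$\hat N^{\delta,p}([0,T];E)=V^{\delta,p}([0,T];E)=\tilde V^{\delta,p}([0,T];E).$$ (ii) On this common space of paths with $E=G^{\lfloor q\rfloor}(\mathbb{R}^n)$, the inhomogeneous rough path distances $\rho_{V^{\delta,p}}$, $\rho_{\tilde V^{\delta,p}}$ and $\rho_{\hat N^{\delta,p}}$ are locally Lipschitz equivalent: for every $b>0$ there is a constant $C\ge 1$ such that for all $\mathbf{X}^1,\mathbf{X}^2\in \hat N^{\delta,p}([0,T];G^{\lfloor q\rfloor}(\mathbb{R}^n))$ with $\|\mathbf{X}^i\|_{\hat N^{\delta,p}}\le b$ ($i=1,2$), any two of the three numbers $\rho_{V^{\delta,p}}(\mathbf{X}^1,\mathbf{X}^2)$, $\rho_{\tilde V^{\delta,p}}(\mathbf{X}^1,\mathbf{X}^2)$, $\rho_{\hat N^{\delta,p}}(\mathbf{X}^1,\mathbf{X}^2)$ are bounded by $C$ times each other.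
   Context: Partitions: $\mathcal{P}\subset[s,t]$ means $\mathcal{P}=\{[t_i,t_{i+1}]: s=t_0<t_1<\dots<t_M=t\}$ is a finite partition of $[s,t]$. Path spaces. For a metric space $(E,d)$, a continuous $f:[0,T]\to E$ and $[s,t]\subset[0,T]$, put $\|f\|_{r\text{-var};[s,t]}=\big(\sup_{\mathcal{P}\subset[s,t]}\sum_{[u,v]\in\mathcal{P}}d(f_u,f_v)^r\big)^{1/r}$, $\|f\|_{V^{\delta,p};[s,t]}=\big(\sup_{\mathcal{P}\subset[s,t]}\sum_{[u,v]\in\mathcal{P}}\frac{d(f_u,f_v)^p}{|v-u|^{\delta p-1}}\big)^{1/p}$, $\|f\|_{\tilde V^{\delta,p};[s,t]}=\big(\sup_{\mathcal{P}\subset[s,t]}\sum_{[u,v]\in\mathcal{P}}\frac{\|f\|_{1/\delta\text{-var};[u,v]}^p}{|v-u|^{\delta p-1}}\big)^{1/p}$, $\|f\|_{N^{\delta,p};[s,t]}=\sup_{0<h\le t-s}h^{-\delta}\big(\int_s^{t-h}d(f_u,f_{u+h})^p\,du\big)^{1/p}$, $\|f\|_{\hat N^{\delta,p};[s,t]}=\big(\sup_{\mathcal{P}\subset[s,t]}\sum_{[u,v]\in\mathcal{P}}\|f\|_{N^{\delta,p};[u,v]}^p\big)^{1/p}$. The subscript $[0,T]$ is omitted when $[s,t]=[0,T]$, and $V^{\delta,p}([0,T];E)$, $\tilde V^{\delta,p}([0,T];E)$, $\hat N^{\delta,p}([0,T];E)$ denote the sets of continuous $f:[0,T]\to E$ for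 which the respective quantity on $[0,T]$ is finite. The group. Let $T^N(\mathbb{R}^n)=\bigoplus_{k=0}^N(\mathbb{R}^n)^{\otimes k}$ be the level-$N$ truncated tensor algebra with product $\otimes$, each $(\mathbb{R}^n)^{\otimes k}$ having its Euclidean norm $|\cdot|$, and $\pi_k:T^N(\mathbb{R}^n)\to(\mathbb{R}^n)^{\otimes k}$ the projection. For a continuous path $Z:[0,T]\to\mathbb{R}^n$ of finite $1$-variation, $S_N(Z)_{s,t}=(1,\int_{s<u<t}dZ_u,\dots,\int_{s<u_1<\dots<u_N<t}dZ_{u_1}\otimes\cdots\otimes dZ_{u_N})\in T^N(\mathbb{R}^n)$. $G^N(\mathbb{R}^n)=\{S_N(Z)_{0,T}\}$ over all such $Z$; it is a group under $\otimes$. $\|g\|_{cc}$ is the infimum of the Euclidean lengths of such paths $\gamma$ with $S_N(\gamma)_{0,T}=g$, and $d_{cc}(g,h)=\|g^{-1}\otimes h\|_{cc}$. For a path $\mathbf{X}$ in $G^N(\mathbb{R}^n)$, $\mathbf{X}_{u,v}=\mathbf{X}_u^{-1}\otimes\mathbf{X}_v$. Inhomogeneous distances. With $N=\lfloor 1/\delta\rfloor$ and $k=1,\dots,N$: $\rho^{(k)}_{1/\delta\text{-var};[s,t]}(\mathbf{X}^1,\mathbf{X}^2)=\sup_{\mathcal{P}\subset[s,t]}\big(\sum_{[u,v]\in\mathcal{P}}|\pi_k(\mathbf{X}^1_{u,v}-\mathbf{X}^2_{u,v})|^{\frac1{\delta k}}\big)^{\delta k}$, $\rho^{(k)}_{V^{\delta,p};[s,t]}(\mathbf{X}^1,\mathbf{X}^2)=\sup_{\mathcal{P}\subset[s,t]}\big(\sum_{[u,v]\in\mathcal{P}}\frac{|\pi_k(\mathbf{X}^1_{u,v}-\mathbf{X}^2_{u,v})|^{p/k}}{|u-v|^{\delta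 p-1}}\big)^{k/p}$, $\rho^{(k)}_{\tilde V^{\delta,p};[s,t]}(\mathbf{X}^1,\mathbf{X}^2)=\sup_{\mathcal{P}\subset[s,t]}\big(\sum_{[u,v]\in\mathcal{P}}\frac{\rho^{(k)}_{1/\delta\text{-var};[u,v]}(\mathbf{X}^1,\mathbf{X}^2)^{p/k}}{|u-v|^{\delta p-1}}\big)^{k/p}$, $\rho^{(k)}_{N^{\delta,p};[u,v]}(\mathbf{X}^1,\mathbf{X}^2)=\sup_{0<h\le v-u}h^{-\delta k}\big(\int_u^{v-h}|\pi_k(\mathbf{X}^1_{r,r+h}-\mathbf{X}^2_{r,r+h})|^{p/k}dr\big)^{k/p}$, $\rho^{(k)}_{\hat N^{\delta,p};[s,t]}(\mathbf{X}^1,\mathbf{X}^2)=\sup_{\mathcal{P}\subset[s,t]}\big(\sum_{[u,v]\in\mathcal{P}}\rho^{(k)}_{N^{\delta,p};[u,v]}(\mathbf{X}^1,\mathbf{X}^2)^{p/k}\big)^{k/p}$. Each of $\rho_{V^{\delta,p}},\rho_{\tilde V^{\delta,p}},\rho_{\hat N^{\delta,p}}$ is the maximum over $k=1,\dots,N$ of the corresponding $\rho^{(k)}$ on $[0,T]$. *)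

(* Defs.v *)
From HB Require Import structures.
From mathcomp Require Import all_boot all_order all_algebra.
From mathcomp Require Import all_classical all_reals all_analysis.
Set Implicit Arguments.
Unset Strict Implicit.
Unset Printing Implicit Defensive.
Import Order.TTheory GRing.Theory Num.Theory.
Local Open Scope classical_set_scope.
Local Open Scope ring_scope.

(* A path f : [0, T] -> E is represented by a function f : R -> E of which
   every notion below only inspects the values on [0, T].  A partition
   s = t_0 < t_1 < ... < t_M = t is the sequence r = [:: t_1; ...; t_M] with
   itv_partition s t r.  Suprema and integrals live in \bar R. *)

Section PartitionSums.
Context {R : realType}.
Implicit Types (s t : R) (F : R -> R -> \bar R).

Definition partition_sum F s t (r : seq R) : \bar R :=
  (\sum_(0 <= i < size r) F (nth t (s :: r) i) (nth t (s :: r) i.+1))%E.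

Definition sup_partition F s t : \bar R :=
  ereal_sup [set partition_sum F s t r | r in itv_partition s t].

(* The variant with an outer power inside the supremum. *)
Definition sup_partition_pow (e : R) F s t : \bar R :=
  ereal_sup [set poweR (partition_sum F s t r) e | r in itv_partition s t].

End PartitionSums.

Section PathSpaces.
Context {R : realType} {E : Type}.
Variable d : E -> E -> R.
Implicit Types (f : R -> E) (T s t r delta p : R).

Definition continuous_path T f : Prop :=
  forall t, t \in `[0, T] -> forall e, 0 < e ->
  exists2 eta, 0 < eta &
    forall s, s \in `[0, T] -> `|s - t| < eta -> d (f s) (f t) < e.

Definition var_norm r f s t : \bar R :=
  poweR (sup_partition (fun u v => (d (f u) (f v) `^ r)%:E) s t) r^-1.

Definition V_norm delta p f s t : \bar R :=
  poweR (sup_partition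
    (fun u v => (d (f u) (f v) `^ p / (v - u) `^ (delta * p - 1))%:E) s t) p^-1.

Definition Vt_norm delta p f s t : \bar R :=
  poweR (sup_partition
    (fun u v => (poweR (var_norm delta^-1 f u v) p
                 * ((v - u) `^ (delta * p - 1))^-1%:E)%E) s t) p^-1.

Definition N_norm delta p f s t : \bar R :=
  ereal_sup [set ((h `^ (- delta))%:E *
      poweR (\int[lebesgue_measure]_(u in `[s, (t - h)%R])
               (d (f u) (f (u + h)%R) `^ p)%:E) p^-1)%E
    | h in [set h : R | 0 < h <= t - s]].

Definition Nh_norm delta p f s t : \bar R :=
  poweR (sup_partition (fun u v => poweR (N_norm delta p f u v) p) s t) p^-1.

Definition V_space delta p T : set (R -> E) :=
  [set f | continuous_path T f /\ (V_norm delta p f 0 T < +oo)%E].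

Definition Vt_space delta p T : set (R -> E) :=
  [set f | continuous_path T f /\ (Vt_norm delta p f 0 T < +oo)%E].

Definition Nh_space delta p T : set (R -> E) :=
  [set f | continuous_path T f /\ (Nh_norm delta p f 0 T < +oo)%E].

End PathSpaces.

(* T^N(R^n): an element is the family of its coefficients on the words of
   length at most N over the alphabet 'I_n; the words of length k index the
   canonical basis of the k-th tensor power of R^n. *)
Notation tensor R n N := {ffun N.-bseq 'I_n -> R}.

Section TensorAlgebra.
Context {R : realType} {n N : nat}.
Implicit Types a b : tensor R n N.

Definition tone : tensor R n N := [ffun w : N.-bseq 'I_n => (size w == 0%N)%:R].

Definition tmul a b : tensor R n N :=
  [ffun w : N.-bseq 'I_n =>
    \sum_(i < (size w).+1)
       a (insub_bseq N (take i w)) * b (insub_bseq N (drop i w))].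

(* The two-sided inverse for tmul (unique when it exists, and equal to the
   junk value tone otherwise). *)
Definition tinv a : tensor R n N :=
  xget tone [set b | tmul a b = tone /\ tmul b a = tone].

(* pi_k, followed by the inclusion of the k-th tensor power in T^N. *)
Definition tproj (k : nat) a : tensor R n N :=
  [ffun w : N.-bseq 'I_n => if size w == k then a w else 0].

Definition tnorm a : R := Num.sqrt (\sum_w a w ^+ 2).

Definition tincr (X : R -> tensor R n N) (u v : R) : tensor R n N :=
  tmul (tinv (X u)) (X v).

End TensorAlgebra.

Section Signature.
Context {R : realType}.

(* I is the Riemann-Stieltjes integral of f against g over [a, b]; xi i is
   the evaluation point in the i-th interval of the partition r. *)
Definition is_RSint (f g : R -> R) (a b I : R) : Prop :=
  forall e, 0 < e -> exists2 eta, 0 < eta &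
    forall (r : seq R) (xi : nat -> R), itv_partition a b r ->
    (forall i, (i < size r)%N ->
       nth b (a :: r) i <= xi i <= nth b (a :: r) i.+1 /\
       nth b (a :: r) i.+1 - nth b (a :: r) i < eta) ->
    `|\sum_(0 <= i < size r)
        f (xi i) * (g (nth b (a :: r) i.+1) - g (nth b (a :: r) i)) - I| < e.

Definition RSint (f g : R -> R) (a b : R) : R := xget 0 (is_RSint f g a b).

Context {n : nat}.
Implicit Types (Z : R -> 'rV[R]_n) (s t T : R).

Definition eucl_dist (x y : 'rV[R]_n) : R :=
  Num.sqrt (\sum_i (y 0 i - x 0 i) ^+ 2).

Definition bv_path T Z : Prop :=
  continuous_path eucl_dist T Z /\ (var_norm eucl_dist 1 Z 0 T < +oo)%E.

(* Integrates the last letter of the word outermost, hence the reversal: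
   iter_int Z s t [:: i_1; ...; i_k] is the integral over
   s < u_1 < ... < u_k < t of dZ^{i_1}_{u_1} ... dZ^{i_k}_{u_k}. *)
Fixpoint iter_int_rev Z s (w : seq 'I_n) (t : R) : R :=
  if w is i :: w' then RSint (iter_int_rev Z s w') (fun u => Z u 0 i) s t
  else 1.

Definition iter_int Z s t (w : seq 'I_n) : R := iter_int_rev Z s (rev w) t.

Definition signature (N : nat) Z s t : tensor R n N :=
  [ffun w : N.-bseq 'I_n => iter_int Z s t w].

End Signature.

Section FreeNilpotentGroup.
Context {R : realType}.
Variables (T : R) (n N : nat).

Definition GN : set (tensor R n N) :=
  [set g | exists2 Z, bv_path T Z & signature N Z 0 T = g].

(* The length of a path is its 1-variation for the Euclidean distance. *)
Definition cc_norm (g : tensor R n N) : R :=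
  inf [set L : R | exists Z, [/\ bv_path T Z, signature N Z 0 T = g
                               & var_norm eucl_dist 1 Z 0 T = L%:E]].

(* GN is used as a type through the coercion set_type. *)
Definition cc_dist (g h : GN) : R := cc_norm (tmul (tinv (val g)) (val h)).

End FreeNilpotentGroup.

Arguments GN {R} T n N.
Arguments cc_dist {R} T n N.

Section InhomogeneousDistances.
Context {R : realType} {n N : nat}.
Implicit Types (X : R -> tensor R n N) (delta p s t : R) (k : nat).

Definition incr_gap k X1 X2 (u v : R) : R :=
  tnorm (tproj k (tincr X1 u v - tincr X2 u v)).

Definition rho_var_k k delta X1 X2 s t : \bar R :=
  sup_partition_pow (delta * k%:R)
    (fun u v => (incr_gap k X1 X2 u v `^ (delta * k%:R)^-1)%:E) s t.

Definition rho_V_k k delta p X1 X2 s t : \bar R :=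
  sup_partition_pow (k%:R / p)
    (fun u v => (incr_gap k X1 X2 u v `^ (p / k%:R)
                 / (v - u) `^ (delta * p - 1))%:E) s t.

Definition rho_Vt_k k delta p X1 X2 s t : \bar R :=
  sup_partition_pow (k%:R / p)
    (fun u v => (poweR (rho_var_k k delta X1 X2 u v) (p / k%:R)
                 * ((v - u) `^ (delta * p - 1))^-1%:E)%E) s t.

Definition rho_N_k k delta p X1 X2 s t : \bar R :=
  ereal_sup [set ((h `^ (- (delta * k%:R)))%:E *
      poweR (\int[lebesgue_measure]_(u in `[s, (t - h)%R])
               (incr_gap k X1 X2 u (u + h)%R `^ (p / k%:R))%:E) (k%:R / p))%E
    | h in [set h : R | 0 < h <= t - s]].

Definition rho_Nh_k k delta p X1 X2 s t : \bar R :=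
  sup_partition_pow (k%:R / p)
    (fun u v => poweR (rho_N_k k delta p X1 X2 u v) (p / k%:R)) s t.

Definition rho_V delta p T X1 X2 : \bar R :=
  \big[maxe/0%E]_(1 <= k < N.+1) rho_V_k k delta p X1 X2 0 T.

Definition rho_Vt delta p T X1 X2 : \bar R :=
  \big[maxe/0%E]_(1 <= k < N.+1) rho_Vt_k k delta p X1 X2 0 T.

Definition rho_Nh delta p T X1 X2 : \bar R :=
  \big[maxe/0%E]_(1 <= k < N.+1) rho_Nh_k k delta p X1 X2 0 T.

End InhomogeneousDistances.

(* Main.v *)
Require Import Defs.
From HB Require Import structures.
From mathcomp Require Import all_boot all_order all_algebra.
From mathcomp Require Import all_classical all_reals all_analysis.
From mathcomp Require Import measurable_realfun ring lra.
Set Implicit Arguments.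
Unset Strict Implicit.
Unset Printing Implicit Defensive.
Import Order.TTheory GRing.Theory Num.Theory.
Import numFieldNormedType.Exports.
Local Open Scope classical_set_scope.
Local Open Scope ring_scope.

(** The proof is organised around controls: nonnegative functions w(s,t) of an
   interval such that w(s,u) + w(u,t) <= w(s,t).  The supremum over partitions
   of a sum of nonnegative terms is a control, and a control that dominates the
   summand on every interval bounds the supremum.  So each norm of the statement
   says that a gap D(u,v), which is a distance d(f_u,f_v) or a level difference
   |pi_k(X1_{u,v} - X2_{u,v})|, is dominated by a control w.  With r = p/k and
   alpha = delta p - 1 the three conditions read

   - V: D(u,v)^r <= w(u,v) (v-u)^alpha;
   - Vt: the same for the r/(1+alpha)-variation of D in place of D;
   - N: the integral of D(x,x+h)^r over [u,v-h] is at most w(u,v) h^(1+alpha).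

   V implies Vt by Hoelder's inequality for sums over a partition
   ([V_controlled_variation]).  V implies N because w(x,x+h) is at most
   W(x+h) - W(x) with W = w(u,.), whose integral telescopes
   ([V_controlled_Nikolskii]).  The estimate from N to V is an embedding of
   Nikolskii functions into Hoelder functions ([chaining_bound]): the averages
   of D(s,.) over [s,s+l] and over [s,s+l/2] differ by the average of the gaps
   D(x,x+l/2), which N bounds by a multiple of l^(alpha/r), so that halving l
   down to 0 costs a geometric series.  It only needs a triangle inequality up
   to an error E (y-x)^(alpha/r).

   For a metric there is no error, and the equality of the spaces follows
   ([metric_spaces_coincide]).  For two rough paths Chen's relation gives the
   triangle inequality up to products of lower levels ([gap_triangle]).  If y
   bounds the N-distance, one shows by induction on the level
   ([level_induction]) that the level-k gap is at most y phi^k where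
   phi(u,v)^p = Om(u,v) (v-u)^alpha for one control Om whose size is
   bounded in terms of b and the parameters.  The Carnot-Caratheodory
   increments of the paths are at most phi by the metric case, hence the error
   at level k is again of order y phi^k.

   This uses that the Carnot-Caratheodory distance is a pseudo-metric on the
   group and dominates tensor coefficients: |pi_k(g)| <= K ||g||^k.  Both rest on
   the Riemann-Stieltjes integral against continuous functions of bounded
   variation ([RSint_continuous_bv]), Chen's relation ([iter_int_Chen]) and the
   fact that a reversed path has the inverse signature ([iter_int_time_rev]). *)

(** * Controls and partitions *)

Section Partitions.
Context {R : realType}.
Implicit Types (F : R -> R -> \bar R) (w : R -> R -> R) (a b s t u v : R).

Lemma partition_sum_nil F s t : partition_sum F s t [::] = 0%E.
Proof. by rewrite /partition_sum big_nil. Qed.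

Lemma partition_sum_cons F s t x r :
  partition_sum F s t (x :: r) = (F s x + partition_sum F x t r)%E.
Proof. by rewrite /partition_sum /= big_nat_recl. Qed.

Lemma itv_partition_consE s t x r :
  itv_partition s t (x :: r) <-> s < x /\ itv_partition x t r.
Proof.
rewrite /itv_partition /=; split; first by case=> /andP[-> ->] ->.
by case=> -> [-> ->].
Qed.

Lemma itv_partitionP s t : s <= t -> exists r, itv_partition s t r.
Proof.
rewrite le_eqVlt => /predU1P[->|st]; last by exists [:: t]; exact: itv_partition1.
by exists [::]; split.
Qed.

Lemma partition_sum_cat F s u t r1 r2 : itv_partition s u r1 ->
  partition_sum F s t (r1 ++ r2)
  = (partition_sum F s u r1 + partition_sum F u t r2)%E.
Proof.
elim: r1 s => [|x r ih] s /=.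
  by move=> /itv_partition_nil ->; rewrite partition_sum_nil add0e.
move=> /itv_partition_consE[sx xr].
by rewrite !partition_sum_cons ih // addeA.
Qed.

(** Nonnegativity is part of the definition, so that a control is monotone in
   the interval. *)
Definition superadditive a b w :=
  (forall s t, a <= s -> s <= t -> t <= b -> 0 <= w s t) /\
  (forall s u t, a <= s -> s <= u -> u <= t -> t <= b ->
    w s u + w u t <= w s t).

Definition additive_on a b w := forall s u t,
  a <= s -> s <= u -> u <= t -> t <= b -> w s u + w u t = w s t.

Definition dominated a b F w :=
  forall u v, a <= u -> u < v -> v <= b -> (F u v <= (w u v)%:E)%E.

Lemma superadditive_mono a b w s t s' t' : superadditive a b w ->
  a <= s' -> s' <= s -> s <= t -> t <= t' -> t' <= b -> w s t <= w s' t'.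
Proof.
move=> [w0 wD] h1 h2 h3 h4 h5.
have le1 : s' <= t := le_trans h2 h3.
have := wD s' t t' h1 le1 h4 h5.
have := wD s' s t h1 h2 h3 (le_trans h4 h5).
have := w0 s' s h1 h2 (le_trans h3 (le_trans h4 h5)).
have := w0 t t' (le_trans h1 le1) h4 h5.
lra.
Qed.

Lemma superadditiveS a b a' b' w : a <= a' -> b' <= b ->
  superadditive a b w -> superadditive a' b' w.
Proof.
move=> aa bb [w0 wD]; split=> [s t h1 h2 h3|s u t h1 h2 h3 h4].
  by apply: w0; [exact: le_trans h1|by []|exact: le_trans bb].
by apply: wD => //; [exact: le_trans h1|exact: le_trans bb].
Qed.

Lemma superadditiveD a b w1 w2 : superadditive a b w1 -> superadditive a b w2 ->
  superadditive a b (fun u v => w1 u v + w2 u v).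
Proof.
move=> [p1 s1] [p2 s2]; split=> [s t h1 h2 h3|s u t h1 h2 h3 h4].
  by rewrite addr_ge0// (p1, p2).
by rewrite addrACA lerD// (s1, s2).
Qed.

Lemma superadditiveZ a b w c : 0 <= c -> superadditive a b w ->
  superadditive a b (fun u v => c * w u v).
Proof.
move=> c0 [p1 s1]; split=> [s t h1 h2 h3|s u t h1 h2 h3 h4].
  by rewrite mulr_ge0// p1.
by rewrite -mulrDr ler_wpM2l// s1.
Qed.

Lemma superadditive_length a b : superadditive a b (fun u v : R => v - u).
Proof. by split=> [s t|s u t] *; lra. Qed.

Lemma additive_on_superadditive a b w :
  (forall s t, a <= s -> s <= t -> t <= b -> 0 <= w s t) ->
  additive_on a b w -> superadditive a b w.
Proof. by move=> w0 wD; split=> // s u t *; rewrite wD. Qed.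

Lemma partition_sum_le a b F w s t r : superadditive a b w -> dominated a b F w ->
  a <= s -> t <= b -> itv_partition s t r ->
  (partition_sum F s t r <= (w s t)%:E)%E.
Proof.
move=> wS Fw; elim: r s => [|x r ih] s as_ tb.
  move=> /itv_partition_nil st; rewrite partition_sum_nil lee_fin; subst t.
  by apply: wS.1.
move=> /itv_partition_consE[sx xr]; have xt := itv_partition_le xr.
rewrite partition_sum_cons.
have ax : a <= x by rewrite (le_trans as_)// ltW.
apply: (@le_trans _ _ (w s x + w x t)%:E); last first.
  by rewrite lee_fin; apply: wS.2 => //; exact: ltW.
by rewrite EFinD leeD// ?ih// Fw// (le_trans xt).
Qed.

Lemma sup_partition_le a b F w s t : superadditive a b w -> dominated a b F w ->
  a <= s -> t <= b -> (sup_partition F s t <= (w s t)%:E)%E.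
Proof.
move=> wS Fw as_ tb; apply: ge_ereal_sup => _ [r rst <-].
exact: (partition_sum_le wS Fw).
Qed.

Lemma partition_sum_EFin w s t r :
  partition_sum (fun u v => (w u v)%:E) s t r =
  (\sum_(0 <= i < size r) w (nth t (s :: r) i) (nth t (s :: r) i.+1))%:E.
Proof. by rewrite /partition_sum sumEFin. Qed.

Lemma sum_partition_le a b w s t r : superadditive a b w ->
  a <= s -> t <= b -> itv_partition s t r ->
  \sum_(0 <= i < size r) w (nth t (s :: r) i) (nth t (s :: r) i.+1) <= w s t.
Proof.
move=> wS as_ tb rst; rewrite -lee_fin -partition_sum_EFin.
by apply: (partition_sum_le wS _ as_ tb rst).
Qed.

Lemma sum_partition_additive a b w s t r : additive_on a b w ->
  a <= s -> t <= b -> itv_partition s t r ->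
  \sum_(0 <= i < size r) w (nth t (s :: r) i) (nth t (s :: r) i.+1) = w s t.
Proof.
move=> wA + tb; elim: r s => [|x r ih] s as_.
  move=> /itv_partition_nil st; subst t; rewrite big_nil.
  by have := wA s s s as_ (lexx _) (lexx _) tb; lra.
move=> /itv_partition_consE[sx xr]; have xt := itv_partition_le xr.
have ax : a <= x by rewrite (le_trans as_)// ltW.
by rewrite /= big_nat_recl//= ih// wA// ltW.
Qed.

Lemma itv_partition_nth_lt s t r i : itv_partition s t r -> (i < size r)%N ->
  nth t (s :: r) i < nth t (s :: r) i.+1.
Proof. by move=> [/(pathP t) + _]; apply. Qed.

Section SupPartition.
Variable F : R -> R -> \bar R.
Hypothesis F_ge0 : forall u v, (0 <= F u v)%E.

Lemma partition_sum_ge0 s t r : (0 <= partition_sum F s t r)%E.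
Proof. by apply: sume_ge0 => i _; exact: F_ge0. Qed.

Lemma partition_sum_le_sup s t r : itv_partition s t r ->
  (partition_sum F s t r <= sup_partition F s t)%E.
Proof. by move=> rst; apply: ereal_sup_ubound; exists r. Qed.

Lemma sup_partition_ge0 s t : s <= t -> (0 <= sup_partition F s t)%E.
Proof.
move=> /itv_partitionP[r rst].
exact: le_trans (partition_sum_ge0 _ _ _) (partition_sum_le_sup rst).
Qed.

Lemma le_sup_partition s t : s < t -> (F s t <= sup_partition F s t)%E.
Proof.
move=> st; have := partition_sum_le_sup (itv_partition1 st).
by rewrite partition_sum_cons partition_sum_nil adde0.
Qed.

Lemma ereal_sup_add_le (A : set \bar R) (y c : \bar R) :
  A !=set0 -> (forall x, A x -> 0 <= x)%E -> (0 <= y)%E ->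
  (forall x, A x -> x + y <= c)%E -> (ereal_sup A + y <= c)%E.
Proof.
move=> [x0 Ax0] A0 y0 Ac; have [yfin|] := boolP (y \is a fin_num).
  rewrite -leeBrDr//; apply: ge_ereal_sup => x Ax.
  by rewrite leeBrDr// Ac.
rewrite ge0_fin_numE// -leNgt leye_eq => /eqP yoo.
have := Ac _ Ax0; rewrite yoo addey; last first.
  by apply/eqP => x0E; have := A0 _ Ax0; rewrite x0E.
by rewrite leye_eq => /eqP ->; rewrite leey.
Qed.

Lemma sup_partition_superadd s u t : s <= u -> u <= t ->
  (sup_partition F s u + sup_partition F u t <= sup_partition F s t)%E.
Proof.
move=> su ut; have [r1 r1P] := itv_partitionP su; have [r2 r2P] := itv_partitionP ut.
apply: ereal_sup_add_le.
- by exists (partition_sum F s u r1); exists r1.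
- by move=> _ [r _ <-]; exact: partition_sum_ge0.
- exact: sup_partition_ge0.
move=> _ [r rP <-]; rewrite addeC; apply: ereal_sup_add_le.
- by exists (partition_sum F u t r2); exists r2.
- by move=> _ [r' _ <-]; exact: partition_sum_ge0.
- exact: partition_sum_ge0.
move=> _ [r' r'P <-]; rewrite addeC -partition_sum_cat//.
exact/partition_sum_le_sup/itv_partition_cat/r'P.
Qed.

(** A subadditive summand grows when a point is inserted in the partition, so
   the partitions through [u] suffice. *)
Lemma sup_partition_subadd s u t :
  (forall x y z, s <= x -> x < y -> y < z -> z <= t -> (F x z <= F x y + F y z)%E) ->
  s <= u -> u <= t ->
  (sup_partition F s t <= sup_partition F s u + sup_partition F u t)%E.
Proof.
move=> FD su ut; apply: ge_ereal_sup => _ [r + <-].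
elim: r s su FD => [|x r ih] s su FD.
  by move=> rP; rewrite partition_sum_nil adde_ge0// sup_partition_ge0.
move=> rP; move: su; rewrite (le_eqVlt s) => /orP[/eqP|su].
  move=> su; rewrite su in rP *.
  by rewrite -[leLHS]add0e leeD// ?partition_sum_le_sup// sup_partition_ge0.
have [sx xr] := (itv_partition_consE _ _ _ _).1 rP.
have xt := itv_partition_le xr.
rewrite partition_sum_cons; have [xu|ux] := leP x u.
  apply: (@le_trans _ _ (sup_partition F s x + (sup_partition F x u + sup_partition F u t))%E).
    rewrite leeD ?le_sup_partition ?ih// => x1 y z h1; apply: FD.
    exact: le_trans (ltW sx) h1.
  by rewrite addeA leeD2r// sup_partition_superadd// ltW.
apply: (@le_trans _ _ (F s u + (F u x + partition_sum F x t r))%E).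
  by rewrite addeA leeD2r// FD.
rewrite leeD ?le_sup_partition// -partition_sum_cons partition_sum_le_sup//.
exact/itv_partition_consE.
Qed.

Lemma sup_partition_mono a b s t : a <= s -> s <= t -> t <= b ->
  (sup_partition F s t <= sup_partition F a b)%E.
Proof.
move=> as_ st tb.
apply: le_trans (sup_partition_superadd as_ (le_trans st tb)).
apply: (@le_trans _ _ (sup_partition F s b)).
  apply: le_trans (sup_partition_superadd st tb).
  by rewrite leeDl// sup_partition_ge0.
by rewrite leeDr// sup_partition_ge0.
Qed.

Definition sup_control s t : R := fine (sup_partition F s t).

Variables a b : R.
Hypotheses (ab : a <= b) (F_fin : (sup_partition F a b < +oo)%E).

Lemma sup_controlE s t : a <= s -> s <= t -> t <= b ->
  (sup_control s t)%:E = sup_partition F s t.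
Proof.
move=> as_ st tb; rewrite fineK// ge0_fin_numE ?sup_partition_ge0//.
exact: le_lt_trans (sup_partition_mono as_ st tb) F_fin.
Qed.

Lemma sup_control_superadditive : superadditive a b sup_control.
Proof.
split=> [s t h1 h2 h3|s u t h1 h2 h3 h4].
  by rewrite -lee_fin sup_controlE// sup_partition_ge0.
have h5 := le_trans h1 h2; have h6 := le_trans h3 h4; have h7 := le_trans h2 h3.
by rewrite -lee_fin EFinD !sup_controlE// sup_partition_superadd.
Qed.

Lemma sup_control_dominates : dominated a b F sup_control.
Proof.
move=> u v au uv vb.
by rewrite sup_controlE ?(ltW uv)// le_sup_partition.
Qed.

(** Gives the length of a path and the lower Riemann-Stieltjes integral as
   additive functions of the interval. *)
Lemma sup_control_additive :
  (forall x y z, a <= x -> x < y -> y < z -> z <= b -> (F x z <= F x y + F y z)%E) ->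
  additive_on a b sup_control.
Proof.
move=> FD s u t h1 h2 h3 h4; apply/eqP; rewrite eq_le.
rewrite sup_control_superadditive.2//= -lee_fin EFinD.
rewrite !sup_controlE// ?(le_trans h3)// ?(le_trans h1)// ?(le_trans h2)//.
apply: sup_partition_subadd => // x y z xs xy yz zt; apply: FD => //.
  exact: le_trans h1 xs.
exact: le_trans zt h4.
Qed.

End SupPartition.

End Partitions.

(** * Integrals over segments *)

Section SegmentIntegral.
Context {R : realType}.
Local Notation mu := (@lebesgue_measure R).
Implicit Types (f g : R -> R) (x y z c : R).

Definition Jint f x y : R := (\int[mu]_(u in `[x, y]) f u)%R.

(** The class is stable under translation and contains the continuous and the
   monotone functions, which are the integrands needed below. *)
Definition locint f := measurable_fun [set: R] f /\
  forall x y, mu.-integrable `[x, y] (EFin \o f).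

Lemma bounded_locint f : measurable_fun [set: R] f ->
  (forall x y, exists M, forall u, x <= u <= y -> `|f u| <= M) -> locint f.
Proof.
move=> mf bf; split=> // x y; have [M Mf] := bf x y.
apply: measurable_bounded_integrable => //=.
- by rewrite lebesgue_measure_itv /=; case: ifPn => _; rewrite -?EFinD ltry.
- exact: measurable_funTS.
exists M; split; first by rewrite num_real.
move=> M' MM' u /= uxy; apply: (le_trans (Mf u _)); first by rewrite in_itv in uxy.
exact: ltW.
Qed.

Lemma continuous_locint f : continuous f -> locint f.
Proof.
move=> cf; split; first exact: continuous_measurable_fun.
move=> x y; apply: continuous_compact_integrable; first exact: segment_compact.
exact: continuous_subspaceT.
Qed.

Lemma nondecreasing_locint f : {homo f : x y / x <= y} -> locint f.
Proof.
move=> nf; apply: bounded_locint; first exact: nondecreasing_measurable.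
move=> x y; exists (`|f x| + `|f y|) => u /andP[/nf h1 /nf h2].
rewrite ler_norml; have := ler_norm (f y); have := ler_norm (- f x).
rewrite normrN; have := normr_ge0 (f x); have := normr_ge0 (f y); lra.
Qed.

Definition translation c : measurableTypeR R -> measurableTypeR R :=
  fun u => u + c.

Lemma measurable_translation c : measurable_fun [set: R] (translation c).
Proof. exact: measurable_funD. Qed.

Lemma lebesgue_measure_translation c (A : set R) : measurable A ->
  pushforward mu (translation c) A = mu A.
Proof.
move=> mA; apply: esym; apply: lebesgue_measure_unique => //.
  exact: measurable_translation.
move=> mt _ [[a b]] _ <-.
rewrite [RHS]/(mu (translation c @^-1` `]a, b])).
rewrite (_ : translation c @^-1` _ = `]a - c, b - c]%classic); last first.
  by apply/seteqP; split=> u /=; rewrite /translation !in_itv /= ltrBlDr lerBrDr.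
rewrite (lebesgue_measure_itv `]a, b]) [RHS](lebesgue_measure_itv `]a - c, b - c]) /= !lte_fin ltrD2r.
by case: ifPn => // _; rewrite -!EFinD; congr EFin; ring.
Qed.

Lemma translation_preimage c x y :
  translation c @^-1` `[x + c, y + c] = `[x, y]%classic.
Proof. by apply/seteqP; split=> u /=; rewrite /translation !in_itv /= !lerD2r. Qed.

Lemma locint_shift f c : locint f -> locint (fun u => f (u + c)).
Proof.
move=> [mf intf].
have mfc : measurable_fun [set: R] (f \o translation c).
  by apply: measurableT_comp mf _; exact: measurable_translation.
split=> // x y; apply/integrableP; split.
  exact/measurable_EFinP/measurable_funTS.
have /integrableP[_] := intf (x + c) (y + c).
congr (_ < _)%E.
transitivity (\int[pushforward mu (translation c)]_(u in `[(x + c)%R, (y + c)%R])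
    `|(EFin \o f) u|)%E.
  apply: eq_measure_integral => //=; first exact: measurable_translation.
  by move=> mt A mA _; rewrite lebesgue_measure_translation.
rewrite ge0_integral_pushforward//= ?translation_preimage//.
  exact: measurable_translation.
by apply/measurable_EFinP; apply: measurableT_comp => //; exact: measurable_funTS.
Qed.

Lemma Jint_shift f x y c : locint f ->
  Jint (fun u => f (u + c)) x y = Jint f (x + c) (y + c).
Proof.
move=> nf; have [_ intc] := locint_shift c nf; have [mf intf] := nf.
rewrite /Jint /Rintegral; congr fine; symmetry.
transitivity (\int[pushforward mu (translation c)]_(u in `[(x + c)%R, (y + c)%R]) (f u)%:E)%E.
  apply: eq_measure_integral => //=; first exact: measurable_translation.
  by move=> mt A mA _; rewrite lebesgue_measure_translation.
rewrite integral_pushforward//= ?translation_preimage//.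
- exact: measurable_translation.
- exact/measurable_EFinP.
Qed.

Lemma locintZ f c : locint f -> locint (fun x => c * f x).
Proof.
move=> [mf itf]; split; first exact: measurable_funM.
by move=> x y; apply: (integrableZl _ c (itf x y)).
Qed.

Lemma locintD f g : locint f -> locint g -> locint (fun x => f x + g x).
Proof.
move=> [mf itf] [mg itg]; split; first exact: measurable_funD.
by move=> x y; apply: (integrableD _ (itf x y) (itg x y)).
Qed.

Lemma Jint_ge0 f x y : (forall u, x <= u <= y -> 0 <= f u) -> 0 <= Jint f x y.
Proof. by move=> f0; apply: Rintegral_ge0 => u /=; rewrite in_itv; exact: f0. Qed.

Lemma Jint_le f g x y : locint f -> locint g ->
  (forall u, x <= u <= y -> f u <= g u) -> Jint f x y <= Jint g x y.
Proof.
move=> [_ nf] [_ ng] fg; apply: le_Rintegral => // u /=.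
Qed.

Lemma Jint_cst c x y : x <= y -> Jint (fun=> c) x y = c * (y - x).
Proof.
move=> xy; rewrite /Jint Rintegral_cst//= lebesgue_measure_itv /= lte_fin.
move: xy; rewrite le_eqVlt => /orP[/eqP ->|->//].
by rewrite ltxx subrr.
Qed.

Lemma JintD f g x y : locint f -> locint g ->
  Jint (fun u => f u + g u) x y = Jint f x y + Jint g x y.
Proof. by move=> [_ nf] [_ ng]; exact: RintegralD. Qed.

Lemma JintZ f c x y : locint f -> Jint (fun u => c * f u) x y = c * Jint f x y.
Proof. by move=> [_ nf]; exact: RintegralZl. Qed.

Lemma Jint_split f x y z : locint f -> x <= y -> y <= z ->
  Jint f x z = Jint f x y + Jint f y z.
Proof.
move=> [_ nf] xy yz; apply/eqP; rewrite addrC -subr_eq; apply/eqP.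
rewrite /Jint Rintegral_itvB ?bnd_simp//.
rewrite Rintegral_itv_obnd_cbnd//.
apply: integrableS (nf y z) => //.
by move=> u /=; rewrite !in_itv /= => /andP[/ltW -> ->].
Qed.

Lemma Jint_le_itv f x y x' y' : locint f -> (forall u, 0 <= f u) ->
  x' <= x -> x <= y -> y <= y' -> Jint f x y <= Jint f x' y'.
Proof.
move=> nf f0 h1 h2 h3.
rewrite (@Jint_split f x' x)// ?(le_trans h2)// (@Jint_split f x y y')//.
have := @Jint_ge0 f x' x (fun u _ => f0 u).
have := @Jint_ge0 f y y' (fun u _ => f0 u); lra.
Qed.

(** Exchanges an integrand that is only known on the segment for one with good
   properties everywhere. *)
Lemma integral_le_Jint f g x y c : locint f -> (forall u, x <= u <= y -> g u = f u) ->
  (Jint f x y <= c <-> (\int[mu]_(u in `[x, y]) (g u)%:E <= c%:E)%E).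
Proof.
move=> [_ nf] gf.
have -> : (\int[mu]_(u in `[x, y]) (g u)%:E = \int[mu]_(u in `[x, y]) (f u)%:E)%E.
  by apply: eq_integral => u; rewrite inE /= in_itv /= => /gf ->.
have ifin : (\int[mu]_(u in `[x, y]) (EFin \o f) u)%E \is a fin_num.
  by apply: integrable_fin_num => //; exact: nf.
by rewrite -lee_fin /Jint /Rintegral fineK.
Qed.

End SegmentIntegral.

(** * The three conditions on a gap function *)

Section Controls.
Context {R : realType}.
Implicit Types (D w : R -> R -> R) (a b r alpha beta : R).

Lemma powR_mulC1 (x : R) e : 0 < e -> 0 <= x -> x * x `^ e = x `^ (1 + e).
Proof.
move=> e0 x0; rewrite powRD ?powRr1//.
by apply/implyP => /eqP; lra.
Qed.

(** Weighted arithmetic-geometric mean with a crude constant: replace both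
   factors by the larger of [x] and [y]. *)
Lemma powR_mix_le (th x y : R) : 0 < th -> th < 1 -> 0 <= x -> 0 <= y ->
  x `^ th * y `^ (1 - th) <= x + y.
Proof.
move=> th0 th1 x0 y0.
have th1' : 0 <= 1 - th by lra.
have E z : 0 <= z -> z `^ th * z `^ (1 - th) = z.
  move=> z0; rewrite -powRD; first by rewrite addrCA subrr addr0 powRr1.
  by apply/implyP => /eqP; lra.
have [xy|yx] := leP x y.
  apply: (@le_trans _ _ (y `^ th * y `^ (1 - th))); last by rewrite E//; lra.
  by apply: ler_wpM2r; [exact: powR_ge0|apply: ge0_ler_powR => //; exact: ltW].
apply: (@le_trans _ _ (x `^ th * x `^ (1 - th))); last by rewrite E//; lra.
by apply: ler_wpM2l; [exact: powR_ge0|apply: ge0_ler_powR => //; exact: ltW].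
Qed.

(** The normalised right-hand side is linear in [x] and [y], hence superadditive
   when they are: this does the work of Hoelder's inequality over a partition. *)
Lemma powR_mix_normalised (th x y X Y : R) : 0 < th -> th < 1 ->
  0 <= x -> x <= X -> 0 <= y -> y <= Y ->
  x `^ th * y `^ (1 - th) <= X `^ th * Y `^ (1 - th) * (x / X + y / Y).
Proof.
move=> th0 th1 x0 xX y0 yY.
have th1' : 1 - th != 0 by apply/eqP; lra.
have X0 := le_trans x0 xX; have Y0 := le_trans y0 yY.
have RHS0 : 0 <= X `^ th * Y `^ (1 - th) * (x / X + y / Y).
  by apply: mulr_ge0; [rewrite mulr_ge0 ?powR_ge0|rewrite addr_ge0// divr_ge0].
have [->|x_neq0] := eqVneq x 0.
  by rewrite powR0 ?gt_eqF// !mul0r add0r mulr_ge0// ?mulr_ge0 ?powR_ge0// invr_ge0.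
have [->|y_neq0] := eqVneq y 0.
  by rewrite powR0// mulr0 mul0r addr0 mulr_ge0// ?mulr_ge0 ?powR_ge0// invr_ge0.
have xp : 0 < x by rewrite lt0r x_neq0.
have yp : 0 < y by rewrite lt0r y_neq0.
have Xp := lt_le_trans xp xX; have Yp := lt_le_trans yp yY.
have -> : x `^ th * y `^ (1 - th)
    = X `^ th * Y `^ (1 - th) * ((x / X) `^ th * (y / Y) `^ (1 - th)).
  have {1}-> : x = x / X * X by rewrite divfK ?gt_eqF.
  have {1}-> : y = y / Y * Y by rewrite divfK ?gt_eqF.
  by rewrite (powRM _ (divr_ge0 x0 X0) X0) (powRM _ (divr_ge0 y0 Y0) Y0); ring.
apply: ler_wpM2l; first by rewrite mulr_ge0 ?powR_ge0.
by apply: powR_mix_le => //; rewrite divr_ge0.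
Qed.

(** For a control [w] this is finiteness of the V-norm.  The exponents [r] and
   [alpha] are independent so that the level-k distances, where r = p/k and
   alpha = delta p - 1, are covered together with the metric case k = 1. *)
Definition V_controlled a b D r alpha w := forall u v,
  a <= u -> u < v -> v <= b -> D u v `^ r <= w u v * (v - u) `^ alpha.

(** The Nikolskii condition raised to the power [r], with the power of [h] moved
   to the right. *)
Definition N_controlled a b D r alpha w := forall u v h,
  a <= u -> u < v -> v <= b -> 0 < h -> h <= v - u ->
  Jint (fun x => D x (x + h) `^ r) u (v - h) <= w u v * h `^ (1 + alpha).

(** For theta = 1/(1+alpha) the summand is at most w^theta (y-x)^(1-theta). *)
Lemma V_controlled_variation a b D r alpha w u v :
  0 < alpha -> superadditive a b w ->
  V_controlled a b D r alpha w -> a <= u -> u < v -> v <= b ->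
  (sup_partition (fun x y => (D x y `^ (r / (1 + alpha)))%:E) u v
   <= (2 * (w u v `^ (1 + alpha)^-1 * (v - u) `^ (1 - (1 + alpha)^-1)))%:E)%E.
Proof.
move=> al0 wS wV au uv vb.
set th := (1 + alpha)^-1; set W := w u v; set L := v - u.
have th0 : 0 < th by rewrite invr_gt0; lra.
have th1 : th < 1 by rewrite invf_lt1; lra.
have alE : alpha * th = 1 - th by rewrite /th; field; lra.
have wS' := superadditiveS au vb wS.
pose c := W `^ th * L `^ (1 - th).
have c0 : 0 <= c by rewrite mulr_ge0 ?powR_ge0.
have W0 : 0 <= W by apply: wS.1 => //; exact: ltW.
have L0 : 0 < L by rewrite subr_gt0.
pose w' x y := c * (W^-1 * w x y + L^-1 * (y - x)).
have w'S : superadditive u v w'.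
  apply: superadditiveZ => //; apply: superadditiveD.
    by apply: superadditiveZ => //; rewrite invr_ge0.
  apply: superadditiveZ; first by rewrite invr_ge0 ltW.
  exact: superadditive_length.
apply: le_trans (sup_partition_le w'S _ (lexx u) (lexx v)) _.
  move=> x y ux xy yv; rewrite lee_fin /w' !(mulrC _^-1).
  have wxy0 : 0 <= w x y by apply: wS'.1 => //; exact: ltW.
  have yx0 : 0 <= y - x by rewrite subr_ge0 ltW.
  apply: (@le_trans _ _ ((w x y) `^ th * (y - x) `^ (1 - th))).
    rewrite powRrM -alE powRrM -powRM ?powR_ge0//.
    apply: ge0_ler_powR; rewrite ?nnegrE ?powR_ge0//; first exact: ltW.
      by rewrite mulr_ge0 ?powR_ge0.
    by apply: wV => //; [exact: le_trans ux|exact: le_trans vb].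
  apply: powR_mix_normalised => //.
    by apply: (superadditive_mono wS') => //; exact: ltW.
  by rewrite /L; lra.
rewrite lee_fin /w' -/W -/L (mulVf (lt0r_neq0 L0)).
rewrite mulrC; apply: ler_wpM2r => //.
suff : W^-1 * W <= 1 by lra.
by have [->|W1] := eqVneq W 0; [rewrite mulr0|rewrite mulVf].
Qed.

Lemma variation_power (alpha W L c : R) : 0 < alpha -> 0 <= W -> 0 <= L -> 0 <= c ->
  (c * (W `^ (1 + alpha)^-1 * L `^ (1 - (1 + alpha)^-1))) `^ (1 + alpha)
  = c `^ (1 + alpha) * (W * L `^ alpha).
Proof.
move=> al0 W0 L0 c0.
rewrite powRM ?mulr_ge0 ?powR_ge0// powRM ?powR_ge0// -!powRrM.
rewrite mulVf ?powRr1//; last by apply/eqP; lra.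
by congr (_ * (_ * _ `^ _)); field; lra.
Qed.

Lemma difference_le_of_split (x y x' y' c : R) :
  x + y = x' + y' -> 0 <= x -> y' <= c -> y - x' <= c.
Proof. by move=> *; lra. Qed.

(** By superadditivity w(x,x+h) <= W(x+h) - W(x) where W = w(u,.); integrating
   the difference over [u,v-h] leaves the integral of W over two intervals of
   length h, with opposite signs. *)
Lemma V_controlled_Nikolskii a b D r alpha w : 0 < alpha -> superadditive a b w ->
  (forall h, 0 < h -> locint (fun x => D x (x + h) `^ r)) ->
  V_controlled a b D r alpha w -> N_controlled a b D r alpha w.
Proof.
move=> al0 wS Dn wV u v h au uv vb h0 hvu.
have wS' := superadditiveS au vb wS.
(* Clamping extends [w u] to a monotone function on the whole line. *)
pose cl x : R := Num.max u (Num.min v x).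
have cl_itv x : u <= cl x <= v by rewrite /cl le_max lexx/= ge_max (ltW uv) ge_min lexx.
have cl_mono : {homo cl : x y / x <= y}.
  move=> x y xy; rewrite /cl ge_max !le_max lexx /=.
  by rewrite orbC le_min ge_min lexx/= ge_min xy orbT.
have cl_id x : u <= x -> x <= v -> cl x = x.
  by move=> ux xv; rewrite /cl (min_idPr xv) (max_idPr ux).
pose W x := w u (cl x).
have W_mono : {homo W : x y / x <= y}.
  move=> x y xy; have /andP[h1 h2] := cl_itv x; have /andP[h3 h4] := cl_itv y.
  by apply: (superadditive_mono wS') => //; exact: cl_mono.
have nW := nondecreasing_locint W_mono.
have W0 x : 0 <= W x.
  by have /andP[h1 h2] := cl_itv x; apply: wS'.1.
have ha0 : 0 <= h `^ alpha by exact: powR_ge0.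
have key : Jint (fun x => D x (x + h) `^ r + h `^ alpha * W x) u (v - h)
    <= Jint (fun x => h `^ alpha * W (x + h)) u (v - h).
  apply: Jint_le.
  - by apply: locintD; [exact: Dn|exact: locintZ].
  - exact/locintZ/locint_shift.
  move=> x /andP[ux xv].
  have xh : x + h <= v by lra.
  have vD := @wV x (x + h) (le_trans au ux) ltac:(lra) (le_trans xh vb).
  rewrite addrAC subrr add0r in vD.
  have := wS'.2 u x (x + h) (lexx _) ux ltac:(lra) xh.
  rewrite /W !cl_id//; [|lra..] => wD.
  apply: (@le_trans _ _ (w x (x + h) * h `^ alpha + h `^ alpha * w u x)).
    by rewrite lerD2r.
  by rewrite (mulrC (w _ _)) -mulrDr ler_wpM2l// addrC.
rewrite JintD ?JintZ ?Jint_shift ?subrK // in key; try exact: Dn; try exact: locintZ; try exact: locint_shift.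
have s1 := @Jint_split _ W u (u + h) v nW ltac:(lra) ltac:(lra).
have s2 := @Jint_split _ W u (v - h) v nW ltac:(lra) ltac:(lra).
have i1 : 0 <= Jint W u (u + h) by apply: Jint_ge0.
have i2 : Jint W (v - h) v <= W v * h.
  rewrite [leRHS](_ : _ = Jint (fun=> W v) (v - h) v).
    apply: Jint_le => // [|x /andP[_ xv]]; last exact: W_mono.
    exact/nondecreasing_locint.
  by rewrite Jint_cst ?subKr// gerBl ltW.
have WE : W v = w u v by rewrite /W cl_id// ltW.
rewrite -powR_mulC1//; last exact: ltW.
rewrite WE in i2; rewrite -lerBrDr -mulrBr in key; apply: (le_trans key).
rewrite mulrA [leRHS]mulrC; apply: ler_wpM2l => //.
exact: (difference_le_of_split (etrans (esym s1) s2)).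
Qed.

End Controls.

(** * From Nikolskii bounds to increments *)

Section Chaining.
Context {R : realType}.

Lemma half_powR_lt1 (beta : R) : 0 < beta -> 2^-1 `^ beta < 1.
Proof.
move=> b0; have := @gt0_ltr_powR R beta b0 2^-1 1.
by rewrite powR1; apply; rewrite ?nnegrE; lra.
Qed.

(** Dividing by [l], the recursion says that an average over length [l] exceeds
   the one over [l/2] by at most K l^beta.  The induction bounds the resulting
   geometric series by its fixed point instead of summing it. *)
Lemma dyadic_average (A : R -> R) (L K beta : R) : 0 < beta -> 0 <= K ->
  (forall l, 0 < l -> l <= L -> A l <= 2 * A (l / 2) + K * l * l `^ beta) ->
  (forall e, 0 < e -> exists2 eta, 0 < eta &
    forall l, 0 < l -> l < eta -> A l <= e * l) ->
  0 < L -> A L <= K / (1 - 2^-1 `^ beta) * L * L `^ beta.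
Proof.
move=> b0 K0 Astep A0 L0.
set c := 2^-1 `^ beta; have c1 : c < 1 by exact: half_powR_lt1.
(* The fixed point of kap = c kap + K. *)
set kap := K / (1 - c).
have kap0 : 0 <= kap by rewrite divr_ge0// subr_ge0 ltW.
have kapE : kap * c + K = kap by rewrite /kap; field; lra.
rewrite -[X in _ <= X]mulrA; apply/ler_addgt0Pr => e e0.
have eL0 : 0 < e / L by rewrite divr_gt0.
have [eta eta0 Aeta] := A0 _ eL0.
suff H m l : 0 < l -> l <= L -> l < eta * 2 ^+ m ->
    A l <= kap * (l * l `^ beta) + e / L * l.
  have [m Lm] : exists m, L < eta * 2 ^+ m.
    have Leta0 : 0 <= L / eta by rewrite divr_ge0// ltW.
    exists (Num.truncn (L / eta)).+1; rewrite mulrC -ltr_pdivrMr//.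
    apply: lt_le_trans (truncnS_gt _) _.
    by rewrite -natrX ler_nat ltnW// ltn_expl.
  by rewrite (le_trans (H _ _ L0 (lexx _) Lm))// divfK ?gt_eqF.
elim: m l => [|m ih] l l0 lL.
  rewrite expr0 mulr1 => leta; apply: (le_trans (Aeta _ l0 leta)).
  by rewrite lerDr mulr_ge0// mulr_ge0 ?powR_ge0 ?(ltW l0).
move=> leta; have l20 : 0 < l / 2 by lra.
apply: (le_trans (Astep _ l0 lL)).
have h2 := ih (l / 2) l20 ltac:(lra).
have {}h2 := h2 ltac:(by rewrite ltr_pdivrMr// -mulrA -exprSr).
have E : (l / 2) `^ beta = c * l `^ beta.
  by rewrite mulrC powRM ?invr_ge0 ?ltW// mulrC.
rewrite E in h2.
have -> : kap * (l * l `^ beta) = kap * c * l * l `^ beta + K * l * l `^ beta.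
  by rewrite -{1}kapE; ring.
lra.
Qed.

Variables (D : R -> R -> R) (r alpha beta Q E s t : R).
Hypothesis betaE : beta = alpha / r.
Hypotheses (D_ge0 : forall u v, 0 <= D u v) (r_ge1 : 1 <= r) (alpha_gt0 : 0 < alpha).
Hypotheses (Q_gt0 : 0 < Q) (E_ge0 : 0 <= E) (st : s < t).
Hypotheses (D_contl : forall u, continuous (D u)) (D_contr : forall v, continuous (D ^~ v)).
Hypotheses (D_contd : forall h : R, continuous (fun u => D u (u + h))).
Hypothesis D_locint : forall h, locint (fun u => D u (u + h) `^ r).
Hypotheses (Dss : D s s = 0) (Dtt : D t t = 0).
Hypothesis D_triangle : forall x u y, s <= x -> x <= u -> u <= y -> y <= t ->
  D x y <= D x u + D u y + E * (y - x) `^ beta.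
Hypothesis D_Nikolskii : forall h : R, 0 < h -> h <= t - s ->
  Jint (fun u => D u (u + h) `^ r) s (t - h) <= Q `^ r * h `^ (1 + alpha).

Let r_gt0 : 0 < r. Proof. exact: lt_le_trans ltr01 r_ge1. Qed.
Let beta_gt0 : 0 < beta. Proof. by rewrite betaE divr_gt0. Qed.
Ltac bring_hyps := have r1' := r_ge1; have r0' := r_gt0; have al0' := alpha_gt0;
  have Q0' := Q_gt0; have E0' := E_ge0; have st' := st; have beta0' := beta_gt0.

Let D_locintl u : locint (D u). Proof. exact: continuous_locint. Qed.
Let D_locintr v : locint (D ^~ v). Proof. exact: continuous_locint. Qed.
Let D_locintd h : locint (fun u => D u (u + h)). Proof. exact: continuous_locint. Qed.
Let locint_cst (c : R) : locint (fun=> c).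
Proof. by apply: continuous_locint => x; exact: cvg_cst. Qed.

(** Jensen's inequality up to a factor 2: values below the threshold [al] are
   harmless, and above it D <= al^(1-r) D^r. *)
Let shift_mean (h x : R) : 0 < h -> s <= x -> x + h <= t - h ->
  Jint (fun u => D u (u + h)) x (x + h) <= 2 * Q * h * h `^ beta.
Proof.
bring_hyps.
move=> h0 sx xh.
have hb : 0 < h `^ beta by exact: powR_gt0.
(* The size that the hypothesis gives to D(u,u+h) on average. *)
pose al := Q * h `^ beta; have al0 : 0 < al by exact: mulr_gt0.
have nZ := locintZ (al `^ (1 - r)) (D_locint h).
apply: (@le_trans _ _ (Jint (fun u => al + al `^ (1 - r) * D u (u + h) `^ r) x (x + h))).
  apply: Jint_le => //; first exact: locintD.
  move=> u _; have [Dal|alD] := leP (D u (u + h)) al.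
    by rewrite (le_trans Dal)// lerDl mulr_ge0 ?powR_ge0.
  have D0 := lt_trans al0 alD.
  suff : D u (u + h) <= al `^ (1 - r) * D u (u + h) `^ r by lra.
  rewrite -{1}[D _ _]powRr1// (_ : 1 = (1 - r) + r); last by ring.
  rewrite powRD; last by apply/implyP => _; rewrite gt_eqF.
  rewrite ler_wpM2r ?powR_ge0// addrK.
  rewrite -(opprB r) !powRN lef_pV2 ?posrE ?powR_gt0//.
  by apply: ge0_ler_powR; [rewrite subr_ge0|rewrite nnegrE ltW|rewrite nnegrE ltW|exact: ltW].
rewrite JintD// Jint_cst ?lerDl ?(ltW h0)// JintZ// addrAC subrr add0r.
have J1 : Jint (fun u => D u (u + h) `^ r) x (x + h) <= Q `^ r * h `^ (1 + alpha).
  apply: le_trans (D_Nikolskii h0 _); last lra.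
  by apply: Jint_le_itv => //; [move=> u; exact: powR_ge0|lra].
have : al `^ (1 - r) * Jint (fun u => D u (u + h) `^ r) x (x + h) <= Q * h * h `^ beta.
  apply: (@le_trans _ _ (al `^ (1 - r) * (Q `^ r * h `^ (1 + alpha)))).
    by rewrite ler_wpM2l ?powR_ge0.
  rewrite /al (powRM _ (ltW Q_gt0) (ltW hb)) -powRrM.
  have -> : Q `^ (1 - r) * h `^ (beta * (1 - r)) * (Q `^ r * h `^ (1 + alpha))
     = (Q `^ (1 - r) * Q `^ r) * (h `^ (beta * (1 - r)) * h `^ (1 + alpha)) by ring.
  rewrite -!powRD; try by apply/implyP => _; rewrite gt_eqF.
  rewrite (_ : 1 - r + r = 1) ?powRr1; [|exact: ltW|ring].
  rewrite (_ : beta * (1 - r) + (1 + alpha) = 1 + beta); last by rewrite betaE; field; lra.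
  by rewrite -(powR_mulC1 beta_gt0 (ltW h0)) mulrA.
rewrite /al; lra.
Qed.

Let E_beta_le l y x : s <= x -> x <= y -> y - x <= l -> E * (y - x) `^ beta <= E * l `^ beta.
Proof.
bring_hyps.
move=> sx xy xl; apply: ler_wpM2l => //.
apply: ge0_ler_powR; rewrite ?nnegrE; lra.
Qed.

Let step_le l h (A B : R) : 0 < l -> h = l / 2 ->
  B <= A + 2 * Q * h * h `^ beta + E * l `^ beta * h ->
  B + A <= 2 * A + (Q + E) * l * l `^ beta.
Proof.
bring_hyps.
move=> l0 hE hB.
have hb : h `^ beta <= l `^ beta.
  apply: ge0_ler_powR; rewrite ?nnegrE; lra.
have : 2 * Q * h * h `^ beta <= Q * l * l `^ beta.
  rewrite (_ : 2 * Q * h = Q * l); last by rewrite hE; field.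
  by apply: ler_wpM2l => //; rewrite mulr_ge0// ltW.
have : E * l `^ beta * h <= E * l * l `^ beta.
  rewrite hE (_ : E * l `^ beta * (l / 2) = E * l * l `^ beta / 2); last by field.
  have : 0 <= E * l * l `^ beta by rewrite !mulr_ge0 ?powR_ge0// ltW.
  lra.
lra.
Qed.

(** The right half of [s,s+l] is the translate of the left half, and passing
   from one to the other costs the gaps D(u,u+l/2). *)
Let left_average l : 0 < l -> l <= t - s ->
  Jint (D s) s (s + l) <= (Q + E) / (1 - 2^-1 `^ beta) * l * l `^ beta.
Proof.
bring_hyps.
move=> l0 ll; apply: (@dyadic_average (fun l => Jint (D s) s (s + l))) => //.
- by rewrite addr_ge0// ltW.
- move=> k k0 kl; pose h := k / 2; have h0 : 0 < h by rewrite /h; lra.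
  have kh : k = h + h by rewrite /h; field.
  rewrite (@Jint_split _ _ s (s + h)) ?lerDl ?(ltW h0)//; last by rewrite lerD2l; lra.
  rewrite addrC; apply: (step_le k0 (erefl (k / 2))); rewrite -/h.
  rewrite {1}(_ : s + k = s + h + h); last by rewrite kh addrA.
  rewrite -Jint_shift//.
  apply: (@le_trans _ _ (Jint (fun u => D s u + D u (u + h) + E * k `^ beta) s (s + h))).
    apply: Jint_le; [exact: locint_shift|apply: locintD => //; exact: locintD|].
    move=> u /andP[su uh].
    have tri : D s (u + h) <= D s u + D u (u + h) + E * (u + h - s) `^ beta.
      by apply: D_triangle => //; lra.
    apply: (le_trans tri).
    by rewrite lerD2l; apply: E_beta_le => //; lra.
  rewrite JintD ?JintD//; last exact: locintD.
  rewrite Jint_cst ?lerDl ?(ltW h0)// (_ : s + h - s = h); last ring.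
  by rewrite lerD2r lerD2l; apply: shift_mean => //; lra.
move=> e e0; have := @D_contl s s => /(@cvgrPdist_lt _ _) /(_ _ e0).
rewrite Dss => /nbhs_ballP[eta /= eta0 Heta]; exists eta => // k k0 keta.
apply: (@le_trans _ _ (Jint (fun=> e) s (s + k))); last by rewrite Jint_cst; lra.
apply: Jint_le => // u /andP[su uk].
have := Heta u; rewrite /ball /= sub0r normrN => He.
rewrite -(ger0_norm (D_ge0 s u)) ltW//; apply: He.
by rewrite distrC ger0_norm; lra.
Qed.

Let right_average l : 0 < l -> l <= t - s ->
  Jint (D ^~ t) (t - l) t <= (Q + E) / (1 - 2^-1 `^ beta) * l * l `^ beta.
Proof.
bring_hyps.
move=> l0 ll; apply: (@dyadic_average (fun l => Jint (D ^~ t) (t - l) t)) => //.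
- by rewrite addr_ge0// ltW.
- move=> k k0 kl; pose h := k / 2; have h0 : 0 < h by rewrite /h; lra.
  have kh : k = h + h by rewrite /h; field.
  rewrite (@Jint_split _ _ (t - k) (t - h))//; [|lra|lra].
  apply: (step_le k0 (erefl (k / 2))); rewrite -/h.
  have E1 : t - h = t - k + h by rewrite kh; ring.
  have -> : Jint (D ^~ t) (t - h) t = Jint (fun u => D (u + h) t) (t - k) (t - h).
    by rewrite (Jint_shift _ _ _ (D_locintr t)) -E1 subrK.
  apply: (@le_trans _ _ (Jint (fun u => D (u + h) t + D u (u + h) + E * k `^ beta) (t - k) (t - h))).
    apply: Jint_le; [by []|apply: locintD => //; apply: locintD => //|].
      exact: (locint_shift h (D_locintr t)).
    move=> u /andP[ku uh].
    rewrite (addrC (D (u + h) t)).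
    have tri : D u t <= D u (u + h) + D (u + h) t + E * (t - u) `^ beta.
      by apply: D_triangle => //; lra.
    apply: (le_trans tri).
    by rewrite lerD2l; apply: E_beta_le => //; lra.
  have n1 := locint_shift h (D_locintr t).
  rewrite JintD ?JintD//; last exact: locintD.
  rewrite Jint_cst; last lra.
  rewrite (_ : t - h - (t - k) = h); last by rewrite kh; ring.
  by rewrite lerD2r lerD2l E1; apply: shift_mean => //; lra.
move=> e e0; have := @D_contr t t => /(@cvgrPdist_lt _ _) /(_ _ e0).
rewrite /= Dtt => /nbhs_ballP[eta /= eta0 Heta]; exists eta => // k k0 keta.
apply: (@le_trans _ _ (Jint (fun=> e) (t - k) t)); last by rewrite Jint_cst; lra.
apply: Jint_le => // u /andP[su uk].
have := Heta u; rewrite /ball /= sub0r normrN => He.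
rewrite -(ger0_norm (D_ge0 u t)) ltW//; apply: He.
by rewrite ger0_norm; lra.
Qed.

(** Average D(s,t) <= D(s,u) + D(u,t) + error over all u in [s,t]; the average
   at each end point is bounded by comparing it with shorter ones, down to
   length 0 where it vanishes by continuity. *)
Lemma chaining_bound :
  D s t <= (2 / (1 - 2^-1 `^ beta) + 1) * (Q + E) * (t - s) `^ beta.
Proof.
bring_hyps.
have L0 : 0 < t - s by lra.
have := left_average L0 (lexx _); have := right_average L0 (lexx _).
rewrite opprB !(addrC _ (_ - _)) !subrK => hr hl.
have : D s t * (t - s) <= Jint (D s) s t + Jint (D ^~ t) s t + E * (t - s) `^ beta * (t - s).
  rewrite -[leLHS]Jint_cst ?(ltW st)//.
  rewrite -[X in _ + X]Jint_cst ?(ltW st)//.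
  rewrite -!JintD//; last exact: locintD.
  apply: Jint_le => //; first by apply: locintD => //; exact: locintD.
  by move=> u /andP[su ut]; exact: D_triangle.
move=> h; rewrite -(ler_pM2r L0); apply: (le_trans h).
set c := (1 - _)^-1 in hr hl *.
have Qb : 0 <= Q * (t - s) * (t - s) `^ beta by rewrite !mulr_ge0 ?powR_ge0// ltW.
have -> : (2 * c + 1) * (Q + E) * (t - s) `^ beta * (t - s)
  = (Q + E) * c * (t - s) * (t - s) `^ beta + (Q + E) * c * (t - s) * (t - s) `^ beta
    + E * (t - s) `^ beta * (t - s) + Q * (t - s) * (t - s) `^ beta by ring.
lra.
Qed.

End Chaining.

(** * Riemann-Stieltjes integrals *)

Section RiemannStieltjes.
Context {R : realType}.
Implicit Types (f g : R -> R) (P V : R -> R -> R) (a b s t u v c e : R).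

Definition ucont a b f := forall e, 0 < e -> exists2 eta, 0 < eta &
  forall x y, a <= x -> x <= b -> a <= y -> y <= b -> `|x - y| < eta ->
    `|f x - f y| < e.

Definition bounded_on a b f := exists K, forall x, a <= x -> x <= b -> `|f x| <= K.

Definition nonneg_on a b P := forall u v, a <= u -> u <= v -> v <= b -> 0 <= P u v.

Lemma mulr_frac_lt (e k : R) : 0 < e -> 0 <= k -> e / (k + 1) * k < e.
Proof. by move=> e0 k0; rewrite mulrAC ltr_pdivrMr ?ltr_pM2l; lra. Qed.

Lemma additive_on0 a b (I : R -> R -> R) s : additive_on a b I -> a <= s -> s <= b -> I s s = 0.
Proof. by move=> IA as_ sb; have := IA s s s as_ (lexx _) (lexx _) sb; lra. Qed.

Definition inf_on f u v := inf [set f x | x in `[u, v]].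

(** [L] is the supremum of the lower Riemann sums.  Lower sums increase under
   refinement, so the supremum is additive in the interval. *)
Lemma lower_integral a b f P : a <= b -> (forall x, 0 <= f x) ->
  bounded_on a b f -> additive_on a b P -> nonneg_on a b P ->
  exists L : R -> R -> R, additive_on a b L /\
    forall u v c1 c2, a <= u -> u <= v -> v <= b ->
      (forall x, u <= x -> x <= v -> c1 <= f x <= c2) ->
      c1 * P u v <= L u v <= c2 * P u v.
Proof.
move=> ab f0 [K fK] PA P0.
pose m := inf_on f.
have lbf u v : has_lbound [set f x | x in `[u, v]].
  by exists 0 => _ [x _ <-].
have m_le u v x : u <= x -> x <= v -> m u v <= f x.
  by move=> ux xv; apply: ge_inf => //; exists x => //=; rewrite in_itv /= ux xv.
have m_ge u v c : u <= v -> (forall x, u <= x -> x <= v -> c <= f x) -> c <= m u v.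
  move=> uv cf; apply: lb_le_inf.
    by exists (f u); exists u => //=; rewrite in_itv /= lexx.
  by move=> _ [x /= + <-]; rewrite in_itv /= => /andP[? ?]; exact: cf.
have m0 u v : u <= v -> 0 <= m u v by move=> uv; apply: m_ge.
(* The absolute value only serves to make [F] nonnegative for all [u] and [v]. *)
pose F u v : \bar R := `|m u v * P u v|%:E.
have F0 u v : (0 <= F u v)%E by rewrite lee_fin.
have FE u v : a <= u -> u <= v -> v <= b -> F u v = (m u v * P u v)%:E.
  by move=> au uv vb; rewrite /F ger0_norm// mulr_ge0 ?m0 ?P0.
have PS := additive_on_superadditive P0 PA.
have Fup u v c : a <= u -> u <= v -> v <= b ->
    (forall x, u <= x -> x <= v -> f x <= c) ->
    (sup_partition F u v <= (c * P u v)%:E)%E.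
  move=> au uv vb fc.
  have c0 : 0 <= c by apply: le_trans (fc u _ _).
  apply: (@sup_partition_le _ u v F (fun x y => c * P x y)) => //.
    by apply: superadditiveZ => //; exact: superadditiveS PS.
  move=> x y ux xy yv; have xy' := ltW xy.
  have ax := le_trans au ux; have yb := le_trans yv vb.
  rewrite FE// lee_fin ler_wpM2r ?P0//.
  by apply: le_trans (m_le _ _ x _ _) (fc x _ _) => //; exact: le_trans yv.
have Ffin : (sup_partition F a b < +oo)%E.
  apply: (le_lt_trans (Fup a b K (lexx _) ab (lexx _) _)); last exact: ltry.
  by move=> x ax xb; rewrite (le_trans (ler_norm _))// fK.
have LA : additive_on a b (sup_control F).
  apply: sup_control_additive => // x y z ax xy yz zb.
  have [xy' yz'] := (ltW xy, ltW yz).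
  have xz := le_trans xy' yz'; have ay := le_trans ax xy'; have yb := le_trans yz' zb.
  rewrite !FE// -EFinD lee_fin -(PA x y z)// mulrDr.
  apply: lerD; apply: ler_wpM2r; rewrite ?P0//; apply: m_ge => // w h1 h2; apply: m_le => //.
    exact: le_trans yz'.
  exact: le_trans h1.
exists (sup_control F); split=> // u v c1 c2 au uv vb fc.
apply/andP; split; last first.
  rewrite -lee_fin (sup_controlE F0 Ffin au uv vb); apply: Fup => // x ux xv.
  by have /andP[] := fc x ux xv.
move: uv; rewrite le_eqVlt => /orP[/eqP uvE|uv].
  have ub : u <= b by rewrite uvE.
  by rewrite -uvE (additive_on0 LA au ub) (additive_on0 PA au ub) mulr0.
have := sup_control_dominates F0 Ffin au uv vb.
have uv' := ltW uv.
rewrite FE// lee_fin; apply: le_trans; rewrite ler_wpM2r ?P0//.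
by apply: m_ge => // x ux xv; have /andP[] := fc x ux xv.
Qed.

Lemma fine_partition s t eta : s <= t -> 0 < eta ->
  exists2 r, itv_partition s t r & forall i, (i < size r)%N ->
    nth t (s :: r) i.+1 - nth t (s :: r) i < eta.
Proof.
move=> st eta0.
have [n tsn] : exists n : nat, t - s <= n%:R * (eta / 2).
  exists (Num.truncn ((t - s) / (eta / 2))).+1.
  rewrite -ler_pdivrMr; last lra.
  by apply: ltW; apply: truncnS_gt.
elim: n s st tsn => [|n ih] s st tsn.
  have -> : s = t by move: tsn; rewrite mul0r => tsn; lra.
  by exists [::].
have [ts|ts] := ltP (t - s) eta.
  move: st; rewrite le_eqVlt => /orP[/eqP -> |st]; first by exists [::].
  exists [:: t]; first exact: itv_partition1.
  by case=> [|//] _ /=.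
have [||r rP rmesh] := ih (s + eta / 2); [lra| |].
  by move: tsn; rewrite -natr1 mulrDl; lra.
exists (s + eta / 2 :: r).
  by apply/itv_partition_consE; split=> //; lra.
case=> [|i] /= ir; last exact: rmesh.
lra.
Qed.

Lemma is_RSint_unique f g s t I1 I2 : s <= t ->
  is_RSint f g s t I1 -> is_RSint f g s t I2 -> I1 = I2.
Proof.
move=> st h1 h2; apply/eqP; rewrite -subr_eq0 -normr_le0.
apply/ler_addgt0Pr => e e0; rewrite add0r.
have e20 : 0 < e / 2 by lra.
have [eta1 eta10 H1] := h1 _ e20; have [eta2 eta20 H2] := h2 _ e20.
have eta0 : 0 < Num.min eta1 eta2 by rewrite lt_min eta10.
have [r rP rm] := fine_partition st eta0.
have tag i : (i < size r)%N ->
    nth t (s :: r) i <= nth t (s :: r) i <= nth t (s :: r) i.+1.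
  by move=> ir; rewrite lexx ltW// itv_partition_nth_lt.
have := H1 r (nth t (s :: r)) rP; have := H2 r (nth t (s :: r)) rP.
set S := \sum_(0 <= i < _) _ => B2 B1.
have {}B1 : `|S - I1| < e / 2.
  by apply: B1 => i ir; split; [exact: tag|move: (rm i ir); rewrite lt_min => /andP[]].
have {}B2 : `|S - I2| < e / 2.
  by apply: B2 => i ir; split; [exact: tag|move: (rm i ir); rewrite lt_min => /andP[]].
rewrite (_ : I1 - I2 = (S - I2) - (S - I1)); last by ring.
apply: (le_trans (ler_normB _ _)); lra.
Qed.

Lemma RSintP f g s t I : s <= t -> is_RSint f g s t I -> RSint f g s t = I.
Proof.
move=> st fI; apply: (is_RSint_unique st _ fI).
exact: (@xgetPex _ 0 (is_RSint f g s t) (ex_intro _ I fI)).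
Qed.

(** Split the integrator into its monotone parts (V + dg)/2 and (V - dg)/2 and
   make the integrand nonnegative by adding a constant; the difference of the
   two lower integrals is additive and, on each interval of a partition, at
   distance at most osc(f) V from the corresponding term of a Riemann sum. *)
Lemma RSint_continuous_bv a b f g V : a <= b ->
  additive_on a b V ->
  (forall u v, a <= u -> u <= v -> v <= b -> `|g v - g u| <= V u v) ->
  ucont a b f -> bounded_on a b f ->
  [/\ additive_on a b (RSint f g),
      forall u v, a <= u -> u <= v -> v <= b -> is_RSint f g u v (RSint f g u v) &
      forall u v c e, a <= u -> u <= v -> v <= b ->
        (forall x, u <= x -> x <= v -> `|f x - c| <= e) ->
        `|RSint f g u v - c * (g v - g u)| <= e * V u v].
Proof.
move=> ab VA gV fu [K fK].
(* The absolute value makes [f'] nonnegative outside [a, b] as well. *)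
pose f' x := `|f x + K|.
have f'E x : a <= x -> x <= b -> f' x = f x + K.
  move=> ax xb; rewrite /f' ger0_norm//.
  by have := fK x ax xb; rewrite ler_norml => /andP[]; lra.
have f'0 x : 0 <= f' x by exact: normr_ge0.
have f'K : bounded_on a b f'.
  exists (K + `|K|) => x ax xb; rewrite ger0_norm//.
  by rewrite (le_trans (ler_normD _ _))// lerD// fK.
have V0 : nonneg_on a b V.
  by move=> u v h1 h2 h3; exact: le_trans (normr_ge0 _) (gV u v h1 h2 h3).
(* The positive and negative variations, as functions of the interval. *)
pose P1 u v := (V u v + (g v - g u)) / 2.
pose P2 u v := (V u v - (g v - g u)) / 2.
have P1A : additive_on a b P1.
  by move=> s u t h1 h2 h3 h4; rewrite /P1 -(VA s u t)//; field.
have P2A : additive_on a b P2.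
  by move=> s u t h1 h2 h3 h4; rewrite /P2 -(VA s u t)//; field.
have P10 : nonneg_on a b P1.
  move=> u v h1 h2 h3; have := gV u v h1 h2 h3.
  by rewrite ler_norml /P1 => /andP[]; lra.
have P20 : nonneg_on a b P2.
  move=> u v h1 h2 h3; have := gV u v h1 h2 h3.
  by rewrite ler_norml /P2 => /andP[]; lra.
have [L1 [L1A L1b]] := lower_integral ab f'0 f'K P1A P10.
have [L2 [L2A L2b]] := lower_integral ab f'0 f'K P2A P20.
pose I u v := L1 u v - L2 u v - K * (g v - g u).
have IA : additive_on a b I.
  by move=> s u t h1 h2 h3 h4; rewrite /I -(L1A s u t)// -(L2A s u t)//; ring.
have Ib u v c e : a <= u -> u <= v -> v <= b ->
    (forall x, u <= x -> x <= v -> `|f x - c| <= e) ->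
    `|I u v - c * (g v - g u)| <= e * V u v.
  move=> au uv vb fc.
  have fc' x : u <= x -> x <= v -> c + K - e <= f' x <= c + K + e.
    move=> ux xv; rewrite f'E ?(le_trans au)// ?(le_trans xv)//.
    by have := fc x ux xv; rewrite ler_norml => /andP[]; lra.
  have /andP[] := L1b u v _ _ au uv vb fc'.
  have /andP[] := L2b u v _ _ au uv vb fc'.
  rewrite ler_norml /I /P1 /P2; lra.
have IRS u v : a <= u -> u <= v -> v <= b -> is_RSint f g u v (I u v).
  move=> au uv vb e e0.
  have Vab0 : 0 <= V u v by exact: V0.
  have e'0 : 0 < e / (V u v + 1) by rewrite divr_gt0//; lra.
  have [eta eta0 Heta] := fu _ e'0; exists eta => // r xi rP Hxi.
  rewrite -(sum_partition_additive IA au vb rP) -sumrB.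
  apply: (le_lt_trans (ler_norm_sum _ _ _)).
  apply: (@le_lt_trans _ _ (\sum_(0 <= i < size r)
      (e / (V u v + 1) * V (nth v (u :: r) i) (nth v (u :: r) i.+1)))).
    apply: ler_sum_nat => i /andP[_ ir].
    have [/andP[x1 x2] x3] := Hxi i ir.
    have n1 : a <= nth v (u :: r) i.
      by apply: (le_trans au); apply: itv_partition_nth_ge => //; rewrite ltnS ltnW.
    have n2 : nth v (u :: r) i.+1 <= b.
      by apply: (le_trans _ vb); apply: itv_partition_nth_le.
    have n12 : nth v (u :: r) i <= nth v (u :: r) i.+1 by rewrite (le_trans x1).
    rewrite distrC; apply: Ib => // x ux xv; apply/ltW/Heta; try lra.
    by rewrite ltr_norml; lra.
  rewrite -mulr_sumr (sum_partition_additive VA au vb rP).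
  exact: mulr_frac_lt.
have RSE u v : a <= u -> u <= v -> v <= b -> RSint f g u v = I u v.
  by move=> au uv vb; apply: RSintP => //; exact: IRS.
split.
- move=> s u t h1 h2 h3 h4; rewrite !RSE ?IA//; [exact: le_trans h3|exact: le_trans h1 _|exact: le_trans h4].
- by move=> u v h1 h2 h3; rewrite RSE//; exact: IRS.
- by move=> u v c e h1 h2 h3; rewrite RSE//; exact: Ib.
Qed.

Lemma is_RSint_lin f1 f2 g s t c I1 I2 :
  is_RSint f1 g s t I1 -> is_RSint f2 g s t I2 ->
  is_RSint (fun x => c * f1 x + f2 x) g s t (c * I1 + I2).
Proof.
move=> h1 h2 e e0.
have c1 : 0 < `|c| + 1 by rewrite ltr_wpDl.
have e10 : 0 < e / 2 / (`|c| + 1) by rewrite !divr_gt0.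
have e20 : 0 < e / 2 by rewrite divr_gt0.
have [eta1 eta10 H1] := h1 _ e10; have [eta2 eta20 H2] := h2 _ e20.
exists (Num.min eta1 eta2); first by rewrite lt_min eta10.
move=> r xi rP Hxi.
have {}H1 : `|\sum_(0 <= i < size r) f1 (xi i) *
    (g (nth t (s :: r) i.+1) - g (nth t (s :: r) i)) - I1| < e / 2 / (`|c| + 1).
  by apply: H1 => // i /Hxi[? +]; rewrite lt_min => /andP[].
have {}H2 : `|\sum_(0 <= i < size r) f2 (xi i) *
    (g (nth t (s :: r) i.+1) - g (nth t (s :: r) i)) - I2| < e / 2.
  by apply: H2 => // i /Hxi[? +]; rewrite lt_min => /andP[].
under eq_bigr do rewrite mulrDl -mulrA.
rewrite big_split /= -mulr_sumr; move: H1 H2.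
set S1 := \sum_(0 <= i < _) _; set S2 := \sum_(0 <= i < _) _ => H1 H2.
rewrite (_ : c * S1 + S2 - (c * I1 + I2) = c * (S1 - I1) + (S2 - I2)); last by ring.
apply: (le_lt_trans (ler_normD _ _)); rewrite normrM.
have : `|c| * `|S1 - I1| <= e / 2.
  rewrite ltr_pdivlMr// in H1; have := normr_ge0 (S1 - I1); lra.
lra.
Qed.

Lemma is_RSint0 g s t : is_RSint (fun=> 0) g s t 0.
Proof.
move=> e e0; exists 1 => // r xi _ _; rewrite big1 ?subrr ?normr0//.
by move=> i _; rewrite mul0r.
Qed.

Lemma is_RSint_sum (J : Type) (js : seq J) (F : R -> J -> R) (c : J -> R) (I : J -> R) g s t :
  (forall j, is_RSint (F ^~ j) g s t (I j)) ->
  is_RSint (fun x => \sum_(j <- js) F x j * c j) g s t (\sum_(j <- js) I j * c j).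
Proof.
move=> FI; elim: js => [|j js ih].
  rewrite big_nil (_ : (fun _ => _) = (fun=> 0)); first exact: is_RSint0.
  by apply/funext => x; rewrite big_nil.
rewrite big_cons (_ : (fun _ => _) = (fun x => c j * F x j + \sum_(j <- js) F x j * c j)).
  by rewrite mulrC; exact: is_RSint_lin.
by apply/funext => x; rewrite big_cons mulrC.
Qed.

Lemma is_RSint_affine f g f' g' s t k d z I : 0 < k -> s <= t ->
  (forall u, s <= u -> u <= t -> f u = f' (k * u + d)) ->
  (forall u, s <= u -> u <= t -> g u = g' (k * u + d) + z) ->
  is_RSint f' g' (k * s + d) (k * t + d) I -> is_RSint f g s t I.
Proof.
move=> k0 st fE gE h e e0; have [eta eta0 H] := h _ e0.
exists (eta / k); first exact: divr_gt0.
move=> r xi rP Hxi.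
pose phi u := k * u + d.
have phi_lt u v : (phi u < phi v) = (u < v) by rewrite ltrD2r ltr_pM2l.
have phi_le u v : (phi u <= phi v) = (u <= v) by rewrite lerD2r ler_pM2l.
have nthE i : nth (phi t) (phi s :: map phi r) i = phi (nth t (s :: r) i).
  rewrite -map_cons; have [ir|ir] := ltnP i (size (s :: r)).
    by rewrite (nth_map t).
  by rewrite !nth_default ?size_map.
have rP' : itv_partition (phi s) (phi t) (map phi r).
  elim: r s {st fE gE h H Hxi nthE} rP => [|x r ih] s.
    by move=> /itv_partition_nil ->.
  move=> /itv_partition_consE[sx xr] /=; apply/itv_partition_consE.
  by rewrite phi_lt sx; split=> //; exact: ih.
have nth_itv i : (i <= size r)%N -> s <= nth t (s :: r) i <= t.
  by move=> ir; rewrite itv_partition_nth_ge//= itv_partition_nth_le.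
have := H (map phi r) (phi \o xi) rP'; rewrite size_map.
under eq_bigr do rewrite !nthE.
move=> H'; rewrite (_ : \sum_(0 <= i < size r) _ = \sum_(0 <= i < size r)
   (f' \o (phi \o xi)) i * (g' (phi (nth t (s :: r) i.+1)) - g' (phi (nth t (s :: r) i)))).
  apply: H' => i ir; rewrite !nthE !phi_le; have [h1 h2] := Hxi i ir; split=> //.
  by move: h2; rewrite /phi ltr_pdivlMr// => h2; lra.
apply: eq_big_nat => i /andP[_ ir].
have [/andP[h1 h2] _] := Hxi i ir.
have /andP[n1 n2] := nth_itv i (ltnW ir); have /andP[n3 n4] := nth_itv i.+1 ir.
rewrite fE ?gE//; [|lra..].
by rewrite /phi /=; ring.
Qed.

(** The two integrals are limits of the same sums, so they agree whether or not
   they exist. *)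
Lemma RSint_affine f g f' g' s t k d z : 0 < k -> s <= t ->
  (forall u, s <= u -> u <= t -> f u = f' (k * u + d)) ->
  (forall u, s <= u -> u <= t -> g u = g' (k * u + d) + z) ->
  RSint f g s t = RSint f' g' (k * s + d) (k * t + d).
Proof.
move=> k0 st fE gE; rewrite /RSint; congr xget; apply/funext => I; apply/propext.
split; last exact: is_RSint_affine gE.
have inv u : k^-1 * (k * u + d) + - k^-1 * d = u by field; lra.
have inv' u : k * (k^-1 * u + - k^-1 * d) + d = u by field; lra.
have itv u : k * s + d <= u -> u <= k * t + d ->
    s <= k^-1 * u + - k^-1 * d <= t.
  move=> h1 h2; have := inv' u; set y := k^-1 * u + _ => yE.
  rewrite -yE !lerD2r !ler_pM2l// in h1 h2.
  by rewrite h1.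
move=> h; apply: (@is_RSint_affine _ _ f g _ _ k^-1 (- k^-1 * d) (- z)).
- by rewrite invr_gt0.
- by rewrite lerD2r ler_pM2l.
- by move=> u h1 h2; have /andP[? ?] := itv u h1 h2; rewrite fE// inv'.
- by move=> u h1 h2; have /andP[? ?] := itv u h1 h2; rewrite gE// inv' addrK.
- by rewrite !inv.
Qed.

End RiemannStieltjes.

(** * Functions on words *)

Section Convolution.
Context {R : realType} {T : Type}.
Implicit Types (A B C : seq T -> R) (w : seq T).

(** The product of noncommutative power series, a word being a monomial.
   Truncation is postponed so that lengths of words need not be tracked. *)
Definition wmul A B w : R := \sum_(0 <= i < (size w).+1) A (take i w) * B (drop i w).

Definition wone w : R := (size w == 0%N)%:R.

Lemma wmul_nil A B : wmul A B [::] = A [::] * B [::].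
Proof. by rewrite /wmul big_nat1. Qed.

Lemma wmul_cons A B x w :
  wmul A B (x :: w) = A [::] * B (x :: w) + wmul (fun v => A (x :: v)) B w.
Proof. by rewrite /wmul /= big_nat_recl. Qed.

Lemma eq_wmul A A' B B' w :
  (forall v, (size v <= size w)%N -> A v = A' v) ->
  (forall v, (size v <= size w)%N -> B v = B' v) ->
  wmul A B w = wmul A' B' w.
Proof.
move=> AE BE; apply: eq_big_nat => i /andP[_ iw].
by rewrite AE ?BE// ?size_drop ?leq_subr// size_take_min geq_minr.
Qed.

Lemma wmul_linl c A A' B w :
  wmul (fun v => c * A v + A' v) B w = c * wmul A B w + wmul A' B w.
Proof.
by rewrite /wmul mulr_sumr -big_split; apply: eq_bigr => i _ /=; ring.
Qed.

Lemma wmul0l B w : wmul (fun=> 0) B w = 0.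
Proof. by rewrite /wmul big1// => i _; rewrite mul0r. Qed.

(** By [wmul_cons], removing the first letter of the word acts on the left
   factor alone, up to a term in which that factor is a constant. *)
Lemma wmulA A B C w : wmul (wmul A B) C w = wmul A (wmul B C) w.
Proof.
elim: w A => [|x w ih] A; first by rewrite !wmul_nil mulrA.
rewrite !wmul_cons wmul_nil -ih.
rewrite (_ : (fun v => _) = (fun v => A [::] * B (x :: v) + wmul (fun v => A (x :: v)) B v)).
  by rewrite wmul_linl; ring.
by apply/funext => v; rewrite wmul_cons.
Qed.

Lemma wmul1l A w : wmul wone A w = A w.
Proof.
case: w => [|x w]; first by rewrite wmul_nil mul1r.
by rewrite wmul_cons mul1r (_ : (fun _ => _) = (fun=> 0)) ?wmul0l ?addr0.
Qed.

Lemma wmul1r A w : wmul A wone w = A w.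
Proof.
elim: w A => [|x w ih] A; first by rewrite wmul_nil mulr1.
by rewrite wmul_cons ih mulr0 add0r.
Qed.

Lemma wmul_rev A B w :
  wmul A B (rev w) = wmul (fun v => B (rev v)) (fun v => A (rev v)) w.
Proof.
rewrite /wmul size_rev [LHS]big_nat_rev; apply: eq_big_nat => i /andP[_ iw].
rewrite add0n subSS take_rev drop_rev subKn -1?ltnS// mulrC.
by [].
Qed.

End Convolution.

(** * Iterated integrals *)

Section IteratedIntegrals.
Context {R : realType} {n : nat}.
Implicit Types (Z : R -> 'rV[R]_n) (V : R -> R -> R) (a b s t u e : R).

(** In all uses [V] is the length of [Z] over an interval. *)
Definition path_control a b Z V := [/\ additive_on a b V, nonneg_on a b V,
  forall u v i, a <= u -> u <= v -> v <= b -> `|Z v 0 i - Z u 0 i| <= V u v &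
  forall i, ucont a b (fun u => Z u 0 i)].

Lemma path_controlS a b a' b' Z V : a <= a' -> b' <= b ->
  path_control a b Z V -> path_control a' b' Z V.
Proof.
move=> aa bb [VA V0 ZV Zu]; split.
- by move=> s u t h1 h2 h3 h4; apply: VA => //; [exact: le_trans h1|exact: le_trans bb].
- by move=> u v h1 h2 h3; apply: V0 => //; [exact: le_trans h1|exact: le_trans bb].
- by move=> u v i h1 h2 h3; apply: ZV => //; [exact: le_trans h1|exact: le_trans bb].
- move=> i e e0; have [eta eta0 H] := Zu i e e0; exists eta => // x y h1 h2 h3 h4.
  by apply: H; rewrite ?(le_trans aa)// (le_trans _ bb).
Qed.

Lemma path_control_super a b Z V : path_control a b Z V -> superadditive a b V.
Proof. by move=> [VA V0 _ _]; exact: additive_on_superadditive. Qed.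

(** Continuity and boundedness are proved together: they are what makes the
   integral against the next letter exist. *)
Lemma iter_int_rev_props a b Z V s w : path_control a b Z V -> a <= s -> s <= b ->
  ucont s b (iter_int_rev Z s w) /\
  forall t, s <= t -> t <= b -> `|iter_int_rev Z s w t| <= V s t ^+ size w.
Proof.
move=> pc0 as_ sb; have pc := path_controlS as_ (lexx b) pc0.
have VS := path_control_super pc; have [VA V0 ZV Zu] := pc.
elim: w => [|i w [ihu ihb]].
  split=> [e e0|t _ _]; last by rewrite normr1 expr0.
  by exists 1 => // x y *; rewrite /= subrr normr0.
have bnd t : s <= t -> t <= b -> bounded_on s t (iter_int_rev Z s w).
  move=> st tb; exists (V s t ^+ size w) => x sx xt.
  apply: (le_trans (ihb x sx (le_trans xt tb))).
  apply: lerXn2r; rewrite ?nnegrE ?V0// ?(le_trans xt)//.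
  by apply: (superadditive_mono VS).
have [RA _ Rb] := @RSint_continuous_bv _ s b _ (fun u => Z u 0 i) V sb VA (fun u v => ZV u v i)
  ihu (bnd b sb (lexx _)).
split; last first.
  move=> t st tb /=.
  have := Rb s t 0 (V s t ^+ size w) (lexx _) st tb.
  rewrite mul0r subr0 exprSr; apply=> x sx xt; rewrite subr0.
  apply: (le_trans (ihb x sx (le_trans xt tb))).
  apply: lerXn2r; rewrite ?nnegrE ?V0// ?(le_trans xt)//.
  by apply: (superadditive_mono VS).
have [K fK] := bnd b sb (lexx b).
have K0 : 0 <= K by apply: le_trans (fK s (lexx _) sb).
have Vsb : 0 <= V s b by exact: V0.
move=> e e0.
have e10 : 0 < e / 2 / (V s b + 1) by rewrite !divr_gt0//; lra.
have e20 : 0 < e / 2 / (K + 1) by rewrite !divr_gt0//; lra.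
have [eta1 eta10 H1] := ihu _ e10; have [eta2 eta20 H2] := Zu i _ e20.
exists (Num.min eta1 eta2); first by rewrite lt_min eta10.
have main x y : s <= x -> x <= y -> y <= b -> `|y - x| < Num.min eta1 eta2 ->
    `|iter_int_rev Z s (i :: w) y - iter_int_rev Z s (i :: w) x| < e.
  move=> sx xy yb; rewrite lt_min => /andP[d1 d2].
  have xb := le_trans xy yb; have sy := le_trans sx xy.
  rewrite /= -(RA s x y)// (addrC (RSint _ _ s x)) addrK.
  have B : `|RSint (iter_int_rev Z s w) (fun u => Z u 0 i) x y
      - iter_int_rev Z s w x * (Z y 0 i - Z x 0 i)| <= e / 2 / (V s b + 1) * V x y.
    apply: Rb => // z xz zy; apply/ltW/H1 => //.
    - exact: le_trans xz.
    - exact: le_trans yb.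
    - by apply: le_lt_trans d1; rewrite !ger0_norm ?subr_ge0// lerD2r.
  have B2 : `|iter_int_rev Z s w x * (Z y 0 i - Z x 0 i)| <= K * (e / 2 / (K + 1)).
    rewrite normrM ler_pM//; first exact: fK.
    exact/ltW/H2.
  have Vxy : V x y <= V s b by apply: (superadditive_mono VS).
  have B3 : e / 2 / (V s b + 1) * V x y <= e / 2 / (V s b + 1) * V s b.
    by apply: ler_wpM2l => //; exact: ltW.
  have B4 : e / 2 / (V s b + 1) * V s b < e / 2.
    by apply: mulr_frac_lt => //; rewrite divr_gt0.
  have B5 : K * (e / 2 / (K + 1)) < e / 2.
    by rewrite mulrC; apply: mulr_frac_lt => //; rewrite divr_gt0.
  rewrite -[X in `|X|](subrK (iter_int_rev Z s w x * (Z y 0 i - Z x 0 i))).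
  apply: (le_lt_trans (ler_normD _ _)); lra.
move=> x y sx xb sy yb dxy; have [xy|/ltW yx] := leP x y.
  by rewrite distrC; apply: main => //; rewrite distrC.
exact: main.
Qed.

Lemma iter_int_rev_RS a b Z V s i w : path_control a b Z V -> a <= s -> s <= b ->
  let F := iter_int_rev Z s w in let g := (fun u => Z u 0 i) in
  [/\ additive_on s b (RSint F g),
      forall u v, s <= u -> u <= v -> v <= b -> is_RSint F g u v (RSint F g u v) &
      forall u v c e, s <= u -> u <= v -> v <= b ->
        (forall x, u <= x -> x <= v -> `|F x - c| <= e) ->
        `|RSint F g u v - c * (g v - g u)| <= e * V u v].
Proof.
move=> pc0 as_ sb F g; have pc := path_controlS as_ (lexx b) pc0.
have VS := path_control_super pc; have [VA V0 ZV Zu] := pc.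
have [Fu Fb] := iter_int_rev_props w pc0 as_ sb.
apply: RSint_continuous_bv => //; first by move=> u v; exact: ZV.
exists (V s b ^+ size w) => x sx xb; apply: (le_trans (Fb x sx xb)).
by apply: lerXn2r; rewrite ?nnegrE ?V0//; apply: (superadditive_mono VS).
Qed.

(** The outermost integral over [s,t] splits at [u]; the part over [u,t] is
   linear in the inner integral, to which the induction hypothesis applies.  The
   factors are exchanged because words are read backwards. *)
Lemma iter_int_rev_Chen a b Z V s u t w : path_control a b Z V ->
  a <= s -> s <= u -> u <= t -> t <= b ->
  iter_int_rev Z s w t =
  wmul (fun v => iter_int_rev Z u v t) (fun v => iter_int_rev Z s v u) w.
Proof.
move=> pc as_ su + tb.
have au := le_trans as_ su.
elim: w t tb => [|i w ih] t tb ut.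
  by rewrite wmul_nil /= mulr1.
have ub := le_trans ut tb; have sb := le_trans su ub; have st := le_trans su ut.
have [RA _ _] := iter_int_rev_RS i w pc as_ sb.
rewrite wmul_cons mul1r [LHS]/= -(RA s u t)//; congr (_ + _).
apply: RSintP => //.
have ext f1 f2 g (x y I : R) : (forall z, x <= z -> z <= y -> f1 z = f2 z) ->
    is_RSint f1 g x y I -> is_RSint f2 g x y I.
  move=> f12 H e e0; have [eta eta0 He] := H e e0; exists eta => // r xi rP Hxi.
  rewrite (_ : \sum_(0 <= j < size r) _ = \sum_(0 <= j < size r)
      f1 (xi j) * (g (nth y (x :: r) j.+1) - g (nth y (x :: r) j))); first exact: He.
  apply: eq_big_nat => j /andP[_ jr]; rewrite f12//.
    have [/andP[h _] _] := Hxi j jr; apply: le_trans h.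
    by apply: itv_partition_nth_ge => //; rewrite ltnS ltnW.
  have [/andP[_ h] _] := Hxi j jr; apply: (le_trans h).
  exact: itv_partition_nth_le.
apply: (ext (fun x => wmul (fun v => iter_int_rev Z u v x) (fun v => iter_int_rev Z s v u) w)).
  by move=> z uz zt; rewrite -ih// (le_trans zt).
rewrite /wmul; apply: is_RSint_sum => j /=.
have [_ RS _] := iter_int_rev_RS i (take j w) pc au ub.
exact: RS.
Qed.

Lemma iter_int_rev1 a b Z V s t i : path_control a b Z V ->
  a <= s -> s <= t -> t <= b ->
  iter_int_rev Z s [:: i] t = Z t 0 i - Z s 0 i.
Proof.
move=> pc as_ st tb; have sb := le_trans st tb.
have [_ _ Rb] := iter_int_rev_RS i [::] pc as_ sb.
have := Rb s t 1 0 (lexx _) st tb; rewrite mul0r mul1r => H.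
apply/eqP; rewrite -subr_eq0 -normr_le0; apply: H => x _ _.
by rewrite /= subrr normr0.
Qed.

(** On a short interval this improves the bound V^|w|: the innermost integral is
   an increment of [Z], small by continuity of [Z] alone. *)
Lemma iter_int_rev_small a b Z V s t e w : path_control a b Z V ->
  a <= s -> s <= t -> t <= b -> 0 <= e -> (0 < size w)%N ->
  (forall x i, s <= x -> x <= t -> `|Z x 0 i - Z s 0 i| <= e) ->
  `|iter_int_rev Z s w t| <= e * V s t ^+ (size w).-1.
Proof.
move=> pc as_ + + e0; elim: w t => [//|i w ih] t st tb _ Ze.
have sb := le_trans st tb; have VS := path_control_super pc; have [VA V0 ZV Zu] := pc.
case: w ih => [|j w] ih.
  by rewrite (iter_int_rev1 _ pc)// expr0 mulr1; exact: Ze.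
have [_ _ Rb] := iter_int_rev_RS i (j :: w) pc as_ sb.
have := Rb s t 0 (e * V s t ^+ size w) (lexx _) st tb.
rewrite mul0r subr0 [size _]/= [_.-1]/= exprSr mulrA; apply=> x sx xt.
rewrite subr0; apply: (le_trans (ih x sx (le_trans xt tb) _ _)) => //.
  by move=> y k sy yx; apply: Ze => //; exact: le_trans xt.
apply: ler_wpM2l => //; apply: lerXn2r; rewrite ?nnegrE ?V0// ?(le_trans xt)//.
by apply: (superadditive_mono VS).
Qed.

Lemma iter_int_rev_affine Z Z' s t k d z w : 0 < k -> s <= t ->
  (forall u, s <= u -> u <= t -> forall i, Z u 0 i = Z' (k * u + d) 0 i + z i) ->
  iter_int_rev Z s w t = iter_int_rev Z' (k * s + d) w (k * t + d).
Proof.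
move=> k0; elim: w t => [//|i w ih] t st ZE /=.
apply: (@RSint_affine _ _ _ _ _ s t k d (z i)) => //.
  by move=> u su ut; apply: ih => // v sv vu; apply: ZE => //; exact: le_trans ut.
by move=> u su ut; exact: ZE.
Qed.

Lemma iter_int_Chen a b Z V s u t w : path_control a b Z V ->
  a <= s -> s <= u -> u <= t -> t <= b ->
  iter_int Z s t w = wmul (iter_int Z s u) (iter_int Z u t) w.
Proof.
by move=> pc h1 h2 h3 h4; rewrite /iter_int (iter_int_rev_Chen _ pc h1 h2 h3 h4) wmul_rev.
Qed.

Lemma iter_int_bound a b Z V s t w : path_control a b Z V ->
  a <= s -> s <= t -> t <= b -> `|iter_int Z s t w| <= V s t ^+ size w.
Proof.
move=> pc h1 h2 h3; rewrite /iter_int -(size_rev w).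
exact: (iter_int_rev_props (rev w) pc h1 (le_trans h2 h3)).2.
Qed.

End IteratedIntegrals.

(** * Euclidean norms *)

Section EuclideanNorm.
Context {R : realType} {I : finType}.
Implicit Types f g : I -> R.

Definition l2norm f : R := Num.sqrt (\sum_i f i ^+ 2).

Lemma l2norm_ge0 f : 0 <= l2norm f.
Proof. exact: sqrtr_ge0. Qed.

Lemma l2norm_sqr f : l2norm f ^+ 2 = \sum_i f i ^+ 2.
Proof. by rewrite sqr_sqrtr// sumr_ge0// => i _; exact: sqr_ge0. Qed.

Lemma l2norm_coord f i : `|f i| <= l2norm f.
Proof.
rewrite -sqrtr_sqr; apply: ler_wsqrtr.
by rewrite (bigD1 i)//= lerDl sumr_ge0// => j _; exact: sqr_ge0.
Qed.

Lemma l2normN f : l2norm (fun i => - f i) = l2norm f.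
Proof. by congr Num.sqrt; apply: eq_bigr => i _; rewrite sqrrN. Qed.

Lemma l2norm_sum_le f (c : R) : 0 <= c -> (forall i, `|f i| <= c) ->
  l2norm f <= #|I|%:R * c.
Proof.
move=> c0 fc; have n0 : 0 <= #|I|%:R * c by rewrite mulr_ge0.
rewrite -[leRHS]ger0_norm// -sqrtr_sqr; apply: ler_wsqrtr.
apply: (@le_trans _ _ (\sum_(i : I) c ^+ 2)).
  by apply: ler_sum => i _; rewrite -real_normK ?num_real// lerXn2r ?nnegrE.
rewrite sumr_const exprMn -[leLHS]mulr_natl; apply: ler_wpM2r; first exact: sqr_ge0.
by rewrite -natrX ler_nat; case: #|I| => // k; rewrite expnS leq_pmulr ?expn_gt0.
Qed.

Lemma l2norm_triangle f g : l2norm (fun i => f i + g i) <= l2norm f + l2norm g.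
Proof.
set a := l2norm f; set b := l2norm g.
have [a0 b0] : 0 <= a /\ 0 <= b by split; exact: l2norm_ge0.
have CS : \sum_i f i * g i <= a * b.
  have [aE|an0] := eqVneq a 0.
    rewrite big1 ?mulr_ge0// => i _.
    have := l2norm_coord f i; rewrite -/a aE normr_le0 => /eqP ->.
    by rewrite mul0r.
  have [bE|bn0] := eqVneq b 0.
    rewrite big1 ?mulr_ge0// => i _.
    have := l2norm_coord g i; rewrite -/b bE normr_le0 => /eqP ->.
    by rewrite mulr0.
  have ap : 0 < a by rewrite lt0r an0.
  have bp : 0 < b by rewrite lt0r bn0.
  (* Expanding this square is Cauchy-Schwarz. *)
  have : 0 <= \sum_i (b * f i - a * g i) ^+ 2.
    by apply: sumr_ge0 => i _; exact: sqr_ge0.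
  have -> : \sum_i (b * f i - a * g i) ^+ 2
      = b ^+ 2 * \sum_i f i ^+ 2 + a ^+ 2 * \sum_i g i ^+ 2
        - 2 * (a * b) * \sum_i f i * g i.
    rewrite !mulr_sumr -big_split -sumrB; apply: eq_bigr => i _ /=; ring.
  rewrite -!l2norm_sqr -/a -/b.
  have -> : b ^+ 2 * a ^+ 2 + a ^+ 2 * b ^+ 2 - 2 * (a * b) * (\sum_i f i * g i)
     = 2 * (a * b) * (a * b - \sum_i f i * g i) by ring.
  by rewrite pmulr_rge0 ?subr_ge0// !mulr_gt0.
have ab0 : 0 <= a + b by rewrite addr_ge0.
rewrite -(ger0_norm ab0) -sqrtr_sqr; apply: ler_wsqrtr.
have -> : \sum_i (f i + g i) ^+ 2
   = \sum_i f i ^+ 2 + \sum_i g i ^+ 2 + 2 * \sum_i f i * g i.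
  by rewrite mulr_sumr -!big_split; apply: eq_bigr => i _ /=; ring.
rewrite -!l2norm_sqr -/a -/b sqrrD; lra.
Qed.

End EuclideanNorm.

(** * The truncated tensor algebra *)

Section Tensors.
Context {R : realType} {n N : nat}.
Implicit Types (a b c : tensor R n N) (w : seq 'I_n).

(** Reads coefficients on plain sequences, where [wmul] lives. *)
Definition coef a w : R := a (insub_bseq N w).

Lemma insub_bseqK w : (size w <= N)%N -> insub_bseq N w = w :> seq _.
Proof. by move=> wN; rewrite /insub_bseq insubdK. Qed.

Lemma coef_val a (w : N.-bseq 'I_n) : coef a w = a w.
Proof. by congr (a _); apply/val_inj; rewrite /= insub_bseqK// size_bseq. Qed.

Lemma eq_coef a b : (forall w, (size w <= N)%N -> coef a w = coef b w) -> a = b.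
Proof. by move=> ab; apply/ffunP => w; rewrite -!coef_val ab// size_bseq. Qed.

Lemma coef_tone w : (size w <= N)%N -> coef tone w = wone w.
Proof. by move=> wN; rewrite /coef ffunE insub_bseqK. Qed.

Lemma coef_tmul a b w : (size w <= N)%N ->
  coef (tmul a b) w = wmul (coef a) (coef b) w.
Proof. by move=> wN; rewrite /coef ffunE /wmul big_mkord insub_bseqK. Qed.

Lemma tmulA a b c : tmul (tmul a b) c = tmul a (tmul b c).
Proof.
apply: eq_coef => w wN; rewrite !coef_tmul//.
rewrite (@eq_wmul _ _ _ (wmul (coef a) (coef b)) _ (coef c))//; last first.
  by move=> v vw; rewrite coef_tmul// (leq_trans vw).
rewrite wmulA; apply: eq_wmul => // v vw.
by rewrite coef_tmul// (leq_trans vw).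
Qed.

Lemma tmul1l a : tmul tone a = a.
Proof.
apply: eq_coef => w wN; rewrite coef_tmul// -[RHS]wmul1l.
by apply: eq_wmul => // v vw; rewrite coef_tone// (leq_trans vw).
Qed.

Lemma tmul1r a : tmul a tone = a.
Proof.
apply: eq_coef => w wN; rewrite coef_tmul// -[RHS]wmul1r.
by apply: eq_wmul => // v vw; rewrite coef_tone// (leq_trans vw).
Qed.

Lemma tinvE a b : tmul a b = tone -> tmul b a = tone -> tinv a = b.
Proof.
move=> ab ba; have [h1 h2] : tmul a (tinv a) = tone /\ tmul (tinv a) a = tone.
  exact: (@xgetPex _ _ [set b | tmul a b = tone /\ tmul b a = tone] (ex_intro _ b (conj ab ba))).
by rewrite -[LHS]tmul1r -ab -tmulA h2 tmul1l.
Qed.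

Definition level k a : R := tnorm (tproj k a).

Lemma level_ge0 k a : 0 <= level k a.
Proof. exact: sqrtr_ge0. Qed.

Lemma level_coef a w : (size w <= N)%N -> `|coef a w| <= level (size w) a.
Proof.
move=> wN; have := l2norm_coord (tproj (size w) a) (insub_bseq N w).
by rewrite ffunE insub_bseqK// eqxx.
Qed.

Lemma level_le k a (c : R) : 0 <= c ->
  (forall w, size w = k -> (size w <= N)%N -> `|coef a w| <= c) ->
  level k a <= #|{bseq N of 'I_n}|%:R * c.
Proof.
move=> c0 ac; apply: l2norm_sum_le => // w; rewrite ffunE.
by case: eqP => [wk|]; [rewrite -coef_val ac// size_bseq|rewrite normr0].
Qed.

Lemma level_triangle k a b c : (forall w, size w = k -> (size w <= N)%N ->
    coef a w = coef b w + coef c w) -> level k a <= level k b + level k c.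
Proof.
move=> abc; apply: le_trans (l2norm_triangle _ _).
rewrite le_eqVlt; apply/orP; left; apply/eqP.
congr Num.sqrt; apply: eq_bigr => w _; congr (_ ^+ 2); rewrite !ffunE.
case: eqP => [wk|_]; last by rewrite addr0.
by rewrite -!coef_val abc// size_bseq.
Qed.

Lemma tcoefB a b w : coef (a - b) w = coef a w - coef b w.
Proof. by rewrite /coef ffunE /= ffunE. Qed.

(** In the product the words split at either end contribute the differences at
   level [k] with coefficient one; every other splitting involves lower levels,
   where a crude constant is enough. *)
Lemma level_tmul_gap k a1 a2 b1 b2 : (0 < k)%N -> (k <= N)%N ->
  coef a1 [::] = 1 -> coef a2 [::] = 1 -> coef b1 [::] = 1 -> coef b2 [::] = 1 ->
  level k (tmul a1 b1 - tmul a2 b2) <=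
  level k (a1 - a2) + level k (b1 - b2) +
  #|{bseq N of 'I_n}|%:R * \sum_(1 <= i < k)
    (level i (a1 - a2) * level (k - i) b1 + level i a2 * level (k - i) (b1 - b2)).
Proof.
move=> k0 kN a11 a21 b11 b21.
(* The part of the product difference that comes from proper splittings. *)
pose rest : tensor R n N := [ffun w : N.-bseq 'I_n => \sum_(1 <= i < size w)
  (coef (a1 - a2) (take i w) * coef b1 (drop i w)
   + coef a2 (take i w) * coef (b1 - b2) (drop i w))].
apply: (@le_trans _ _ (level k ((a1 - a2) + (b1 - b2)) + level k rest)).
  apply: level_triangle => w wk wN; rewrite tcoefB !coef_tmul//.
  have restE : coef rest w = \sum_(1 <= i < size w)
    (coef (a1 - a2) (take i w) * coef b1 (drop i w)
     + coef a2 (take i w) * coef (b1 - b2) (drop i w)).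
    by rewrite /coef ffunE insub_bseqK.
  have addE : coef ((a1 - a2) + (b1 - b2)) w
      = coef a1 w - coef a2 w + (coef b1 w - coef b2 w).
    by rewrite -!tcoefB /coef ffunE.
  rewrite restE addE /wmul; case: (size w) wk (take_size w) (drop_size w) => [wk|m wk tw dw].
    by rewrite -wk in k0.
  have ends (c d : tensor R n N) : coef c [::] = 1 -> coef d [::] = 1 ->
      \sum_(0 <= i < m.+2) coef c (take i w) * coef d (drop i w)
      = coef c w + coef d w + \sum_(0 <= i < m) coef c (take i.+1 w) * coef d (drop i.+1 w).
    move=> c1 d1; rewrite big_nat_recl// take0 drop0 c1 big_nat_recr//= tw dw d1.
    ring.
  have -> : \sum_(1 <= i < m.+1) (coef (a1 - a2) (take i w) * coef b1 (drop i w) +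
        coef a2 (take i w) * coef (b1 - b2) (drop i w))
    = \sum_(0 <= i < m) coef a1 (take i.+1 w) * coef b1 (drop i.+1 w)
      - \sum_(0 <= i < m) coef a2 (take i.+1 w) * coef b2 (drop i.+1 w).
    rewrite big_add1 -sumrB; apply: eq_bigr => i _.
    by rewrite !tcoefB; ring.
  rewrite !ends//; ring.
apply: lerD.
  by apply: level_triangle => w _ _; rewrite /coef ffunE.
apply: level_le.
  by apply: sumr_ge0 => i _; rewrite addr_ge0// mulr_ge0// level_ge0.
move=> w wk wN; rewrite /coef ffunE insub_bseqK// wk.
apply: (le_trans (ler_norm_sum _ _ _)); apply: ler_sum_nat => i /andP[i1 ik].
have st : size (take i w) = i by rewrite size_take wk ik.
have sd : size (drop i w) = (k - i)%N by rewrite size_drop wk.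
have iN : (i <= N)%N by rewrite (leq_trans (ltnW ik)).
have kiN : (k - i <= N)%N by rewrite (leq_trans (leq_subr _ _)).
apply: (le_trans (ler_normD _ _)); rewrite !normrM.
have lev c v j : size v = j -> (j <= N)%N -> `|coef c v| <= level j c.
  by move=> <-; exact: level_coef.
by apply: lerD; apply: ler_pM => //; exact: lev.
Qed.

End Tensors.

(** * Uniform continuity of paths *)

Section UniformContinuity.
Context {R : realType} {E : Type}.
Implicit Types (d : E -> E -> R) (f : R -> E).

Definition uniform_path d (T : R) f := forall e : R, 0 < e -> exists2 eta : R, 0 < eta &
  forall x y : R, 0 <= x -> x <= T -> 0 <= y -> y <= T -> `|x - y| < eta ->
    d (f x) (f y) < e.

(** Heine-Cantor for a pseudo-metric on a type without topology. *)
Lemma continuous_uniform_path d T f :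
  (forall x y, d x y = d y x) -> (forall x y z, d x z <= d x y + d y z) ->
  continuous_path d T f -> uniform_path d T f.
Proof.
move=> dC dD cf e e0.
pose P (i x : R) := forall y, y \in `[0, T] -> x \in `[0, T] -> `|x - y| < i -> d (f x) (f y) < e.
have : near_covering (`[0, T]%classic : set R).
  by rewrite -compact_near_coveringP; exact: segment_compact.
move=> /(_ R (0%R^'+) P _) [].
  move=> x /=; rewrite -/(x \in `[0, T]) => x0T.
  have e20 : 0 < e / 2 by rewrite divr_gt0.
  have [eta eta0 Heta] := cf x x0T _ e20.
  exists (ball x (eta / 2), [set i | i < eta / 2]); first split => /=.
  - by apply: nbhsx_ballx; rewrite divr_gt0.
  - by apply: nbhs_right_lt; rewrite divr_gt0.
  move=> [x' i] /= [xx' ilt] y y0T x'0T x'y.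
  have xx'2 : `|x - x'| < eta / 2 by exact: xx'.
  have h1 : d (f x') (f x) < e / 2.
    by apply: Heta => //; rewrite distrC; lra.
  have h2 : d (f y) (f x) < e / 2.
    apply: Heta => //; rewrite (_ : y - x = - (x' - y) - (x - x')); last by ring.
    by apply: (le_lt_trans (ler_normB _ _)); rewrite normrN; lra.
  by apply: (le_lt_trans (dD _ (f x) _)); rewrite (dC (f x)); lra.
move=> r /= r0 Hr; exists (r / 2); first by rewrite divr_gt0.
move=> x y x0 xT y0 yT xy.
apply: (Hr (r / 2) _ _ x _ y) => //=; rewrite ?in_itv /= ?x0 ?y0//.
  by rewrite sub0r normrN gtr0_norm ?divr_gt0//; lra.
by rewrite divr_gt0.
Qed.

Lemma uniform_continuous_path d T f : uniform_path d T f -> continuous_path d T f.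
Proof.
move=> uf x /[!in_itv]/= /andP[x0 xT] e e0; have [eta eta0 H] := uf e e0.
by exists eta => // y /[!in_itv]/= /andP[y0 yT] yx; exact: H.
Qed.

End UniformContinuity.

(** * Paths of bounded variation and their reversal *)

Section BoundedVariationPaths.
Context {R : realType} {n : nat}.
Implicit Types (Z : R -> 'rV[R]_n) (V W : R -> R -> R) (T : R).

Lemma eucl_distE (x y : 'rV[R]_n) : eucl_dist x y = l2norm (fun i => y 0 i - x 0 i).
Proof. by []. Qed.

Lemma eucl_dist_ge0 (x y : 'rV[R]_n) : 0 <= eucl_dist x y.
Proof. exact: sqrtr_ge0. Qed.

Lemma eucl_distC (x y : 'rV[R]_n) : eucl_dist x y = eucl_dist y x.
Proof.
rewrite !eucl_distE -l2normN; congr l2norm; apply/funext => i; exact: opprB.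
Qed.

Lemma eucl_dist_triangle (x y z : 'rV[R]_n) :
  eucl_dist x z <= eucl_dist x y + eucl_dist y z.
Proof.
rewrite !eucl_distE; apply: le_trans (l2norm_triangle _ _).
rewrite le_eqVlt; apply/orP; left; apply/eqP; congr l2norm.
by apply/funext => i; ring.
Qed.

Lemma eucl_dist_shift (x y z : 'rV[R]_n) : eucl_dist (x + z) (y + z) = eucl_dist x y.
Proof.
by rewrite !eucl_distE; congr l2norm; apply/funext => i; rewrite !mxE; ring.
Qed.

Lemma eucl_distxx (x : 'rV[R]_n) : eucl_dist x x = 0.
Proof.
rewrite eucl_distE /l2norm big1 ?sqrtr0// => i _.
by rewrite subrr expr0n.
Qed.

Lemma eucl_dist_coord (x y : 'rV[R]_n) i : `|y 0 i - x 0 i| <= eucl_dist x y.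
Proof. exact: (l2norm_coord (fun i => y 0 i - x 0 i)). Qed.

Lemma bv_uniform T Z : bv_path T Z -> uniform_path eucl_dist T Z.
Proof.
move=> [cZ _]; apply: continuous_uniform_path cZ; first exact: eucl_distC.
by move=> x y z; exact: eucl_dist_triangle.
Qed.

Definition length_control T Z V := path_control 0 T Z V /\
  forall u v, 0 <= u -> u <= v -> v <= T -> eucl_dist (Z u) (Z v) <= V u v.

Lemma uniform_ucont T Z i : uniform_path eucl_dist T Z ->
  ucont 0 T (fun u => Z u 0 i).
Proof.
move=> uZ e e0; have [eta eta0 H] := uZ e e0; exists eta => // x y x0 xT y0 yT xy.
by rewrite distrC; apply: le_lt_trans (eucl_dist_coord _ _ _) _; exact: H.
Qed.

Lemma bv_length_control T Z : 0 <= T -> bv_path T Z ->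
  exists2 V, length_control T Z V & var_norm eucl_dist 1 Z 0 T = (V 0 T)%:E.
Proof.
move=> T0 bZ; have uZ := bv_uniform bZ; have [_] := bZ.
rewrite /var_norm invr1.
set F := fun u v : R => _.
have F0 u v : (0 <= F u v)%E by rewrite lee_fin powR_ge0.
have FE u v : F u v = (eucl_dist (Z u) (Z v))%:E.
  by rewrite /F powRr1// eucl_dist_ge0.
rewrite poweRe1 ?sup_partition_ge0// => Ffin.
have VA : additive_on 0 T (sup_control F).
  apply: sup_control_additive => // x y z _ _ _ _.
  by rewrite !FE -EFinD lee_fin eucl_dist_triangle.
have VS : superadditive 0 T (sup_control F) by exact: sup_control_superadditive.
have Vd u v : 0 <= u -> u <= v -> v <= T -> eucl_dist (Z u) (Z v) <= sup_control F u v.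
  move=> u0; rewrite le_eqVlt => /orP[/eqP <- uT|uv vT].
    by rewrite eucl_distxx VS.1.
  by have := sup_control_dominates F0 Ffin u0 uv vT; rewrite FE lee_fin.
exists (sup_control F); last by rewrite (sup_controlE F0 Ffin (lexx 0) T0 (lexx T)).
split=> //; split=> //; first exact: VS.1.
- by move=> u v i u0 uv vT; apply: le_trans (eucl_dist_coord _ _ _) (Vd u v _ _ _).
- by move=> i; exact: uniform_ucont.
Qed.

(** The lengths of reversed and concatenated paths are obtained from this bound,
   by transporting a control rather than partitions. *)
Lemma control_bv T Z W : 0 <= T -> uniform_path eucl_dist T Z ->
  superadditive 0 T W ->
  (forall u v, 0 <= u -> u <= v -> v <= T -> eucl_dist (Z u) (Z v) <= W u v) ->
  bv_path T Z /\ (var_norm eucl_dist 1 Z 0 T <= (W 0 T)%:E)%E.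
Proof.
move=> T0 uZ WS ZW.
have H : (var_norm eucl_dist 1 Z 0 T <= (W 0 T)%:E)%E.
  rewrite /var_norm invr1 poweRe1; last first.
    by apply: sup_partition_ge0 => // u v; rewrite lee_fin powR_ge0.
  apply: (sup_partition_le WS) => // u v u0 uv vT.
  by rewrite lee_fin powRr1 ?eucl_dist_ge0// ZW// ltW.
split=> //; split; first exact: uniform_continuous_path.
by apply: le_lt_trans H _; exact: ltry.
Qed.

Lemma iter_int_degenerate T Z V s : length_control T Z V -> 0 <= s -> s <= T ->
  iter_int Z s s = wone.
Proof.
move=> [pc _] s0 sT; apply/funext => -[|i w] //.
have := iter_int_bound (i :: w) pc s0 (lexx s) sT.
have [VA _ _ _] := pc.
by rewrite (additive_on0 VA s0 sT) exprS mul0r normr_le0 => /eqP ->.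
Qed.

Definition time_rev T Z : R -> 'rV[R]_n := fun u => Z (T - u).

Lemma time_rev_uniform T Z : uniform_path eucl_dist T Z -> uniform_path eucl_dist T (time_rev T Z).
Proof.
move=> uZ e e0; have [eta eta0 H] := uZ e e0; exists eta => // x y x0 xT y0 yT xy.
apply: H; try lra.
by rewrite (_ : T - x - (T - y) = - (x - y)) ?normrN//; ring.
Qed.

Lemma time_rev_control T Z V : uniform_path eucl_dist T Z ->
  length_control T Z V -> length_control T (time_rev T Z) (fun u v => V (T - v) (T - u)).
Proof.
move=> uZ [[VA V0 ZV Zu] Zd]; split.
  split.
  - by move=> s u t h1 h2 h3 h4; rewrite addrC VA//; lra.
  - by move=> u v h1 h2 h3; apply: V0; lra.
  - by move=> u v i h1 h2 h3; rewrite distrC; apply: ZV; lra.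
  - by move=> i; apply: uniform_ucont; exact: time_rev_uniform.
by move=> u v h1 h2 h3; rewrite eucl_distC; apply: Zd; lra.
Qed.

Lemma wmul_bound (S : Type) (A B : seq S -> R) (a b : R) (m : nat) (w : seq S) :
  (forall v : seq S, (size v <= m)%N -> `|A v| <= a) ->
  (forall v : seq S, (size v <= m)%N -> `|B v| <= b) ->
  (size w <= m)%N -> `|wmul A B w| <= m.+1%:R * (a * b).
Proof.
move=> Aa Bb wm.
have a0 : 0 <= a by apply: le_trans (Aa [::] _).
have b0 : 0 <= b by apply: le_trans (Bb [::] _).
rewrite /wmul; apply: (le_trans (ler_norm_sum _ _ _)).
apply: (@le_trans _ _ (\sum_(0 <= i < (size w).+1) (a * b))).
  apply: ler_sum => i _; rewrite normrM; apply: ler_pM => //; [apply: Aa|apply: Bb].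
    by rewrite size_take_min (leq_trans (geq_minr _ _)).
  by rewrite size_drop (leq_trans (leq_subr _ _)).
rewrite sumr_const_nat subn0 -[leLHS]mulr_natl; apply: ler_wpM2r; first exact: mulr_ge0.
by rewrite ler_nat ltnS.
Qed.

(** Increments of order o(1) V sum up to o(1) along fine partitions. *)
Lemma increments_small_const T (phi : R -> R) V : 0 <= T -> superadditive 0 T V ->
  (forall e, 0 < e -> exists2 eta, 0 < eta & forall u v, 0 <= u -> u <= v -> v <= T ->
     v - u < eta -> `|phi v - phi u| <= e * V u v) -> phi T = phi 0.
Proof.
move=> T0 VS H; apply/eqP; rewrite -subr_eq0 -normr_le0.
apply/ler_addgt0Pr => e e0; rewrite add0r.
have V0 : 0 <= V 0 T by exact: VS.1.
have e'0 : 0 < e / (V 0 T + 1) by rewrite divr_gt0//; lra.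
have [eta eta0 Heta] := H _ e'0.
have [r rP rm] := fine_partition T0 eta0.
have dA : additive_on 0 T (fun u v => phi v - phi u) by move=> *; ring.
rewrite -(sum_partition_additive dA (lexx 0) (lexx T) rP).
apply: (le_trans (ler_norm_sum _ _ _)).
apply: (@le_trans _ _ (\sum_(0 <= i < size r)
    (e / (V 0 T + 1) * V (nth T (0 :: r) i) (nth T (0 :: r) i.+1)))).
  apply: ler_sum_nat => i /andP[_ ir]; apply: Heta; last exact: rm.
  - by apply: itv_partition_nth_ge => //; rewrite ltnS ltnW.
  - exact/ltW/itv_partition_nth_lt.
  - exact: itv_partition_nth_le.
rewrite -mulr_sumr.
apply: (@le_trans _ _ (e / (V 0 T + 1) * V 0 T)).
  by apply: ler_wpM2l; [exact: ltW|exact: (sum_partition_le VS)].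
exact/ltW/mulr_frac_lt.
Qed.

(** Let [phi t] be the coefficient for the path run up to time [t] and back.  By
   Chen's relation its increment over [s,t] comes from the loop that goes from
   [s] to [t] and back: level one of this loop vanishes and the higher levels
   are at most osc(Z) V(s,t) up to a constant.  So [phi] is constant. *)
Lemma iter_int_time_rev T Z : 0 <= T -> bv_path T Z ->
  wmul (iter_int Z 0 T) (iter_int (time_rev T Z) 0 T) = wone.
Proof.
move=> T0 bZ; have uZ := bv_uniform bZ.
have [V LV _] := bv_length_control T0 bZ.
have LW := time_rev_control uZ LV.
have [pc Vd] := LV; have [pr _] := LW.
have VS := path_control_super pc; have [VA V0 ZV _] := pc.
set Zr := time_rev T Z in pr *.
apply/funext => w; set m := size w.
pose phi t := wmul (iter_int Z 0 t) (iter_int Zr (T - t) T) w.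
have -> : wmul (iter_int Z 0 T) (iter_int Zr 0 T) w = phi T by rewrite /phi subrr.
have phi0 : phi 0 = wone w.
  rewrite /phi subr0 (iter_int_degenerate LV)// (iter_int_degenerate LW)//.
  exact: wmul1l.
rewrite -phi0; apply: (increments_small_const T0 VS) => e e0.
pose Om : R := 1 + V 0 T.
have VOm u v : 0 <= u -> u <= v -> v <= T -> V u v <= Om.
  move=> h1 h2 h3; have := superadditive_mono VS (lexx 0) h1 h2 h3 (lexx T).
  by rewrite /Om; lra.
have Om1 : 1 <= Om by rewrite /Om lerDl V0.
have OmX k : 1 <= Om ^+ k by exact: exprn_ege1.
have OmXm k l : (k <= l)%N -> Om ^+ k <= Om ^+ l by move=> kl; exact: ler_weXn2l.
pose C : R := m.+1%:R * (Om ^+ m * (m.+1%:R * ((m.+1%:R * Om ^+ m) * Om ^+ m))).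
have C0 : 0 < C.
  have Op : 0 < Om ^+ m by apply: lt_le_trans (OmX m).
  by rewrite /C !mulr_gt0// ltr0n.
have e'0 : 0 < e / C by rewrite divr_gt0.
have [eta eta0 Heta] := uZ _ e'0.
exists eta => // s t s0 st tT ts.
have sT := le_trans st tT; have t0 := le_trans s0 st.
have Vst0 : 0 <= V s t by exact: V0.
set e' := e / C in e'0 Heta *.
have Zsmall x y i : s <= x -> x <= t -> s <= y -> y <= t -> `|Z x 0 i - Z y 0 i| <= e'.
  move=> sx xt sy yt; apply: le_trans (eucl_dist_coord _ _ _) _; apply/ltW/Heta; try lra.
  by rewrite ltr_norml; lra.
(* The loop from [s] to [t] and back. *)
pose M := wmul (iter_int Z s t) (iter_int Zr (T - t) (T - s)).
pose M1 v := M v - wone v.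
have phiE : phi t - phi s = wmul (iter_int Z 0 s) (wmul M1 (iter_int Zr (T - s) T)) w.
  have -> : phi t = wmul (iter_int Z 0 s) (wmul M (iter_int Zr (T - s) T)) w.
    rewrite /phi /M (_ : iter_int Z 0 t = wmul (iter_int Z 0 s) (iter_int Z s t)); last first.
      by apply/funext => v; apply: (iter_int_Chen v pc).
    rewrite (_ : iter_int Zr (T - t) T =
      wmul (iter_int Zr (T - t) (T - s)) (iter_int Zr (T - s) T)); last first.
      by apply/funext => v; apply: (iter_int_Chen v pr); lra.
    rewrite wmulA; apply: eq_wmul => // v _; by rewrite wmulA.
  have -> : phi s = wmul (iter_int Z 0 s) (wmul wone (iter_int Zr (T - s) T)) w.
    by rewrite /phi; apply: eq_wmul => // v _; rewrite wmul1l.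
  rewrite [in RHS]/wmul -sumrB; apply: eq_bigr => i _; rewrite -mulrBr; congr (_ * _).
  rewrite /wmul -sumrB; apply: eq_bigr => j _; by rewrite -mulrBl.
have Zr_small : forall x i, T - t <= x -> x <= T - s -> `|Zr x 0 i - Zr (T - t) 0 i| <= e'.
  by move=> x i h1 h2; apply: Zsmall; lra.
have rb v : `|iter_int Zr (T - t) (T - s) v| <= V s t ^+ size v.
  have := iter_int_bound v pr (_ : 0 <= T - t) (_ : T - t <= T - s) (_ : T - s <= T).
  by rewrite !subKr; apply; lra.
have zb v : `|iter_int Z s t v| <= V s t ^+ size v by exact: (iter_int_bound v pc).
have rs v : (0 < size v)%N -> `|iter_int Zr (T - t) (T - s) v| <= e' * V s t ^+ (size v).-1.
  rewrite /iter_int -(size_rev v) => v0.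
  have := iter_int_rev_small pr (_ : 0 <= T - t) (_ : T - t <= T - s) (_ : T - s <= T) (ltW e'0) v0 Zr_small.
  by rewrite !subKr; apply; lra.
have zs v : (0 < size v)%N -> `|iter_int Z s t v| <= e' * V s t ^+ (size v).-1.
  rewrite /iter_int -(size_rev v) => v0.
  by apply: (iter_int_rev_small pc) => //; [exact: ltW|move=> x i h1 h2; exact: Zsmall].
have M1b v : (size v <= m)%N -> `|M1 v| <= e' * V s t * (m.+1%:R * Om ^+ m).
  have RHS0 : 0 <= e' * V s t * (m.+1%:R * Om ^+ m).
    have Op : 0 <= Om ^+ m by exact: le_trans (OmX m).
    by apply: mulr_ge0; apply: mulr_ge0 => //; exact: ltW.
  case: v => [|i [|j v]].
  - by rewrite /M1 /M wmul_nil /iter_int /= mulr1 subrr normr0.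
  - move=> _; rewrite /M1 /M wmul_cons wmul_nil.
    have i1 : iter_int Z s t [:: i] = Z t 0 i - Z s 0 i by exact: iter_int_rev1 pc _ _ _.
    have i2 : iter_int Zr (T - t) (T - s) [:: i] = Zr (T - s) 0 i - Zr (T - t) 0 i.
      by apply: iter_int_rev1 pr _ _ _; lra.
    rewrite i1 i2 [iter_int Z s t [::]]/= [iter_int Zr _ _ [::]]/= /wone /= subr0.
    rewrite /Zr /time_rev !subKr mul1r mulr1.
    by rewrite (_ : _ + _ = 0) ?normr0//; ring.
  set u := [:: i, j & v] => um.
  rewrite /M1 [wone u]/= subr0 /M /wmul.
  apply: (le_trans (ler_norm_sum _ _ _)).
  apply: (@le_trans _ _ (\sum_(0 <= k < (size u).+1) (e' * V s t * Om ^+ m))).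
    apply: ler_sum_nat => k /andP[_ ku]; rewrite ltnS in ku.
    have key : `|iter_int Z s t (take k u) * iter_int Zr (T - t) (T - s) (drop k u)|
        <= e' * V s t ^+ (size u).-1.
      rewrite normrM; case: k ku => [|k] ku.
        rewrite take0 drop0 [X in X * _](_ : _ = 1) ?mul1r; first exact: rs.
        by rewrite /iter_int /= normr1.
      have st1 : size (take k.+1 u) = k.+1 by rewrite size_takel.
      have sd1 : size (drop k.+1 u) = (size u - k.+1)%N by rewrite size_drop.
      have := zs (take k.+1 u); rewrite st1 => /(_ isT) h1.
      have := rb (drop k.+1 u); rewrite sd1 => h2.
      apply: (le_trans (ler_pM _ _ h1 h2)) => //.
      by rewrite -mulrA -exprD [size u]/= subSS subnKC.
    apply: (le_trans key); rewrite -mulrA; apply: ler_wpM2l; first exact: ltW.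
    rewrite /= exprS; apply: ler_wpM2l => //.
    apply: (@le_trans _ _ (Om ^+ size v)).
      apply: lerXn2r; rewrite ?nnegrE//; [exact: le_trans Om1|exact: VOm].
    exact/OmXm/ltnW/ltnW.
  rewrite sumr_const_nat subn0 -[leLHS]mulr_natl mulrCA; apply: ler_wpM2l.
    by rewrite mulr_ge0// ltW.
  apply: ler_wpM2r; first by apply: le_trans (OmX m).
  by rewrite ler_nat ltnS.
have Ab v : (size v <= m)%N -> `|iter_int Z 0 s v| <= Om ^+ m.
  move=> vm; apply: le_trans (iter_int_bound v pc (lexx 0) s0 sT) _.
  apply: le_trans (OmXm _ _ vm); apply: lerXn2r; rewrite ?nnegrE ?V0//.
    exact: le_trans Om1.
  exact: VOm.
have Bb v : (size v <= m)%N -> `|iter_int Zr (T - s) T v| <= Om ^+ m.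
  move=> vm; have := iter_int_bound v pr (_ : 0 <= T - s) (_ : T - s <= T) (lexx T).
  rewrite subrr subKr => h; apply: (le_trans (h _ _)); [lra|lra|].
  apply: le_trans (OmXm _ _ vm); apply: lerXn2r; rewrite ?nnegrE ?V0//.
    exact: le_trans Om1.
  exact: VOm.
rewrite phiE; have MBb v : (size v <= m)%N -> `|wmul M1 (iter_int Zr (T - s) T) v|
    <= m.+1%:R * (e' * V s t * (m.+1%:R * Om ^+ m) * Om ^+ m).
  by move=> vm; apply: wmul_bound => //.
apply: (le_trans (wmul_bound Ab MBb (leqnn m))).
rewrite (_ : m.+1%:R * _ = C * e' * V s t); last by rewrite /C; ring.
by rewrite (_ : C * e' = e) // /e' mulrC divfK ?gt_eqF.
Qed.

End BoundedVariationPaths.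

(** * Concatenation of paths *)

Section Concatenation.
Context {R : realType} {n : nat}.
Implicit Types (Z : R -> 'rV[R]_n) (V W : R -> R -> R) (T : R).

(** Each path runs at double speed, and the second is translated to start where
   the first ends. *)
Definition cat_path T Z1 Z2 : R -> 'rV[R]_n := fun u =>
  if u <= T / 2 then Z1 (2 * u) else Z2 (2 * u - T) + (Z1 T - Z2 0).

Lemma cat_pathl T Z1 Z2 u : u <= T / 2 -> cat_path T Z1 Z2 u = Z1 (2 * u).
Proof. by move=> uT; rewrite /cat_path uT. Qed.

Lemma cat_pathr T Z1 Z2 u : T / 2 <= u ->
  cat_path T Z1 Z2 u = Z2 (2 * u - T) + (Z1 T - Z2 0).
Proof.
rewrite le_eqVlt => /orP[/eqP <-|Tu]; last by rewrite /cat_path leNgt Tu.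
rewrite cat_pathl// mulrC divfK//= subrr addrC subrK.
by [].
Qed.

Lemma bv_cat_path T Z1 Z2 V1 V2 : 0 < T ->
  uniform_path eucl_dist T Z1 -> uniform_path eucl_dist T Z2 ->
  length_control T Z1 V1 -> length_control T Z2 V2 ->
  bv_path T (cat_path T Z1 Z2) /\
  (var_norm eucl_dist 1 (cat_path T Z1 Z2) 0 T <= (V1 0 T + V2 0 T)%:E)%E.
Proof.
move=> T0 u1 u2 [pc1 d1] [pc2 d2]; set Z := cat_path T Z1 Z2.
have [VA1 V10 _ _] := pc1; have [VA2 V20 _ _] := pc2.
have S1 := path_control_super pc1; have S2 := path_control_super pc2.
(* The clocks of the two paths: each stands still while the other one runs. *)
pose lo x : R := Num.min (2 * x) T.
pose hi x : R := Num.max (2 * x - T) 0.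
have lo_itv x : 0 <= x -> 0 <= lo x <= T.
  by move=> x0; rewrite /lo le_min ge_min lexx orbT (ltW T0) mulr_ge0.
have hi_itv x : x <= T -> 0 <= hi x <= T.
  by move=> xT; rewrite /hi le_max ge_max lexx orbT /= (ltW T0) andbT; lra.
have lo_mono x y : x <= y -> lo x <= lo y.
  by move=> xy; rewrite /lo le_min !ge_min lexx orbT ler_pM2l// xy.
have hi_mono x y : x <= y -> hi x <= hi y.
  move=> xy; rewrite /hi ge_max !le_max lexx !orbT andbT.
  by apply/orP; left; lra.
have lol x : x <= T / 2 -> lo x = 2 * x by move=> xT; apply/min_idPl; lra.
have lor x : T / 2 <= x -> lo x = T by move=> xT; apply/min_idPr; lra.
have hil x : x <= T / 2 -> hi x = 0 by move=> xT; apply/max_idPr; lra.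
have hir x : T / 2 <= x -> hi x = 2 * x - T by move=> xT; apply/max_idPl; lra.
pose W x y := V1 (lo x) (lo y) + V2 (hi x) (hi y).
have WA : additive_on 0 T W.
  move=> s u t s0 su ut tT; have u0 := le_trans s0 su; have uT := le_trans ut tT.
  have t0 := le_trans u0 ut; have sT := le_trans su uT.
  have /andP[? ?] := lo_itv s s0; have /andP[? ?] := lo_itv t t0.
  have /andP[? ?] := hi_itv s sT; have /andP[? ?] := hi_itv t tT.
  by rewrite /W addrACA VA1 ?VA2//; rewrite ?lo_mono ?hi_mono.
have W0 : nonneg_on 0 T W.
  move=> u v u0 uv vT; have v0 := le_trans u0 uv; have uT := le_trans uv vT.
  have /andP[? ?] := lo_itv u u0; have /andP[? ?] := lo_itv v v0.
  have /andP[? ?] := hi_itv u uT; have /andP[? ?] := hi_itv v vT.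
  by rewrite /W addr_ge0// ?V10 ?V20// ?lo_mono ?hi_mono.
have WS := additive_on_superadditive W0 WA.
have half0 : 0 <= T / 2 by lra.
have halfT : T / 2 <= T by lra.
have Wl u v : 0 <= u -> u <= v -> v <= T / 2 -> eucl_dist (Z u) (Z v) <= W u v.
  move=> h1 h2 h3; rewrite /Z !cat_pathl//; last lra.
  rewrite /W lol ?lol ?hil//; [|lra..].
  by rewrite (additive_on0 VA2) ?addr0 ?lexx ?(ltW T0)//; apply: d1; lra.
have Wr u v : T / 2 <= u -> u <= v -> v <= T -> eucl_dist (Z u) (Z v) <= W u v.
  move=> h1 h2 h3; rewrite /Z !cat_pathr//; last lra.
  rewrite eucl_dist_shift /W lor ?lor ?hir//; [|lra..].
  by rewrite (additive_on0 VA1) ?add0r ?lexx ?(ltW T0)//; apply: d2; lra.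
have Wd u v : 0 <= u -> u <= v -> v <= T -> eucl_dist (Z u) (Z v) <= W u v.
  move=> h1 h2 h3; have [vT|Tv] := leP v (T / 2); first exact: Wl.
  have [uT|Tu] := leP (T / 2) u; first exact: Wr.
  apply: (le_trans (eucl_dist_triangle _ (Z (T / 2)) _)).
  rewrite -(WA u (T / 2) v)//; [|exact: ltW..].
  by apply: lerD; [apply: Wl => //|apply: Wr => //]; exact: ltW.
have uZ : uniform_path eucl_dist T Z.
  move=> e e0; have e20 : 0 < e / 2 by lra.
  have [eta1 eta10 H1] := u1 _ e20; have [eta2 eta20 H2] := u2 _ e20.
  have mpos : 0 < Num.min eta1 eta2 by rewrite lt_min eta10.
  exists (Num.min eta1 eta2 / 2); first by rewrite divr_gt0.
  have near_l x y : 0 <= x -> x <= T / 2 -> 0 <= y -> y <= T / 2 ->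
      `|x - y| < Num.min eta1 eta2 / 2 -> eucl_dist (Z x) (Z y) < e / 2.
    move=> x0 xT y0 yT xy; rewrite /Z !cat_pathl//; apply: H1; try lra.
    move: xy; rewrite ltr_pdivlMr// lt_min => /andP[xy _].
    by rewrite -mulrBr normrM ger0_norm// mulrC.
  have near_r x y : T / 2 <= x -> x <= T -> T / 2 <= y -> y <= T ->
      `|x - y| < Num.min eta1 eta2 / 2 -> eucl_dist (Z x) (Z y) < e / 2.
    move=> x0 xT y0 yT xy; rewrite /Z !cat_pathr// eucl_dist_shift; apply: H2; try lra.
    move: xy; rewrite ltr_pdivlMr// lt_min => /andP[_ xy].
    by rewrite (_ : _ - _ = 2 * (x - y)) ?normrM ?[`|2|]ger0_norm// 1?mulrC//; ring.
  have near_lr x y : 0 <= x -> x <= T / 2 -> T / 2 <= y -> y <= T ->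
      `|x - y| < Num.min eta1 eta2 / 2 -> eucl_dist (Z x) (Z y) < e.
    move=> x0 xT y0 yT; rewrite distrC ger0_norm ?subr_ge0 ?(le_trans xT)// => xy.
    have a1 : eucl_dist (Z x) (Z (T / 2)) < e / 2.
      by apply: near_l => //; rewrite distrC ger0_norm; lra.
    have a2 : eucl_dist (Z (T / 2)) (Z y) < e / 2.
      by apply: near_r => //; rewrite distrC ger0_norm; lra.
    by apply: (le_lt_trans (eucl_dist_triangle _ (Z (T / 2)) _)); lra.
  move=> x y x0 xT y0 yT xy.
  have [x2|/ltW x2] := leP x (T / 2); have [y2|/ltW y2] := leP y (T / 2).
  - by apply: lt_trans (near_l _ _ _ _ _ _ xy) _ => //; lra.
  - exact: near_lr.
  - by rewrite eucl_distC; apply: near_lr => //; rewrite distrC.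
  - by apply: lt_trans (near_r _ _ _ _ _ _ xy) _ => //; lra.
have T0' := ltW T0.
have [h1 h2] := control_bv T0' uZ WS Wd; split=> //.
apply: (le_trans h2); rewrite lee_fin /W lol// lor// hil// hir// mulr0.
by rewrite (_ : 2 * T - T = T)//; ring.
Qed.

Lemma iter_int_cat_path T Z1 Z2 : 0 < T -> bv_path T Z1 -> bv_path T Z2 ->
  iter_int (cat_path T Z1 Z2) 0 T = wmul (iter_int Z1 0 T) (iter_int Z2 0 T).
Proof.
move=> T0 b1 b2; have T0' := ltW T0.
have [V1 L1 _] := bv_length_control T0' b1; have [V2 L2 _] := bv_length_control T0' b2.
have [bZ _] := bv_cat_path T0 (bv_uniform b1) (bv_uniform b2) L1 L2.
have [V [pc _] _] := bv_length_control T0' bZ.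
have half0 : 0 <= T / 2 by lra.
have halfT : T / 2 <= T by lra.
apply/funext => w; rewrite (iter_int_Chen w pc (lexx 0) half0 halfT (lexx T)).
apply: eq_wmul => v _; rewrite /iter_int.
  rewrite (@iter_int_rev_affine _ _ _ Z1 0 (T / 2) 2 0 (fun=> 0))//; last first.
    by move=> u u0 uT i; rewrite cat_pathl// !addr0.
  by rewrite mulr0 !addr0 mulrC divfK.
rewrite (@iter_int_rev_affine _ _ _ Z2 (T / 2) T 2 (- T) (fun i => (Z1 T - Z2 0) 0 i))//; last first.
  by move=> u u0 uT i; rewrite cat_pathr// !mxE.
by rewrite mulrC divfK// subrr (_ : 2 * T - T = T)//; ring.
Qed.

Lemma time_revK T Z : time_rev T (time_rev T Z) = Z.
Proof. by apply/funext => u; rewrite /time_rev subKr. Qed.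

Lemma bv_time_rev T Z : 0 <= T -> bv_path T Z -> bv_path T (time_rev T Z) /\
  (var_norm eucl_dist 1 (time_rev T Z) 0 T <= var_norm eucl_dist 1 Z 0 T)%E.
Proof.
move=> T0 bZ; have uZ := bv_uniform bZ.
have [V LV ->] := bv_length_control T0 bZ.
have [pr dr] := time_rev_control uZ LV.
have := control_bv T0 (time_rev_uniform uZ) (path_control_super pr) dr.
by rewrite subrr subr0.
Qed.

End Concatenation.

(** * The free nilpotent group and its metric *)

Section Group.
Context {R : realType} {T : R} {n N : nat}.
Hypothesis T_gt0 : 0 < T.
Implicit Types (g h k : tensor R n N) (Z : R -> 'rV[R]_n).

Let T_ge0 : 0 <= T. Proof. exact: ltW. Qed.

Lemma coef_signature Z s t w : (size w <= N)%N ->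
  coef (signature N Z s t) w = iter_int Z s t w.
Proof. by move=> wN; rewrite /coef ffunE insub_bseqK. Qed.

Lemma signature_cat Z1 Z2 : bv_path T Z1 -> bv_path T Z2 ->
  signature N (cat_path T Z1 Z2) 0 T = tmul (signature N Z1 0 T) (signature N Z2 0 T).
Proof.
move=> b1 b2; apply: eq_coef => w wN.
rewrite coef_tmul// coef_signature// iter_int_cat_path//.
by apply: eq_wmul => v vw; rewrite coef_signature// (leq_trans vw).
Qed.

Lemma signature_rev Z : bv_path T Z ->
  tmul (signature N Z 0 T) (signature N (time_rev T Z) 0 T) = tone.
Proof.
move=> bZ; apply: eq_coef => w wN.
rewrite coef_tmul// coef_tone// -(iter_int_time_rev T_ge0 bZ).
by apply: eq_wmul => v vw; rewrite coef_signature// (leq_trans vw).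
Qed.

Lemma tinv_signature Z : bv_path T Z ->
  tinv (signature N Z 0 T) = signature N (time_rev T Z) 0 T.
Proof.
move=> bZ; apply: tinvE; first exact: signature_rev.
by rewrite -{2}(time_revK T Z); apply: signature_rev; exact: (bv_time_rev T_ge0 bZ).1.
Qed.

Notation G := (GN T n N).

Lemma GN_mul g h : G g -> G h -> G (tmul g h).
Proof.
move=> [Z1 b1 <-] [Z2 b2 <-]; exists (cat_path T Z1 Z2); last exact: signature_cat.
have [V1 L1 _] := bv_length_control T_ge0 b1; have [V2 L2 _] := bv_length_control T_ge0 b2.
exact: (bv_cat_path T_gt0 (bv_uniform b1) (bv_uniform b2) L1 L2).1.
Qed.

Lemma GN_inv g : G g -> G (tinv g).
Proof.
move=> [Z bZ <-]; rewrite tinv_signature//.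
exact: (ex_intro2 _ _ (time_rev T Z) (bv_time_rev T_ge0 bZ).1 erefl).
Qed.

Lemma GN_mulV g : G g -> tmul g (tinv g) = tone.
Proof. by move=> [Z bZ <-]; rewrite tinv_signature// signature_rev. Qed.

Lemma GN_mulVl g : G g -> tmul (tinv g) g = tone.
Proof.
move=> [Z bZ <-]; rewrite tinv_signature// -{2}(time_revK T Z).
by apply: signature_rev; exact: (bv_time_rev T_ge0 bZ).1.
Qed.

Lemma GN_coef0 g : G g -> coef g [::] = 1.
Proof. by move=> [Z bZ <-]; rewrite coef_signature. Qed.

Lemma GN_invK g : G g -> tinv (tinv g) = g.
Proof. by move=> Gg; apply: tinvE; [exact: GN_mulVl|exact: GN_mulV]. Qed.

Lemma GN_invM g h : G g -> G h -> tinv (tmul g h) = tmul (tinv h) (tinv g).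
Proof.
move=> Gg Gh; apply: tinvE.
  by rewrite tmulA -(tmulA h) GN_mulV// tmul1l GN_mulV.
by rewrite tmulA -(tmulA (tinv g)) GN_mulVl// tmul1l GN_mulVl.
Qed.

Local Notation norm := (@cc_norm R T n N).

Definition cc_lengths g := [set L : R | exists Z, [/\ bv_path T Z, signature N Z 0 T = g
                               & var_norm eucl_dist 1 Z 0 T = L%:E]].

Lemma cc_lengths_ge0 g L : cc_lengths g L -> 0 <= L.
Proof. by move=> [Z [_ _ E]]; rewrite -lee_fin -E poweR_ge0. Qed.

Lemma cc_lengths_nonempty g : G g -> cc_lengths g !=set0.
Proof.
move=> [Z bZ ZE]; have [V _ E] := bv_length_control T_ge0 bZ.
by exists (V 0 T), Z.
Qed.

Lemma cc_norm_ge0 g : 0 <= norm g.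
Proof.
rewrite -[norm g]/(inf (cc_lengths g)).
have [ne|/set0P] := pselect (cc_lengths g !=set0).
  by apply: lb_le_inf => // L; exact: cc_lengths_ge0.
by move=> /negP; rewrite negbK => /eqP ->; rewrite inf0.
Qed.

Lemma cc_norm_le Z L : bv_path T Z -> (var_norm eucl_dist 1 Z 0 T <= L%:E)%E ->
  norm (signature N Z 0 T) <= L.
Proof.
move=> bZ ZL; have [V _ E] := bv_length_control T_ge0 bZ.
apply: (@le_trans _ _ (V 0 T)); last by rewrite -lee_fin -E.
apply: ge_inf; first by exists 0 => L'; exact: cc_lengths_ge0.
by exists Z.
Qed.

Lemma cc_norm_lt g e : G g -> 0 < e -> exists Z, [/\ bv_path T Z, signature N Z 0 T = g
  & (var_norm eucl_dist 1 Z 0 T < (norm g + e)%:E)%E].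
Proof.
move=> Gg e0; have [|L [Z [bZ ZE ZL]] Lg] := @inf_adherent _ (cc_lengths g) e e0.
  by split; [exact: cc_lengths_nonempty|exists 0 => L; exact: cc_lengths_ge0].
by exists Z; split=> //; rewrite ZL lte_fin.
Qed.

Lemma cc_norm_mul g h : G g -> G h -> norm (tmul g h) <= norm g + norm h.
Proof.
move=> Gg Gh; apply/ler_addgt0Pr => e e0; have e20 : 0 < e / 2 by lra.
have [Z1 [b1 E1 l1]] := cc_norm_lt Gg e20; have [Z2 [b2 E2 l2]] := cc_norm_lt Gh e20.
have [V1 L1 VE1] := bv_length_control T_ge0 b1; have [V2 L2 VE2] := bv_length_control T_ge0 b2.
have [bZ ZL] := bv_cat_path T_gt0 (bv_uniform b1) (bv_uniform b2) L1 L2.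
rewrite -E1 -E2 -(signature_cat b1 b2) E1 E2.
apply: (cc_norm_le bZ); apply: (le_trans ZL).
rewrite VE1 lte_fin in l1; rewrite VE2 lte_fin in l2.
by rewrite lee_fin; lra.
Qed.

Lemma cc_norm_inv_le g : G g -> norm (tinv g) <= norm g.
Proof.
move=> Gg; apply/ler_addgt0Pr => e e0.
have [Z [bZ E l]] := cc_norm_lt Gg e0; have [bR lR] := bv_time_rev T_ge0 bZ.
rewrite -{1}E (tinv_signature bZ).
exact: (cc_norm_le bR (le_trans lR (ltW l))).
Qed.

Lemma cc_norm_inv g : G g -> norm (tinv g) = norm g.
Proof.
move=> Gg; apply/eqP; rewrite eq_le cc_norm_inv_le//=.
by rewrite -{1}(GN_invK Gg) cc_norm_inv_le//; exact: GN_inv.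
Qed.

(** Realised by the constant path. *)
Lemma GN_tone : G tone /\ norm tone = 0.
Proof.
pose Z : R -> 'rV[R]_n := fun=> 0.
have uZ : uniform_path eucl_dist T Z.
  by move=> e e0; exists 1 => // x y *; rewrite eucl_distxx.
have S0 : superadditive 0 T (fun _ _ : R => 0 : R).
  by split=> // *; rewrite addr0.
have [|bZ ZL] := @control_bv _ _ T Z _ T_ge0 uZ S0.
  by move=> u v _ _ _; rewrite eucl_distxx.
have ZE : signature N Z 0 T = tone.
  apply: eq_coef => w wN; rewrite coef_signature// coef_tone//.
  have [V [pc _] VE] := bv_length_control T_ge0 bZ.
  have V0 : V 0 T = 0.
    have [_ Vp _ _] := pc.
    apply/eqP; rewrite eq_le (Vp 0 T (lexx 0) T_ge0 (lexx T)) andbT -lee_fin -VE.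
    exact: ZL.
  case: w wN => [//|i w] wN.
  have := iter_int_bound (i :: w) pc (lexx 0) T_ge0 (lexx T).
  by rewrite V0 exprS mul0r normr_le0 => /eqP ->.
split; first by exists Z.
apply/eqP; rewrite eq_le cc_norm_ge0 andbT -ZE.
exact: cc_norm_le.
Qed.

(** After taking roots of order |w| the bound [iter_int_bound] is linear in the
   length, so it passes to the infimum. *)
Lemma cc_norm_coef g w : G g -> (size w <= N)%N ->
  `|coef g w| <= norm g ^+ size w.
Proof.
move=> Gg wN; have [w0|w0] := posnP (size w).
  by rewrite w0 expr0 (size0nil w0) GN_coef0// normr1.
have k0 : 0 < (size w)%:R :> R by rewrite ltr0n.
have key : `|coef g w| `^ (size w)%:R^-1 <= norm g.
  apply: lb_le_inf; first exact: cc_lengths_nonempty.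
  move=> L [Z [bZ ZE ZL]].
  have [V [pc _] VE] := bv_length_control T_ge0 bZ.
  have LE : L = V 0 T by apply/eqP; rewrite -eqe -ZL VE.
  have [_ V0 _ _] := pc.
  have L0 : 0 <= L by rewrite LE V0.
  have := iter_int_bound w pc (lexx 0) T_ge0 (lexx T).
  rewrite -(coef_signature _ _ _ wN) ZE -LE => gL.
  have LK : (L ^+ size w) `^ (size w)%:R^-1 = L.
    by rewrite -powR_mulrn// -powRrM mulfV ?powRr1// lt0r_neq0.
  by rewrite -[leRHS]LK; apply: ge0_ler_powR; rewrite ?nnegrE ?invr_ge0// ?ler0n// exprn_ge0.
rewrite -(powR_mulrn _ (cc_norm_ge0 g)).
have -> : `|coef g w| = (`|coef g w| `^ (size w)%:R^-1) `^ (size w)%:R.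
  by rewrite -powRrM mulVf ?powRr1// lt0r_neq0.
by apply: ge0_ler_powR; rewrite ?nnegrE ?ler0n ?powR_ge0 ?cc_norm_ge0.
Qed.

Lemma cc_dist_ge0 (x y : G) : 0 <= cc_dist T n N x y.
Proof. exact: cc_norm_ge0. Qed.

Lemma GN_val (x : G) : G (val x).
Proof. exact: set_mem (valP x). Qed.

Lemma cc_distC (x y : G) : cc_dist T n N x y = cc_dist T n N y x.
Proof.
have Gx := GN_val x; have Gy := GN_val y.
rewrite /cc_dist -[LHS]cc_norm_inv; last by apply: GN_mul => //; exact: GN_inv.
by rewrite GN_invM ?GN_invK//; exact: GN_inv.
Qed.

Lemma cc_dist_triangle (x y z : G) :
  cc_dist T n N x z <= cc_dist T n N x y + cc_dist T n N y z.
Proof.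
have Gx := GN_inv (GN_val x); have Gy := GN_val y; have Gz := GN_val z.
have Gy' := GN_inv Gy.
rewrite /cc_dist; apply: le_trans (cc_norm_mul _ _); try exact: GN_mul.
by rewrite tmulA -(tmulA (val y)) GN_mulV// tmul1l.
Qed.

Lemma cc_distxx (x : G) : cc_dist T n N x x = 0.
Proof. by rewrite /cc_dist GN_mulVl; [exact: GN_tone.2|exact: GN_val]. Qed.

End Group.

(** * Gap functions and their partition sums *)

Section Gaps.
Context {R : realType}.
Implicit Types (D w : R -> R -> R) (T r alpha beta : R).

(** Uniform joint continuity on the whole plane; it holds for gaps of paths that
   are extended constantly outside their interval. *)
Definition ucont2 D := forall e : R, 0 < e -> exists2 eta : R, 0 < eta &
  forall u v u' v' : R, `|u - u'| < eta -> `|v - v'| < eta -> `|D u v - D u' v'| < e.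

Lemma ucont2_continuous D (f g : R -> R) : ucont2 D ->
  (forall x y : R, `|f x - f y| <= `|x - y|) -> (forall x y : R, `|g x - g y| <= `|x - y|) ->
  continuous (fun x => D (f x) (g x)).
Proof.
move=> uD fL gL x; apply/(@cvgrPdist_lt _ _) => /= e e0.
have [eta eta0 H] := uD e e0; apply/nbhs_ballP; exists eta => //= y xy.
by apply: H; apply: le_lt_trans xy; [exact: fL|exact: gL].
Qed.

Lemma locint_powR (f : R -> R) r : continuous f -> (forall x, 0 <= f x) -> 0 <= r ->
  locint (fun x => f x `^ r).
Proof.
move=> cf f0 r0; apply: bounded_locint.
  apply: (measurableT_comp (measurable_powR r)).
  exact: continuous_measurable_fun.
move=> x y; have [xy|yx] := leP x y; last by exists 0 => u; lra.
have [|c _ fc] := @EVT_max _ f x y xy; first by apply: continuous_subspaceT.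
exists (f c `^ r) => u uxy; rewrite ger0_norm ?powR_ge0//.
by apply: ge0_ler_powR; rewrite ?nnegrE// fc// in_itv.
Qed.

Lemma ucont2_locint D r h : ucont2 D -> (forall u v, 0 <= D u v) -> 0 <= r ->
  locint (fun x => D x (x + h) `^ r).
Proof.
move=> uD D0 r0; apply: locint_powR => //.
apply: (@ucont2_continuous D id (fun x => x + h)) => // x y.
by rewrite (_ : x + h - (y + h) = x - y)//; ring.
Qed.

(** Apply [chaining_bound] with Q = wN^(1/r) + e', positive even where the
   control vanishes, and let e' tend to 0. *)
Lemma chaining_control D r alpha beta T wN (E s t : R) :
  (forall u v, 0 <= D u v) -> ucont2 D -> (forall u, D u u = 0) ->
  1 <= r -> 0 < alpha -> beta = alpha / r ->
  superadditive 0 T wN -> N_controlled 0 T D r alpha wN ->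
  0 <= s -> s < t -> t <= T -> 0 <= E ->
  (forall x u y, s <= x -> x <= u -> u <= y -> y <= t ->
    D x y <= D x u + D u y + E * (y - x) `^ beta) ->
  D s t <= (2 / (1 - 2^-1 `^ beta) + 1) * (wN s t `^ r^-1 + E) * (t - s) `^ beta.
Proof.
move=> D0 uD Dxx r1 al0 bE wS wN_ s0 st tT E0 Dtri.
have r0 : 0 < r by lra.
have b0 : 0 < beta by rewrite bE divr_gt0.
have c1 := half_powR_lt1 b0.
set C := 2 / _ + 1; have C0 : 0 < C by rewrite /C ltr_pwDr// divr_ge0// subr_ge0 ltW.
have L0 : 0 < (t - s) `^ beta by rewrite powR_gt0// subr_gt0.
apply/ler_addgt0Pr => e e0.
have e'0 : 0 < e / (C * (t - s) `^ beta) by rewrite divr_gt0// mulr_gt0.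
set e' := e / _ in e'0.
have w0 : 0 <= wN s t by apply: wS.1 => //; exact: ltW.
pose Q := wN s t `^ r^-1 + e'.
have Q0 : 0 < Q by rewrite /Q ltr_wpDl// powR_ge0.
have QwN : wN s t <= Q `^ r.
  rewrite -[leLHS](powRr1 w0) -(mulVf (lt0r_neq0 r0)) powRrM.
  apply: ge0_ler_powR; rewrite ?nnegrE ?powR_ge0// ?(ltW r0)// ?(ltW Q0)//.
  by rewrite /Q lerDl ltW.
have := @chaining_bound _ D r alpha beta Q E s t bE D0 r1 al0 Q0 E0 st.
move=> /(_ _ _ _ _ (Dxx s) (Dxx t) Dtri) H.
have : D s t <= C * (Q + E) * (t - s) `^ beta.
  apply: H.
  - move=> u; apply: (@ucont2_continuous D (fun=> u) id) => // x y.
    by rewrite subrr normr0.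
  - move=> v; apply: (@ucont2_continuous D id (fun=> v)) => // x y.
    by rewrite subrr normr0.
  - move=> h; apply: (@ucont2_continuous D id (fun x => x + h)) => // x y.
    by rewrite (_ : x + h - (y + h) = x - y)//; ring.
  - by move=> h; apply: ucont2_locint => //; exact: ltW.
  - move=> h h0 hst; apply: (le_trans (wN_ s t h s0 st tT h0 hst)).
    by apply: ler_wpM2r => //; exact: powR_ge0.
move/le_trans; apply.
rewrite /Q (_ : C * (_ + e' + E) * _ =
  C * (wN s t `^ r^-1 + E) * (t - s) `^ beta + e' * (C * (t - s) `^ beta)); last by ring.
by rewrite lerD2l /e' divfK// gt_eqF// mulr_gt0.
Qed.

(** A metric satisfies the triangle inequality without error. *)
Lemma metric_N_to_V D r alpha T wN :
  (forall u v, 0 <= D u v) -> ucont2 D -> (forall u, D u u = 0) ->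
  1 <= r -> 0 < alpha ->
  superadditive 0 T wN -> N_controlled 0 T D r alpha wN ->
  (forall x u y, D x y <= D x u + D u y) ->
  V_controlled 0 T D r alpha
    (fun u v => (2 / (1 - 2^-1 `^ (alpha / r)) + 1) `^ r * wN u v).
Proof.
move=> D0 uD Dxx r1 al0 wS wN_ Dtri u v u0 uv vT.
have r0 : 0 < r by lra.
have b0 : 0 < alpha / r by rewrite divr_gt0.
have c1 := half_powR_lt1 b0.
have := @chaining_control D r alpha _ T wN 0 u v D0 uD Dxx r1 al0 erefl wS wN_ u0 uv vT (lexx 0).
set C := 2 / _ + 1; have C0 : 0 <= C by rewrite /C addr_ge0// divr_ge0// subr_ge0 ltW.
move=> H; have {}H : D u v <= C * wN u v `^ r^-1 * (v - u) `^ (alpha / r).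
  by rewrite -[_ `^ r^-1]addr0; apply: H => x z y *; rewrite mul0r addr0.
have w0 : 0 <= wN u v by apply: wS.1 => //; exact: ltW.
apply: (@le_trans _ _ ((C * wN u v `^ r^-1 * (v - u) `^ (alpha / r)) `^ r)).
  by apply: ge0_ler_powR; rewrite ?nnegrE ?(ltW r0)// !mulr_ge0 ?powR_ge0.
rewrite !powRM ?mulr_ge0 ?powR_ge0// -!powRrM mulVf ?gt_eqF// powRr1// divfK ?gt_eqF//.
Qed.

Section Sums.
Variables (D : R -> R -> R) (r alpha e T : R).
Hypotheses (D_ge0 : forall u v, 0 <= D u v) (r_gt0 : 0 < r) (alpha_gt0 : 0 < alpha).
Hypotheses (e_gt0 : 0 < e) (er : e * r = 1 + alpha) (T_ge0 : 0 <= T).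

(** The summands of the three norms, where [e] stands for delta k; hence the
   relation e r = 1 + alpha. *)
Definition gapV u v : \bar R := (D u v `^ r / (v - u) `^ alpha)%:E.

Definition gapvar u v : \bar R :=
  poweR (sup_partition (fun x y => (D x y `^ e^-1)%:E) u v) e.

Definition gapT u v : \bar R :=
  (poweR (gapvar u v) r * ((v - u) `^ alpha)^-1%:E)%E.

Definition gapN u v : \bar R :=
  ereal_sup [set ((h `^ (- e))%:E *
      poweR (\int[lebesgue_measure]_(x in `[u, (v - h)%R])
               (D x (x + h)%R `^ r)%:E) r^-1)%E
    | h in [set h : R | 0 < h <= v - u]].

Definition gapNp u v : \bar R := poweR (gapN u v) r.

Lemma gapV_ge0 u v : (0 <= gapV u v)%E.
Proof. by rewrite lee_fin divr_ge0 ?powR_ge0. Qed.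

Lemma gapT_ge0 u v : (0 <= gapT u v)%E.
Proof. by rewrite mule_ge0 ?poweR_ge0// lee_fin invr_ge0 powR_ge0. Qed.

Lemma gapNp_ge0 u v : (0 <= gapNp u v)%E.
Proof. exact: poweR_ge0. Qed.

Lemma gapN_ge0 u v : u < v -> (0 <= gapN u v)%E.
Proof.
move=> uv; have h0 : 0 < v - u by rewrite subr_gt0.
apply: (@le_trans _ _ (((v - u) `^ (- e))%:E * poweR (\int[lebesgue_measure]_(x in `[u, (v - (v - u))%R])
               (D x (x + (v - u))%R `^ r)%:E) r^-1)%E).
  by rewrite mule_ge0 ?poweR_ge0// lee_fin powR_ge0.
by apply: ereal_sup_ubound; exists (v - u) => //=; rewrite h0 lexx.
Qed.

Lemma dominated_gapV a b w :
  dominated a b gapV w <-> V_controlled a b D r alpha w.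
Proof.
split=> H u v au uv vb; have := H u v au uv vb; rewrite lee_fin => {}H;
  have L0 : 0 < (v - u) `^ alpha by rewrite powR_gt0// subr_gt0.
  by rewrite -ler_pdivrMr.
by rewrite ler_pdivrMr.
Qed.

Lemma gapV_le_gapT u v : u < v -> (gapV u v <= gapT u v)%E.
Proof.
move=> uv; rewrite /gapV /gapT EFinM; apply: lee_wpmul2r.
  by rewrite lee_fin invr_ge0 powR_ge0.
rewrite -poweR_EFin; apply: gt0_ler_poweR; rewrite ?in_itv /= ?leey ?lee_fin ?D_ge0 ?poweR_ge0//.
  exact: ltW.
have -> : (D u v)%:E = poweR (D u v `^ e^-1)%:E e.
  by rewrite poweR_EFin -powRrM mulVf ?powRr1// gt_eqF.
apply: gt0_ler_poweR; rewrite ?in_itv /= ?leey ?lee_fin ?powR_ge0//; first exact: ltW.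
  by rewrite sup_partition_ge0// ?ltW// => x y; rewrite lee_fin powR_ge0.
by apply: (@le_sup_partition _ (fun x y => (D x y `^ e^-1)%:E)).
Qed.

Lemma sup_gapV_le_gapT : (sup_partition gapV 0 T <= sup_partition gapT 0 T)%E.
Proof.
apply: ge_ereal_sup => _ [s sP <-].
apply: le_trans (partition_sum_le_sup _ sP).
elim: s 0 sP => [|x s ih] z; first by rewrite !partition_sum_nil.
move=> /itv_partition_consE[zx xs]; rewrite !partition_sum_cons.
by rewrite leeD ?gapV_le_gapT ?ih.
Qed.

Lemma V_controlled_gapT w : superadditive 0 T w -> V_controlled 0 T D r alpha w ->
  (sup_partition gapT 0 T <= (2 `^ (1 + alpha) * w 0 T)%:E)%E.
Proof.
move=> wS wV; apply: (@sup_partition_le _ 0 T gapT (fun u v => 2 `^ (1 + alpha) * w u v)) => //.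
  by apply: superadditiveZ => //; exact: powR_ge0.
move=> u v u0 uv vT; rewrite /gapT /gapvar -poweRrM er.
have L0 : 0 < (v - u) `^ alpha by rewrite powR_gt0// subr_gt0.
have rE : r / (1 + alpha) = e^-1.
  by rewrite -er invfM mulrCA divff ?mulr1// gt_eqF.
have := V_controlled_variation alpha_gt0 wS wV u0 uv vT; rewrite rE => H.
have w0 : 0 <= w u v by apply: wS.1 => //; exact: ltW.
have al1 : 0 <= 1 + alpha by rewrite addr_ge0// ltW.
have S0 : (0 <= sup_partition (fun x y => (D x y `^ e^-1)%:E) u v)%E.
  by apply: sup_partition_ge0; [move=> x y; rewrite lee_fin powR_ge0|exact: ltW].
apply: (@le_trans _ _ ((2 `^ (1 + alpha) * (w u v * (v - u) `^ alpha))%:E * ((v - u) `^ alpha)^-1%:E)%E).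
  apply: lee_wpmul2r; first by rewrite lee_fin invr_ge0 powR_ge0.
  rewrite -variation_power// -?poweR_EFin; last by rewrite subr_ge0 ltW.
  apply: gt0_ler_poweR; rewrite ?in_itv /= ?leey ?andbT// lee_fin.
  by rewrite !mulr_ge0 ?powR_ge0.
by rewrite -EFinM -!mulrA divff ?mulr1// gt_eqF.
Qed.

Section Nikolskii.
Variable D' : R -> R -> R.
Hypothesis DD' : forall u v, 0 <= u -> u <= T -> 0 <= v -> v <= T -> D u v = D' u v.
Hypothesis D'n : forall h : R, locint (fun x => D' x (x + h) `^ r).

Let integral_D u v (h : R) (c : R) : 0 <= u -> v <= T -> 0 < h ->
  (Jint (fun x => D' x (x + h) `^ r) u (v - h) <= c <->
  (\int[lebesgue_measure]_(x in `[u, (v - h)%R]) (D x (x + h)%R `^ r)%:E <= c%:E)%E).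
Proof.
move=> u0 vT h0; apply: integral_le_Jint => // x /andP[ux xv].
have ux' := le_trans u0 ux.
rewrite DD'//; first by apply: le_trans vT; rewrite (le_trans xv)// gerBl ltW.
  by rewrite addr_ge0// ltW.
by apply: le_trans vT; rewrite -lerBrDr.
Qed.

(** At the power [r], the term of index [h] of the supremum is h^-(1+alpha)
   times the integral. *)
Lemma dominated_gapNp w : (forall u v, 0 <= u -> u <= v -> v <= T -> 0 <= w u v) ->
  dominated 0 T gapNp w <-> N_controlled 0 T D' r alpha w.
Proof.
move=> w0; split=> H.
  move=> u v h u0 uv vT h0 hvu; apply/integral_D => //.
  have wuv : 0 <= w u v by apply: w0 => //; exact: ltW.
  have {}H := H u v u0 uv vT; rewrite /gapNp in H.
  set I := (\int[_]_(_ in _) _)%E.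
  have I0 : (0 <= I)%E by apply: integral_ge0 => x _; rewrite lee_fin powR_ge0.
  have : ((h `^ (- e))%:E * poweR I r^-1 <= gapN u v)%E.
    by apply: ereal_sup_ubound; exists h => //=; rewrite h0.
  set c := (_ * _)%E => cN.
  have c0 : (0 <= c)%E by rewrite mule_ge0 ?poweR_ge0// lee_fin powR_ge0.
  have : (poweR c r <= (w u v)%:E)%E.
    apply: le_trans H; apply: gt0_ler_poweR; rewrite ?in_itv /= ?leey ?andbT//.
      exact: ltW.
    exact: le_trans cN.
  rewrite /c poweRM ?poweR_ge0 ?lee_fin ?powR_ge0// -poweRrM mulVf ?gt_eqF// poweRe1//.
  rewrite poweR_EFin -powRrM mulNr er powRN.
  have hp : 0 < h `^ (1 + alpha) by rewrite powR_gt0.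
  by rewrite muleC lee_pdivrMr// -EFinM.
move=> u v u0 uv vT; rewrite /gapNp.
have wuv : 0 <= w u v by apply: w0 => //; exact: ltW.
have -> : (w u v)%:E = poweR (w u v `^ r^-1)%:E r.
  by rewrite poweR_EFin -powRrM mulVf ?powRr1// gt_eqF.
have gN : (gapN u v <= (w u v `^ r^-1)%:E)%E.
  apply: ge_ereal_sup => _ [h /= /andP[h0 hvu] <-].
  have := H u v h u0 uv vT h0 hvu.
  move/(integral_D _ u0 vT h0).
  set I := (\int[_]_(_ in _) _)%E => HI.
  have I0 : (0 <= I)%E by apply: integral_ge0 => x _; rewrite lee_fin powR_ge0.
  apply: (@le_trans _ _ ((h `^ (- e))%:E * poweR (w u v * h `^ (1 + alpha))%:E r^-1)%E).
    apply: lee_wpmul2l; first by rewrite lee_fin powR_ge0.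
    apply: gt0_ler_poweR; rewrite ?in_itv /= ?leey ?andbT ?invr_ge0 ?(ltW r_gt0)//.
    by rewrite lee_fin mulr_ge0 ?powR_ge0.
  rewrite poweR_EFin -EFinM lee_fin powRM ?powR_ge0// -powRrM -er mulfK ?gt_eqF//.
  rewrite mulrCA powRN mulVf ?mulr1// gt_eqF// powR_gt0//.
by apply: gt0_ler_poweR; rewrite ?in_itv /= ?leey ?andbT ?lee_fin ?powR_ge0 ?(ltW r_gt0) ?gapN_ge0.
Qed.

End Nikolskii.

End Sums.
End Gaps.

(** * Constant extension of paths *)

Section Clamping.
Context {R : realType}.
Implicit Types (T u v : R).

Definition clamp T u : R := Num.max 0 (Num.min u T).

Lemma clamp_itv T u : 0 <= T -> 0 <= clamp T u <= T.
Proof. by move=> T0; rewrite /clamp le_max lexx ge_max T0 ge_min lexx orbT. Qed.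

Lemma clamp_id T u : 0 <= u -> u <= T -> clamp T u = u.
Proof. by move=> u0 uT; rewrite /clamp (min_idPl uT) (max_idPr u0). Qed.

Lemma clamp_le T u v : u <= v -> 0 <= clamp T v - clamp T u <= v - u.
Proof.
move=> uv; rewrite /clamp /Num.max /Num.min.
by case: ifP; case: ifP; case: ifP; case: ifP; lra.
Qed.

Lemma clamp_lipschitz T u v : `|clamp T u - clamp T v| <= `|u - v|.
Proof.
have [uv|/ltW vu] := leP u v.
  by have /andP[h1 h2] := clamp_le T uv; rewrite distrC (distrC u) !ger0_norm// subr_ge0.
by have /andP[h1 h2] := clamp_le T vu; rewrite !ger0_norm// subr_ge0.
Qed.

Lemma metric_ucont2 (E : Type) (d : E -> E -> R) T f : 0 <= T ->
  (forall x y, d x y = d y x) -> (forall x y z, d x z <= d x y + d y z) ->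
  uniform_path d T f -> ucont2 (fun u v => d (f (clamp T u)) (f (clamp T v))).
Proof.
move=> T0 dC dD uf e e0; have e20 : 0 < e / 2 by lra.
have [eta eta0 H] := uf _ e20; exists eta => // u v u' v' uu vv.
have cl x y : `|x - y| < eta -> d (f (clamp T x)) (f (clamp T y)) < e / 2.
  move=> xy; have /andP[? ?] := clamp_itv x T0; have /andP[? ?] := clamp_itv y T0.
  by apply: H => //; apply: le_lt_trans (clamp_lipschitz _ _ _) xy.
have h1 := cl _ _ uu; have h2 := cl _ _ vv.
set a := f _ in h1 *; set b := f (clamp T v) in h2 *.
set a' := f (clamp T u') in h1 *; set b' := f (clamp T v') in h2 *.
have := dD a a' b; have := dD a' b' b; have := dD a' a b'; have := dD a b b'.
rewrite (dC a' a) (dC b' b) ltr_norml => *; lra.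
Qed.

End Clamping.

(** * Powers of suprema over partitions *)

Section SupPow.
Context {R : realType}.

(** Reduces the level distances, which have a power inside the supremum, to the
   same suprema as the metric norms. *)
Lemma sup_partition_powE (F : R -> R -> \bar R) (e s t : R) :
  (forall u v, (0 <= F u v)%E) -> s <= t -> 0 < e ->
  sup_partition_pow e F s t = poweR (sup_partition F s t) e.
Proof.
move=> F0 st e0; have S0 := sup_partition_ge0 F0 st.
have [r0 r0P] := itv_partitionP st.
have P0 : (0 <= sup_partition_pow e F s t)%E.
  apply: (@le_trans _ _ (poweR (partition_sum F s t r0) e)); first exact: poweR_ge0.
  by apply: ereal_sup_ubound; exists r0.
have mono (x y : \bar R) (f : R) : 0 < f -> (0 <= x)%E -> (x <= y)%E -> (poweR x f <= poweR y f)%E.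
  move=> f0 x0 xy; apply: gt0_ler_poweR; rewrite ?in_itv /= ?leey ?andbT ?(ltW f0)//.
  exact: le_trans xy.
apply/eqP; rewrite eq_le; apply/andP; split.
  apply: ge_ereal_sup => _ [r rP <-]; exact: (mono _ _ e e0 (partition_sum_ge0 F0 _ _ _) (partition_sum_le_sup F rP)).
have -> : sup_partition_pow e F s t
    = poweR (poweR (sup_partition_pow e F s t) e^-1) e.
  by rewrite -poweRrM mulVf ?gt_eqF// poweRe1.
apply: (mono _ _ e e0 S0); apply: ge_ereal_sup => _ [r rP <-].
have q0 := partition_sum_ge0 F0 s t r.
have -> : partition_sum F s t r = poweR (poweR (partition_sum F s t r) e) e^-1.
  by rewrite -poweRrM mulfV ?gt_eqF// poweRe1.
apply: mono; [by rewrite invr_gt0|exact: poweR_ge0|].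
by apply: ereal_sup_ubound; exists r.
Qed.

End SupPow.

(** * Level gaps of two rough paths *)

Section LevelGaps.
Context {R : realType} {T : R} {n N : nat}.
Hypothesis T_gt0 : 0 < T.
Notation G := (GN T n N).
Notation dcc := (cc_dist T n N).
Notation K := (#|{bseq N of 'I_n}|%:R : R).
Implicit Types (X : R -> G) (g h a b c : tensor R n N).

Let T_ge0 : 0 <= T := ltW T_gt0.

Definition glift X u : tensor R n N := val (X (clamp T u)).

Lemma GN_lift X u : G (glift X u).
Proof. exact: GN_val. Qed.

Lemma GN_tincr X u v : G (tincr (glift X) u v).
Proof.
by apply: (GN_mul T_gt0); [apply: (GN_inv T_gt0)|]; exact: GN_lift.
Qed.

Lemma tincr_mul X u v w : tincr (glift X) u w = tmul (tincr (glift X) u v) (tincr (glift X) v w).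
Proof.
rewrite /tincr tmulA -(tmulA (glift X v)) (GN_mulV T_gt0) ?tmul1l//.
exact: GN_lift.
Qed.

Lemma tincrxx X u : tincr (glift X) u u = tone.
Proof. by rewrite /tincr (GN_mulVl T_gt0)//; exact: GN_lift. Qed.

Lemma cc_norm_tincr X u v :
  cc_norm T (tincr (glift X) u v) = dcc (X (clamp T u)) (X (clamp T v)).
Proof. by []. Qed.

Lemma level_GN k g : G g -> (k <= N)%N -> level k g <= K * cc_norm T g ^+ k.
Proof.
move=> Gg kN; apply: level_le; first by rewrite exprn_ge0// cc_norm_ge0.
by move=> w wk wN; rewrite -wk; exact: cc_norm_coef.
Qed.

Lemma level_dist k a b : `|level k a - level k b| <= level k (a - b).
Proof.
have h1 : level k a <= level k (a - b) + level k b.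
  by apply: level_triangle => w _ _; rewrite tcoefB subrK.
have h2 : level k b <= level k (a - b) + level k a.
  rewrite (_ : level k (a - b) = level k (b - a)).
    by apply: level_triangle => w _ _; rewrite tcoefB subrK.
  rewrite /level /tnorm; congr Num.sqrt; apply: eq_bigr => w _.
  by rewrite !ffunE; case: ifP => // _; rewrite -sqrrN; congr (_ ^+ 2); ring.
by rewrite ler_norml; lra.
Qed.

(** The empty prefix, or suffix, reproduces [Y] exactly and all other
   splittings are small. *)
Lemma wmul_near (S : Type) (A B Y : seq S -> R) (eps M : R) (m : nat) (w : seq S) :
  A [::] = 1 -> B [::] = 1 -> 0 <= eps ->
  (forall v, (0 < size v)%N -> (size v <= m)%N -> `|A v| <= eps) ->
  (forall v, (0 < size v)%N -> (size v <= m)%N -> `|B v| <= eps) ->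
  (forall v, (size v <= m)%N -> `|Y v| <= M) -> (size w <= m)%N ->
  `|wmul A Y w - Y w| <= m%:R * (eps * M) /\ `|wmul Y B w - Y w| <= m%:R * (eps * M).
Proof.
move=> A1 B1 eps0 Ae Be YM wm.
have M0 : 0 <= M by apply: le_trans (YM [::] _).
have eM : 0 <= eps * M by exact: mulr_ge0.
have sumle (F : nat -> R) : (forall i, (i < size w)%N -> `|F i| <= eps * M) ->
    `|\sum_(0 <= i < size w) F i| <= m%:R * (eps * M).
  move=> FM; apply: (le_trans (ler_norm_sum _ _ _)).
  apply: (@le_trans _ _ (\sum_(0 <= i < size w) (eps * M))).
    by apply: ler_sum_nat => i /andP[_ iw]; exact: FM.
  rewrite sumr_const_nat subn0 -[leLHS]mulr_natl; apply: ler_wpM2r => //.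
  by rewrite ler_nat.
split.
  rewrite /wmul big_nat_recl// take0 drop0 A1 mul1r addrAC subrr add0r.
  apply: sumle => i iw; rewrite normrM; apply: ler_pM => //; [apply: Ae|apply: YM].
  - by rewrite size_takel.
  - by rewrite size_takel// (leq_trans iw).
  - by rewrite size_drop (leq_trans (leq_subr _ _)).
rewrite /wmul big_nat_recr//= take_size drop_size B1 mulr1 addrK.
apply: sumle => i iw; rewrite normrM mulrC; apply: ler_pM => //; [apply: Be|apply: YM].
- by rewrite size_drop subn_gt0.
- by rewrite size_drop (leq_trans (leq_subr _ _)).
- by rewrite size_takel ?(ltnW iw)// (leq_trans (ltnW iw)).
Qed.

Lemma coef_GN_near (a b c : tensor R n N) (eps Kb : R) w : G a -> G b -> G c ->
  0 <= eps -> eps <= 1 -> 0 <= Kb ->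
  cc_norm T a <= eps -> cc_norm T c <= eps -> cc_norm T b <= Kb -> (size w <= N)%N ->
  `|coef (tmul a (tmul b c)) w - coef b w| <= 2 * (N%:R * (Kb + 1) ^+ N) * eps.
Proof.
move=> Ga Gb Gc eps0 eps1 Kb0 ae ce bK wN.
have small g v : G g -> cc_norm T g <= eps -> (0 < size v)%N -> (size v <= N)%N ->
    `|coef g v| <= eps.
  move=> Gg ge v0 vN; apply: (le_trans (cc_norm_coef T_gt0 Gg vN)).
  have c0 : 0 <= cc_norm T g by exact: cc_norm_ge0.
  apply: le_trans (ge); case: (size v) v0 => // k _; rewrite exprS.
  by apply: ler_piMr => //; apply: exprn_ile1 => //; exact: le_trans ge eps1.
have Kb1 : 1 <= Kb + 1 by lra.
have bounded g v : G g -> cc_norm T g <= Kb + 1 -> (size v <= N)%N ->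
    `|coef g v| <= (Kb + 1) ^+ N.
  move=> Gg gK vN; apply: (le_trans (cc_norm_coef T_gt0 Gg vN)).
  apply: (@le_trans _ _ ((Kb + 1) ^+ size v)); last exact: ler_weXn2l.
  by apply: lerXn2r; rewrite ?nnegrE ?cc_norm_ge0//; lra.
have Gbc : G (tmul b c) by exact: GN_mul.
have bcK : cc_norm T (tmul b c) <= Kb + 1.
  by apply: (le_trans (cc_norm_mul T_gt0 Gb Gc)); lra.
have bK1 : cc_norm T b <= Kb + 1 by lra.
have [h1 _] := wmul_near (GN_coef0 Ga) (GN_coef0 Gc) eps0
  (fun v => small a v Ga ae) (fun v => small c v Gc ce)
  (fun v => bounded _ v Gbc bcK) wN.
have [_ h2] := wmul_near (GN_coef0 Ga) (GN_coef0 Gc) eps0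
  (fun v => small a v Ga ae) (fun v => small c v Gc ce)
  (fun v => bounded _ v Gb bK1) wN.
rewrite coef_tmul//; rewrite -coef_tmul// in h2.
set x := wmul _ _ w in h1 *; set y := coef (tmul b c) w in h1 h2 *.
rewrite (_ : x - coef b w = (x - y) + (y - coef b w)); last by ring.
apply: (le_trans (ler_normD _ _)); lra.
Qed.

Definition gap k X1 X2 u v : R := level k (tincr (glift X1) u v - tincr (glift X2) u v).

Lemma gap_ge0 k X1 X2 u v : 0 <= gap k X1 X2 u v.
Proof. exact: level_ge0. Qed.

Lemma gapxx k X1 X2 u : gap k X1 X2 u u = 0.
Proof.
rewrite /gap !tincrxx subrr /level /tnorm big1 ?sqrtr0// => w _.
by rewrite !ffunE; case: ifP => _; rewrite expr0n.
Qed.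

(** X_{u,v} = X_{u,u'} X_{u',v'} X_{v',v}, and the outer factors are close to the
   unit because their Carnot-Caratheodory norms are small. *)
Lemma coef_tincr_ucont X : continuous_path dcc T X -> forall e : R, 0 < e ->
  exists2 eta : R, 0 < eta & forall u v u' v' : R, `|u - u'| < eta -> `|v - v'| < eta ->
  forall w, (size w <= N)%N ->
    `|coef (tincr (glift X) u v) w - coef (tincr (glift X) u' v') w| <= e.
Proof.
move=> cX e e0.
have uX : uniform_path dcc T X.
  apply: continuous_uniform_path cX; first by move=> x y; exact: cc_distC.
  by move=> x y z; exact: cc_dist_triangle.
have [Kb Kb0 KbP] : exists2 Kb : R, 0 <= Kb & forall u v, dcc (X (clamp T u)) (X (clamp T v)) <= Kb.
  have uc := metric_ucont2 T_ge0 (cc_distC T_gt0) (fun x y z => cc_dist_triangle T_gt0 x y z) uX.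
  have cD : continuous (fun v => dcc (X (clamp T 0)) (X (clamp T v))).
    apply: (ucont2_continuous (f := fun=> 0) (g := id) uc) => // x y.
    by rewrite subrr normr0.
  have [|c _ fc] := @EVT_max _ (fun v => dcc (X (clamp T 0)) (X (clamp T v))) 0 T T_ge0.
    by apply: continuous_subspaceT.
  have H v : dcc (X (clamp T 0)) (X (clamp T v)) <= dcc (X (clamp T 0)) (X (clamp T c)).
    have /andP[h1 h2] := clamp_itv v T_ge0.
    have := fc (clamp T v); rewrite in_itv /= h1 h2 => /(_ isT).
    by rewrite (@clamp_id _ T (clamp T v)).
  exists (2 * dcc (X (clamp T 0)) (X (clamp T c))).
    by rewrite mulr_ge0// cc_dist_ge0.
  move=> u v; apply: (le_trans (cc_dist_triangle T_gt0 _ (X (clamp T 0)) _)).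
  by rewrite (cc_distC T_gt0 (X (clamp T u))); have := H u; have := H v; lra.
pose M := 2 * (N%:R * (Kb + 1) ^+ N).
have M0 : 0 <= M by rewrite !mulr_ge0// exprn_ge0// addr_ge0.
pose eps := Num.min 1 (e / (M + 1)).
have eps0 : 0 < eps by rewrite /eps lt_min ltr01 divr_gt0//; lra.
have eps1 : eps <= 1 by rewrite /eps ge_min lexx.
have [eta eta0 H] := uX eps eps0; exists eta => // u v u' v' uu vv w wN.
have cl x y : `|x - y| < eta -> dcc (X (clamp T x)) (X (clamp T y)) <= eps.
  move=> xy; have /andP[? ?] := clamp_itv x T_ge0; have /andP[? ?] := clamp_itv y T_ge0.
  by apply/ltW/H => //; apply: le_lt_trans (clamp_lipschitz _ _ _) xy.
rewrite (tincr_mul X u u' v) (tincr_mul X u' v' v).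
apply: (@le_trans _ _ (M * eps)).
  apply: coef_GN_near => //; try exact: GN_tincr; try exact: ltW.
  - exact: cl.
  - by apply: cl; rewrite distrC.
  - exact: KbP.
apply: (@le_trans _ _ (M * (e / (M + 1)))).
  by apply: ler_wpM2l => //; rewrite /eps ge_min lexx orbT.
by rewrite mulrCA ler_piMr ?(ltW e0)// ler_pdivrMr; lra.
Qed.

Lemma gap_ucont2 k X1 X2 : continuous_path dcc T X1 -> continuous_path dcc T X2 ->
  ucont2 (gap k X1 X2).
Proof.
move=> c1 c2 e e0.
have K0 : 0 <= K by exact: ler0n.
have e'0 : 0 < e / 2 / (K + 1) by rewrite !divr_gt0//; lra.
have [eta1 eta10 H1] := coef_tincr_ucont c1 e'0.
have [eta2 eta20 H2] := coef_tincr_ucont c2 e'0.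
set e' := e / 2 / _ in e'0 H1 H2.
exists (Num.min eta1 eta2); first by rewrite lt_min eta10.
move=> u v u' v'; rewrite !lt_min => /andP[u1 u2] /andP[v1 v2].
apply: (le_lt_trans (level_dist _ _ _)).
apply: (@le_lt_trans _ _ (K * (2 * e'))).
  apply: level_le; first by rewrite mulr_ge0// ltW.
  move=> w _ wN; rewrite !tcoefB.
  have := H1 _ _ _ _ u1 v1 w wN; have := H2 _ _ _ _ u2 v2 w wN.
  rewrite !ler_norml => /andP[? ?] /andP[? ?]; lra.
rewrite /e' (_ : K * (2 * (e / 2 / (K + 1))) = e * (K / (K + 1))); last by field; lra.
by rewrite gtr_pMr// ltr_pdivrMr; lra.
Qed.

(** Chen's relation as a triangle inequality whose error consists of lower
   levels. *)
Lemma gap_triangle k X1 X2 x u y : (0 < k)%N -> (k <= N)%N ->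
  gap k X1 X2 x y <= gap k X1 X2 x u + gap k X1 X2 u y +
  K * \sum_(1 <= i < k) (gap i X1 X2 x u * level (k - i) (tincr (glift X1) u y)
     + level i (tincr (glift X2) x u) * gap (k - i) X1 X2 u y).
Proof.
move=> k0 kN; rewrite {1}/gap (tincr_mul X1 x u y) (tincr_mul X2 x u y).
by apply: level_tmul_gap => //; apply: (@GN_coef0 R T); exact: GN_tincr.
Qed.

End LevelGaps.

(** * Induction on the tensor level *)

Section LevelInduction.
Context {R : realType} {T : R} {n N : nat}.
Notation G := (GN T n N).
Notation dcc := (cc_dist T n N).
Notation K := (#|{bseq N of 'I_n}|%:R : R).
Implicit Types (X : R -> G) (w Om : R -> R -> R).

Lemma powR_split (z p : R) (i k : nat) : 0 < p -> (i <= k)%N -> (0 < k)%N ->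
  z `^ (i%:R / p) * z `^ ((k - i)%:R / p) = z `^ (k%:R / p).
Proof.
move=> p0 ik k0.
have E : i%:R / p + (k - i)%:R / p = k%:R / p.
  by rewrite -mulrDl -natrD subnKC.
rewrite -powRD; first by rewrite E.
have kp : 0 < k%:R / p by rewrite divr_gt0 ?ltr0n.
by rewrite E gt_eqF.
Qed.

Lemma level_le_control (T_gt0 : 0 < T) X (p : R) (z : R) j x u : 0 < p -> 0 <= z -> (j <= N)%N ->
  dcc (X (clamp T x)) (X (clamp T u)) `^ p <= z ->
  level j (tincr (glift X) x u) <= K * z `^ (j%:R / p).
Proof.
move=> p0 z0 jN dz; apply: (le_trans (level_GN T_gt0 (GN_tincr T_gt0 X x u) jN)).
rewrite cc_norm_tincr; apply: ler_wpM2l; first exact: ler0n.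
rewrite -powR_mulrn ?cc_dist_ge0//.
have -> : dcc (X (clamp T x)) (X (clamp T u)) `^ j%:R
    = (dcc (X (clamp T x)) (X (clamp T u)) `^ p) `^ (j%:R / p).
  by rewrite -powRrM mulrCA divff ?mulr1// gt_eqF.
by apply: ge0_ler_powR; rewrite ?nnegrE ?powR_ge0// divr_ge0// ltW.
Qed.

(** [w] controls both paths for the Carnot-Caratheodory distance, [wN k] controls
   the level-[k] gap in the Nikolskii sense, and [y] is the size of the
   N-distance. *)
Definition level_data (p alpha B y : R) X1 X2 w (wN : nat -> R -> R -> R) :=
  [/\ continuous_path dcc T X1 /\ continuous_path dcc T X2,
      superadditive 0 T w /\ w 0 T <= B,
      V_controlled 0 T (fun u v => dcc (X1 (clamp T u)) (X1 (clamp T v))) p alpha w,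
      V_controlled 0 T (fun u v => dcc (X2 (clamp T u)) (X2 (clamp T v))) p alpha w &
      forall k, (0 < k)%N -> (k <= N)%N ->
        [/\ superadditive 0 T (wN k), wN k 0 T <= y `^ (p / k%:R) &
            N_controlled 0 T (gap k X1 X2) (p / k%:R) alpha (wN k)]].

(** The scaling y phi^i with phi^p = Om (v-u)^alpha is preserved by products with
   increments of the paths, which are of size phi at level one. *)
Definition level_bounds (p alpha C y : R) X1 X2 w (m : nat) Om :=
  [/\ superadditive 0 T Om, Om 0 T <= C,
      (forall u v, 0 <= u -> u < v -> v <= T -> w u v <= Om u v) &
      forall i, (0 < i)%N -> (i <= m)%N -> (i <= N)%N ->
        forall u v, 0 <= u -> u < v -> v <= T ->
          gap i X1 X2 u v <= y * (Om u v * (v - u) `^ alpha) `^ (i%:R / p)].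

(** By induction the error in [gap_triangle] is at most a multiple of y phi^k, so
   [chaining_control] bounds the gap at level [k] by y (w'^(k/p) + Om^(k/p))
   times (v-u)^(alpha k/p), where y^(p/k) w' is the Nikolskii control; a multiple
   of w' + Om is then added to the control.  The constant is chosen before the
   paths. *)
Lemma level_induction (p alpha B : R) (m : nat) : 0 < T -> 0 < alpha -> 0 < p ->
  N%:R <= p -> 0 <= B ->
  exists2 C : R, 0 <= C & forall X1 X2 (y : R) w wN, 0 < y ->
    level_data p alpha B y X1 X2 w wN ->
    exists Om, level_bounds p alpha C y X1 X2 w m Om.
Proof.
move=> T0 al0 p0 Np B0; have T0' := ltW T0.
elim: m => [|m [C C0 IH]].
  by exists B => // X1 X2 y w wN y0 [_ [wS wB] _ _ _]; exists w; split=> // -[].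
have [kN|kN] := leqP m.+1 N; last first.
  exists C => // X1 X2 y w wN y0 dat; have [Om [h1 h2 h3 h4]] := IH _ _ _ _ _ y0 dat.
  exists Om; split=> // i i0 im iN; apply: h4 => //.
  by rewrite -ltnS (leq_ltn_trans iN).
set k := m.+1 in kN *.
have k0 : (0 < k)%N by [].
have kr0 : 0 < k%:R :> R by rewrite ltr0n.
pose r := p / k%:R.
have r0 : 0 < r by rewrite /r divr_gt0.
have r1 : 1 <= r by rewrite /r ler_pdivlMr// mul1r (le_trans _ Np)// ler_nat.
have rV : r^-1 = k%:R / p by rewrite /r invf_div.
pose beta := alpha / r.
have b0 : 0 < beta by rewrite /beta divr_gt0.
have bE : beta = alpha * (k%:R / p) by rewrite /beta rV.
have c1 := half_powR_lt1 b0.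
pose Ck : R := 2 / (1 - 2^-1 `^ beta) + 1.
have Ck0 : 0 <= Ck by rewrite /Ck addr_ge0// divr_ge0// subr_ge0 ltW.
(* Fewer than [k] splittings with two terms each; one factor [K] comes from
   [gap_triangle], the other from the size of the increments of the paths. *)
pose A : R := 2 * k%:R * K ^+ 2.
have A0 : 0 <= A by rewrite /A !mulr_ge0// ?ltW// exprn_ge0.
pose c := Ck * (1 + A).
have c0 : 0 <= c by rewrite /c mulr_ge0// addr_ge0.
have cr0 : 0 <= c `^ r by exact: powR_ge0.
exists (C + c `^ r * (1 + C)); first by rewrite addr_ge0// mulr_ge0// addr_ge0.
move=> X1 X2 y w wN y0 dat.
have [Om [OS OC Ow Ogap]] := IH _ _ _ _ _ y0 dat.
have [[cX1 cX2] [wS wB] wX1 wX2 wNP] := dat.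
have [wkS wkB wkN] := wNP k k0 kN.
have yr0 : 0 < y `^ r by exact: powR_gt0.
pose w' u v := (y `^ r)^-1 * wN k u v.
have w'S : superadditive 0 T w' by apply: superadditiveZ => //; rewrite invr_ge0 ltW.
have w'1 : w' 0 T <= 1 by rewrite /w' mulrC ler_pdivrMr// mul1r.
pose S u v := w' u v + Om u v.
have SS : superadditive 0 T S by exact: superadditiveD.
pose Om' u v := Om u v + c `^ r * S u v.
have OS' : superadditive 0 T Om' by apply: superadditiveD => //; exact: superadditiveZ.
have OmOm' u v : 0 <= u -> u < v -> v <= T -> Om u v <= Om' u v.
  by move=> u0 uv vT; rewrite /Om' lerDl mulr_ge0// SS.1// ltW.
exists Om'; split => //.
- rewrite /Om'; apply: lerD => //; apply: ler_wpM2l => //.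
  by rewrite /S; apply: lerD.
- by move=> u v u0 uv vT; apply: (le_trans (Ow _ _ u0 uv vT)); exact: OmOm'.
move=> i i0 ik iN s t s0 st tT.
have st' := ltW st.
have Ost0 : 0 <= Om s t by exact: OS.1.
have L0 : 0 < t - s by rewrite subr_gt0.
have La0 : 0 <= (t - s) `^ alpha by exact: powR_ge0.
move: ik; rewrite leq_eqVlt ltnS => /orP[/eqP iE|im]; last first.
  apply: (le_trans (Ogap i i0 im iN s t s0 st tT)).
  apply: ler_wpM2l; first exact: ltW.
  apply: ge0_ler_powR; rewrite ?nnegrE.
  - by rewrite divr_ge0// ltW.
  - exact: mulr_ge0.
  - by rewrite mulr_ge0//; exact: OS'.1.
  - by apply: ler_wpM2r => //; exact: OmOm'.
rewrite {}iE -/k {i i0 iN}.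
pose E := A * (y * Om s t `^ (k%:R / p)).
have E0 : 0 <= E by rewrite /E !mulr_ge0 ?powR_ge0// ltW.
have kp0 : 0 <= k%:R / p by rewrite divr_ge0// ltW.
have tri x u z : s <= x -> x <= u -> u <= z -> z <= t ->
    gap k X1 X2 x z <= gap k X1 X2 x u + gap k X1 X2 u z + E * (z - x) `^ beta.
  move=> sx xu uz zt; apply: (le_trans (gap_triangle T0 X1 X2 x u z k0 kN)).
  rewrite lerD2l; pose Psi := Om s t * (z - x) `^ alpha.
  have xz := le_trans xu uz.
  have Psi0 : 0 <= Psi by rewrite mulr_ge0// powR_ge0.
  have PsiE : Psi `^ (k%:R / p) = Om s t `^ (k%:R / p) * (z - x) `^ beta.
    by rewrite /Psi powRM ?powR_ge0// -powRrM bE.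
  have psi_le a b : s <= a -> a <= b -> b <= t -> x <= a -> b <= z ->
      Om a b * (b - a) `^ alpha <= Psi.
    move=> sa ab bt xa bz; apply: ler_pM; rewrite ?powR_ge0//.
    - by apply: OS.1 => //; [exact: le_trans s0 sa|exact: le_trans bt tT].
    - exact: (superadditive_mono OS s0 sa ab bt tT).
    - apply: ge0_ler_powR; [exact: ltW|by rewrite nnegrE subr_ge0|by rewrite nnegrE subr_ge0|exact: lerB].
  have gap_le j a b : (0 < j)%N -> (j < k)%N -> s <= a -> a <= b -> b <= t -> x <= a -> b <= z ->
      gap j X1 X2 a b <= y * Psi `^ (j%:R / p).
    move=> j0 jk sa; rewrite le_eqVlt => /orP[/eqP <- _ _ _|ab bt xa bz].
      by rewrite (gapxx T0) mulr_ge0 ?powR_ge0// ltW.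
    have jN : (j <= N)%N by rewrite (leq_trans (ltnW jk)).
    apply: (le_trans (Ogap j j0 jk jN a b (le_trans s0 sa) ab (le_trans bt tT))).
    apply: ler_wpM2l; first exact: ltW.
    apply: ge0_ler_powR; rewrite ?nnegrE ?divr_ge0 ?(ltW p0) ?ler0n//.
      rewrite mulr_ge0 ?powR_ge0//; apply: OS.1; [exact: le_trans s0 sa|exact: ltW|exact: le_trans bt tT].
    by apply: psi_le => //; exact: ltW.
  have lev_le X j a b : V_controlled 0 T (fun u v => dcc (X (clamp T u)) (X (clamp T v))) p alpha w ->
      (0 < j)%N -> (j < k)%N -> s <= a -> a <= b -> b <= t -> x <= a -> b <= z ->
      level j (tincr (glift X) a b) <= K * Psi `^ (j%:R / p).
    move=> wXc j0 jk sa ab bt xa bz.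
    have jN : (j <= N)%N by rewrite (leq_trans (ltnW jk)).
    apply: level_le_control => //.
    move: ab; rewrite le_eqVlt => /orP[/eqP <-|ab].
      by rewrite cc_distxx// powR0// gt_eqF.
    apply: (le_trans (wXc a b (le_trans s0 sa) ab (le_trans bt tT))).
    apply: (@le_trans _ _ (Om a b * (b - a) `^ alpha)); last by apply: psi_le => //; exact: ltW.
    by apply: ler_wpM2r; [exact: powR_ge0|apply: Ow => //; [exact: le_trans s0 sa|exact: le_trans bt tT]].
  have K0 : 0 <= K by exact: ler0n.
  have Psik0 : 0 <= Psi `^ (k%:R / p) by exact: powR_ge0.
  have sumE : \sum_(1 <= j < k) (gap j X1 X2 x u * level (k - j) (tincr (glift X1) u z)
     + level j (tincr (glift X2) x u) * gap (k - j) X1 X2 u z)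
     <= k%:R * (2 * (y * K * Psi `^ (k%:R / p))).
    apply: (@le_trans _ _ (\sum_(1 <= j < k) (2 * (y * K * Psi `^ (k%:R / p))))).
      apply: ler_sum_nat => j /andP[j0 jk].
      have jk' := ltnW jk.
      have kj0 : (0 < k - j)%N by rewrite subn_gt0.
      have kjk : (k - j < k)%N by rewrite ltn_subrL j0.
      have split_j := powR_split Psi p0 jk' k0.
      have t1 : gap j X1 X2 x u * level (k - j) (tincr (glift X1) u z)
          <= y * K * Psi `^ (k%:R / p).
        apply: (@le_trans _ _ (y * Psi `^ (j%:R / p) * (K * Psi `^ ((k - j)%:R / p)))).
          apply: ler_pM; rewrite ?gap_ge0 ?level_ge0//.
            by apply: gap_le => //; exact: le_trans zt.
          by apply: lev_le => //; exact: le_trans xu.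
        by rewrite -split_j le_eqVlt; apply/orP; left; apply/eqP; ring.
      have t2 : level j (tincr (glift X2) x u) * gap (k - j) X1 X2 u z
          <= y * K * Psi `^ (k%:R / p).
        apply: (@le_trans _ _ (K * Psi `^ (j%:R / p) * (y * Psi `^ ((k - j)%:R / p)))).
          apply: ler_pM; rewrite ?gap_ge0 ?level_ge0//.
            by apply: lev_le => //; exact: le_trans zt.
          by apply: gap_le => //; exact: le_trans xu.
        by rewrite -split_j le_eqVlt; apply/orP; left; apply/eqP; ring.
      by rewrite [leRHS]mulr_natl mulr2n lerD.
    rewrite sumr_const_nat -[leLHS]mulr_natl; apply: ler_wpM2r.
      by rewrite !mulr_ge0// ltW.
    by rewrite ler_nat leq_subr.
  apply: (le_trans (ler_wpM2l K0 sumE)); rewrite PsiE /E /A.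
  by rewrite le_eqVlt; apply/orP; left; apply/eqP; ring.
have main := chaining_control (gap_ge0 k X1 X2) (gap_ucont2 T0 k cX1 cX2)
  (gapxx T0 k X1 X2) r1 al0 (erefl beta) wkS wkN s0 st tT E0 tri.
rewrite -/Ck rV in main; apply: (le_trans main).
have w'0 : 0 <= w' s t by exact: w'S.1.
have S0 : 0 <= S s t by exact: SS.1.
have wE : wN k s t `^ (k%:R / p) = y * w' s t `^ (k%:R / p).
  have -> : wN k s t = y `^ r * w' s t by rewrite /w' mulrA mulfV ?mul1r// gt_eqF.
  by rewrite powRM ?powR_ge0// -powRrM -rV mulfV ?gt_eqF// powRr1// ltW.
have Sw : w' s t `^ (k%:R / p) <= S s t `^ (k%:R / p).
  by apply: ge0_ler_powR; rewrite ?nnegrE// /S lerDl.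
have SOm : Om s t `^ (k%:R / p) <= S s t `^ (k%:R / p).
  by apply: ge0_ler_powR; rewrite ?nnegrE// /S lerDr.
have tb0 : 0 <= (t - s) `^ beta by exact: powR_ge0.
apply: (@le_trans _ _ (Ck * (y * ((1 + A) * S s t `^ (k%:R / p))) * (t - s) `^ beta)).
  apply: ler_wpM2r => //; apply: ler_wpM2l => //; rewrite wE /E.
  rewrite (_ : y * _ + A * (y * _) = y * (w' s t `^ (k%:R / p) + A * Om s t `^ (k%:R / p))); last by ring.
  apply: ler_wpM2l; first exact: ltW.
  by rewrite mulrDl mul1r lerD// ler_wpM2l.
have -> : Ck * (y * ((1 + A) * S s t `^ (k%:R / p))) * (t - s) `^ beta
    = y * (c `^ r * S s t * (t - s) `^ alpha) `^ (k%:R / p).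
  rewrite (powRM _ (mulr_ge0 cr0 S0) La0) (powRM _ cr0 S0) -!powRrM -bE -rV.
  by rewrite mulfV ?gt_eqF// powRr1// /c; ring.
apply: ler_wpM2l; first exact: ltW.
apply: ge0_ler_powR; rewrite ?nnegrE//.
- by rewrite !mulr_ge0.
- by rewrite mulr_ge0//; exact: OS'.1.
- by apply: ler_wpM2r => //; rewrite /Om' lerDr.
Qed.

End LevelInduction.

(** * Comparison of the three sums *)

Section ClampedControls.
Context {R : realType}.
Implicit Types (D w : R -> R -> R) (T r alpha : R).

Definition agree_on T D D' := forall u v : R,
  0 <= u -> u <= T -> 0 <= v -> v <= T -> D u v = D' u v.

Lemma V_controlled_agree T D D' r alpha w : agree_on T D D' ->
  V_controlled 0 T D r alpha w <-> V_controlled 0 T D' r alpha w.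
Proof.
move=> DD'; split=> H u v u0 uv vT; have := H u v u0 uv vT.
  by rewrite DD'// ?(le_trans _ vT)// ?(le_trans u0)// ltW.
by rewrite -DD'// ?(le_trans _ vT)// ?(le_trans u0)// ltW.
Qed.

Lemma eq_sup_partition (F G : R -> R -> \bar R) s t :
  (forall u v, s <= u -> u < v -> v <= t -> F u v = G u v) ->
  sup_partition F s t = sup_partition G s t.
Proof.
move=> FG; rewrite /sup_partition; congr ereal_sup.
have E (r : seq R) : itv_partition s t r -> partition_sum F s t r = partition_sum G s t r.
  elim: r s FG => [|x r ih] s FG; first by rewrite !partition_sum_nil.
  move=> /itv_partition_consE[sx xr]; rewrite !partition_sum_cons.
  have xt := itv_partition_le xr.
  rewrite FG// ih// => u v xu; apply: FG; exact: le_trans (ltW sx) xu.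
apply/seteqP; split=> _ [r rP <-]; exists r => //; first by rewrite E.
exact: E.
Qed.

Section GapSums.
Variables (D D' : R -> R -> R) (r alpha e T : R).
Hypothesis DD' : agree_on T D D'.
Hypotheses (D'_ge0 : forall u v, 0 <= D' u v) (D'_ucont : ucont2 D').
Hypotheses (r_gt0 : 0 < r) (alpha_gt0 : 0 < alpha).
Hypotheses (er : e * r = 1 + alpha) (T_gt0 : 0 < T).

Local Notation SV := (sup_partition (gapV D r alpha) 0 T).
Local Notation ST := (sup_partition (gapT D r alpha e) 0 T).
Local Notation SN := (sup_partition (gapNp D r e) 0 T).

Let D'_locint (h : R) : locint (fun x => D' x (x + h) `^ r).
Proof. by apply: ucont2_locint => //; exact: ltW. Qed.

Lemma V_sum_control : (SV < +oo)%E -> exists w,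
  [/\ superadditive 0 T w, V_controlled 0 T D' r alpha w & (w 0 T)%:E = SV].
Proof.
move=> fin; have F0 := gapV_ge0 D r alpha.
exists (sup_control (gapV D r alpha)); split.
- by apply: sup_control_superadditive => //; exact: ltW.
- apply/(V_controlled_agree r alpha _ DD')/dominated_gapV.
  exact: sup_control_dominates.
- by rewrite (sup_controlE F0 fin)// ltW.
Qed.

Lemma V_sum_le_control w : superadditive 0 T w -> V_controlled 0 T D' r alpha w ->
  (SV <= (w 0 T)%:E)%E.
Proof.
move=> wS /(V_controlled_agree r alpha _ DD')/dominated_gapV wV.
exact: (sup_partition_le wS wV (lexx 0) (lexx T)).
Qed.

Lemma Vt_sum_le_V_sum : (ST <= (2 `^ (1 + alpha))%:E * SV)%E.
Proof.
have [fin|] := boolP (SV < +oo)%E; last first.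
  rewrite -leNgt leye_eq => /eqP ->.
  by rewrite gt0_muley ?leey// lte_fin powR_gt0.
have [w [wS wV <-]] := V_sum_control fin; rewrite -EFinM.
apply: V_controlled_gapT => //; exact/(V_controlled_agree r alpha _ DD').
Qed.

Lemma N_sum_le_V_sum : (SN <= SV)%E.
Proof.
have [fin|] := boolP (SV < +oo)%E; last by rewrite -leNgt leye_eq => /eqP ->; rewrite leey.
have [w [wS wV <-]] := V_sum_control fin.
apply: (@sup_partition_le _ 0 T (gapNp D r e) w) => //.
apply/(dominated_gapNp r_gt0 er DD' D'_locint) => //; first exact: wS.1.
exact: (V_controlled_Nikolskii alpha_gt0 wS (fun h _ => D'_locint h) wV).
Qed.

Lemma N_sum_control (B : R) : (SN <= B%:E)%E -> exists w,
  [/\ superadditive 0 T w, N_controlled 0 T D' r alpha w & w 0 T <= B].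
Proof.
move=> SNB; have fin : (SN < +oo)%E := le_lt_trans SNB (ltry B).
have F0 := gapNp_ge0 D r e; have T0 := ltW T_gt0.
have wS : superadditive 0 T (sup_control (gapNp D r e)).
  exact: sup_control_superadditive.
exists (sup_control (gapNp D r e)); split=> //.
  apply/(dominated_gapNp r_gt0 er DD' D'_locint) => //; first exact: wS.1.
  exact: sup_control_dominates.
by rewrite -lee_fin (sup_controlE F0 fin).
Qed.

End GapSums.
End ClampedControls.

(** * The path spaces over a metric space *)

Section MetricSpaces.
Context {R : realType} {E : Type} (d : E -> E -> R) (T q delta p : R).
Hypotheses (d_ge0 : forall x y, 0 <= d x y) (dxx : forall x, d x x = 0).
Hypotheses (dC : forall x y, d x y = d y x).
Hypothesis d_triangle : forall x y z, d x z <= d x y + d y z.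
Hypotheses (T_gt0 : 0 < T) (q_gt1 : 1 < q) (deltaE : delta = 1 / q) (q_lt_p : q < p).

Local Notation alpha := (delta * p - 1).

Lemma delta_gt0 : 0 < delta.
Proof. by rewrite deltaE divr_gt0// (lt_trans _ q_gt1). Qed.

Lemma alpha_gt0 : 0 < alpha.
Proof.
by rewrite subr_gt0 deltaE mulrAC mul1r ltr_pdivlMr ?mul1r// (lt_trans _ q_gt1).
Qed.

Lemma p_gt1 : 1 < p.
Proof. exact: lt_trans q_gt1 q_lt_p. Qed.

Let alpha0 := alpha_gt0.
Let delta0 := delta_gt0.
Let p0 : 0 < p := lt_trans ltr01 p_gt1.
Let er : delta * p = 1 + alpha. Proof. by rewrite addrC subrK. Qed.

Lemma VnormE f : V_norm d delta p f 0 T =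
  poweR (sup_partition (gapV (fun u v => d (f u) (f v)) p alpha) 0 T) p^-1.
Proof. by []. Qed.

Lemma VtnormE f : Vt_norm d delta p f 0 T =
  poweR (sup_partition (gapT (fun u v => d (f u) (f v)) p alpha delta) 0 T) p^-1.
Proof. by rewrite /Vt_norm /var_norm invrK. Qed.

Lemma NhnormE f : Nh_norm d delta p f 0 T =
  poweR (sup_partition (gapNp (fun u v => d (f u) (f v)) p delta) 0 T) p^-1.
Proof. by []. Qed.

Lemma poweR_pV_lty (x : \bar R) : (poweR x p^-1 < +oo)%E <-> (x < +oo)%E.
Proof.
split; last exact: poweR_lty.
by apply: lty_poweRy; rewrite invr_eq0 gt_eqF.
Qed.

Section Path.
Variable f : R -> E.
Hypothesis cf : continuous_path d T f.
Let D u v := d (f u) (f v).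
Definition clamped u v := d (f (clamp T u)) (f (clamp T v)).

Lemma clamped_agree : agree_on T D clamped.
Proof. by move=> u v u0 uT v0 vT; rewrite /clamped !clamp_id. Qed.

Lemma clamped_ucont2 : ucont2 clamped.
Proof.
apply: (@metric_ucont2 _ _ d T f) => //; first exact: ltW.
exact: continuous_uniform_path.
Qed.

Definition chain_cst : R := (2 / (1 - 2^-1 `^ (alpha / p)) + 1) `^ p.

Lemma metric_N_sum_V_control (B : R) :
  (sup_partition (gapNp D p delta) 0 T <= B%:E)%E -> exists w,
  [/\ superadditive 0 T w, V_controlled 0 T clamped p alpha w &
      w 0 T <= chain_cst * B].
Proof.
move=> SNB.
have [w [wS wN wB]] := N_sum_control clamped_agree (fun u v => d_ge0 _ _)
  clamped_ucont2 p0 er T_gt0 SNB.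
exists (fun u v => chain_cst * w u v); split.
- by apply: superadditiveZ => //; exact: powR_ge0.
- apply: metric_N_to_V => //.
  + by move=> u v; exact: d_ge0.
  + exact: clamped_ucont2.
  + by move=> u; exact: dxx.
  + exact: (ltW p_gt1).
  + by move=> x u y; exact: d_triangle.
- by apply: ler_wpM2l => //; exact: powR_ge0.
Qed.

Lemma Nh_finite_iff_V : (Nh_norm d delta p f 0 T < +oo)%E <->
  (V_norm d delta p f 0 T < +oo)%E.
Proof.
rewrite VnormE NhnormE !poweR_pV_lty; split=> [fin|].
  have S0 : (0 <= sup_partition (gapNp D p delta) 0 T)%E.
    by apply: sup_partition_ge0; [exact: gapNp_ge0|exact: ltW].
  have [|w [wS wV _]] := @metric_N_sum_V_control (fine (sup_partition (gapNp D p delta) 0 T)).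
    by rewrite fineK// ge0_fin_numE.
  by apply: le_lt_trans (V_sum_le_control clamped_agree wS wV) (ltry _).
apply: le_lt_trans; apply: (N_sum_le_V_sum clamped_agree _ clamped_ucont2) => //.
by move=> u v; exact: d_ge0.
Qed.

Lemma V_finite_iff_Vt : (V_norm d delta p f 0 T < +oo)%E <->
  (Vt_norm d delta p f 0 T < +oo)%E.
Proof.
rewrite VnormE VtnormE !poweR_pV_lty; split; last first.
  by apply: le_lt_trans; apply: sup_gapV_le_gapT => // u v; exact: d_ge0.
move=> fin; apply: (le_lt_trans (Vt_sum_le_V_sum clamped_agree p0 alpha0 er T_gt0)).
have S0 : (0 <= sup_partition (gapV D p alpha) 0 T)%E.
  by apply: sup_partition_ge0; [exact: gapV_ge0|exact: ltW].
have /fineK <- : sup_partition (gapV D p alpha) 0 T \is a fin_num.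
  by rewrite ge0_fin_numE.
by rewrite -EFinM ltry.
Qed.

End Path.

Lemma metric_spaces_coincide :
  Nh_space d delta p T = V_space d delta p T /\
  V_space d delta p T = Vt_space d delta p T.
Proof.
split; apply/seteqP; split=> f [cf fin]; split=> //.
- exact: (Nh_finite_iff_V cf).1.
- exact: (Nh_finite_iff_V cf).2.
- exact: (V_finite_iff_Vt f).1.
- exact: (V_finite_iff_Vt f).2.
Qed.

End MetricSpaces.

(** * The inhomogeneous distances *)

Section RoughPathDistances.
Context {R : realType} {T q delta p : R} {n : nat}.
Hypotheses (T_gt0 : 0 < T) (q_gt1 : 1 < q) (deltaE : delta = 1 / q) (q_lt_p : q < p).
Let N := Num.truncn q.
Local Notation alpha := (delta * p - 1).
Notation G := (GN T n N).
Notation dcc := (cc_dist T n N).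

Let alpha0 : 0 < alpha := alpha_gt0 q_gt1 deltaE q_lt_p.
Let delta0 : 0 < delta := delta_gt0 q_gt1 deltaE.
Let p0 : 0 < p := lt_trans ltr01 (p_gt1 q_gt1 q_lt_p).

Lemma level_le_q k : (k <= N)%N -> k%:R <= q.
Proof.
move=> kN; apply: (@le_trans _ _ N%:R); first by rewrite ler_nat.
by have /andP[] := truncn_itv (ltW (lt_trans ltr01 q_gt1)).
Qed.

Section Level.
Variables (X1 X2 : R -> G) (k : nat).
Hypotheses (c1 : continuous_path dcc T X1) (c2 : continuous_path dcc T X2).
Hypotheses (k_gt0 : (0 < k)%N) (kN : (k <= N)%N).
Let Y1 t := val (X1 t).
Let Y2 t := val (X2 t).
Let r := p / k%:R.
Local Notation D := (incr_gap k Y1 Y2).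

Let kr0 : 0 < k%:R :> R. Proof. by rewrite ltr0n. Qed.
Let r0 : 0 < r. Proof. exact: divr_gt0. Qed.
Let rV : r^-1 = k%:R / p. Proof. by rewrite /r invf_div. Qed.
Let er : (delta * k%:R) * r = 1 + alpha.
Proof. by rewrite addrC subrK /r mulrC mulrCA divfK ?gt_eqF. Qed.
Let dk0 : 0 < delta * k%:R. Proof. exact: mulr_gt0. Qed.
Let T0 : 0 <= T := ltW T_gt0.

Lemma incr_gap_agree : agree_on T D (gap k X1 X2).
Proof. by move=> u v u0 uT v0 vT; rewrite /gap /tincr /glift !clamp_id. Qed.

Lemma incr_gap_ge0 u v : 0 <= D u v.
Proof. exact: sqrtr_ge0. Qed.

Lemma rho_V_kE : rho_V_k k delta p Y1 Y2 0 T =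
  poweR (sup_partition (gapV D r alpha) 0 T) (k%:R / p).
Proof.
rewrite /rho_V_k -sup_partition_powE//; last by rewrite divr_gt0.
exact: gapV_ge0.
Qed.

Lemma rho_Vt_kE : rho_Vt_k k delta p Y1 Y2 0 T =
  poweR (sup_partition (gapT D r alpha (delta * k%:R)) 0 T) (k%:R / p).
Proof.
rewrite /rho_Vt_k sup_partition_powE//; last by rewrite divr_gt0.
  congr poweR; apply: eq_sup_partition => u v u0 uv vT.
  rewrite /gapT /gapvar /rho_var_k sup_partition_powE//; last exact: ltW.
  by move=> x y; rewrite lee_fin powR_ge0.
move=> u v; rewrite mule_ge0 ?poweR_ge0// lee_fin invr_ge0 powR_ge0//.
Qed.

Lemma rho_Nh_kE : rho_Nh_k k delta p Y1 Y2 0 T =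
  poweR (sup_partition (gapNp D r (delta * k%:R)) 0 T) (k%:R / p).
Proof.
rewrite /rho_Nh_k sup_partition_powE//; last by rewrite divr_gt0.
  by rewrite /gapNp /gapN rV.
by move=> u v; exact: poweR_ge0.
Qed.

Let mono (x y : \bar R) (f : R) : 0 <= f -> (0 <= x)%E -> (x <= y)%E ->
  (poweR x f <= poweR y f)%E.
Proof.
move=> f0 x0 xy; apply: gt0_ler_poweR; rewrite ?in_itv /= ?leey ?andbT//.
exact: le_trans xy.
Qed.

Let kp0 : 0 <= k%:R / p. Proof. by rewrite divr_ge0// ltW. Qed.

Let SV0 : (0 <= sup_partition (gapV D r alpha) 0 T)%E.
Proof. by apply: sup_partition_ge0 => //; exact: gapV_ge0. Qed.
Let ST0 : (0 <= sup_partition (gapT D r alpha (delta * k%:R)) 0 T)%E.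
Proof. by apply: sup_partition_ge0 => //; exact: gapT_ge0. Qed.
Let SN0 : (0 <= sup_partition (gapNp D r (delta * k%:R)) 0 T)%E.
Proof. by apply: sup_partition_ge0 => //; exact: gapNp_ge0. Qed.

Lemma rho_V_le_Vt_k : (rho_V_k k delta p Y1 Y2 0 T <= rho_Vt_k k delta p Y1 Y2 0 T)%E.
Proof.
rewrite rho_V_kE rho_Vt_kE; apply: mono => //.
by apply: sup_gapV_le_gapT => // u v; exact: incr_gap_ge0.
Qed.

Lemma rho_Vt_le_V_k :
  (rho_Vt_k k delta p Y1 Y2 0 T <= 2%:E * rho_V_k k delta p Y1 Y2 0 T)%E.
Proof.
rewrite rho_V_kE rho_Vt_kE.
apply: (le_trans (mono kp0 ST0 (Vt_sum_le_V_sum incr_gap_agree r0 alpha0 er T_gt0))).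
rewrite poweRM ?lee_fin ?powR_ge0//; apply: lee_wpmul2r; first exact: poweR_ge0.
rewrite poweR_EFin lee_fin -powRrM -er -rV mulfK ?gt_eqF//.
have dk1 : delta * k%:R <= 1.
  rewrite deltaE mulrAC mul1r ler_pdivrMr ?mul1r ?level_le_q//.
  exact: lt_trans ltr01 q_gt1.
rewrite -[leRHS](powRr1 (ler0n _ 2)); apply: ler_powR => //.
by rewrite ler1n.
Qed.

Lemma rho_Nh_le_V_k :
  (rho_Nh_k k delta p Y1 Y2 0 T <= rho_V_k k delta p Y1 Y2 0 T)%E.
Proof.
rewrite rho_V_kE rho_Nh_kE; apply: mono => //.
apply: (N_sum_le_V_sum incr_gap_agree _ (gap_ucont2 T_gt0 k c1 c2) r0 alpha0 er T_gt0).
by move=> u v; exact: gap_ge0.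
Qed.

Lemma rho_Nh_control (y : R) : 0 < y -> (rho_Nh_k k delta p Y1 Y2 0 T <= y%:E)%E ->
  exists w, [/\ superadditive 0 T w, w 0 T <= y `^ r &
    N_controlled 0 T (gap k X1 X2) r alpha w].
Proof.
move=> y0; rewrite rho_Nh_kE => h.
have SNy : (sup_partition (gapNp D r (delta * k%:R)) 0 T <= (y `^ r)%:E)%E.
  have S0 := SN0; move: h S0; set S := sup_partition _ _ _ => h S0.
  have -> : S = poweR (poweR S (k%:R / p)) r.
    by rewrite -poweRrM -rV mulVf ?gt_eqF// poweRe1.
  rewrite -poweR_EFin; exact: (mono (ltW r0) (poweR_ge0 _ _) h).
have [w [wS wN wB]] := N_sum_control incr_gap_agree (gap_ge0 k X1 X2)
  (gap_ucont2 T_gt0 k c1 c2) r0 er T_gt0 SNy.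
by exists w.
Qed.

(** The exponent k/p of the constant is at most 1, hence the factor 1 + C. *)
Lemma rho_V_bound (C y : R) Om : 0 <= C -> 0 < y -> superadditive 0 T Om -> Om 0 T <= C ->
  (forall u v, 0 <= u -> u < v -> v <= T ->
    gap k X1 X2 u v <= y * (Om u v * (v - u) `^ alpha) `^ (k%:R / p)) ->
  (rho_V_k k delta p Y1 Y2 0 T <= ((1 + C) * y)%:E)%E.
Proof.
move=> C0 y0 OS OC Og.
have wS : superadditive 0 T (fun u v => y `^ r * Om u v).
  by apply: superadditiveZ => //; exact: powR_ge0.
have wV : V_controlled 0 T (gap k X1 X2) r alpha (fun u v => y `^ r * Om u v).
  move=> u v u0 uv vT.
  have Om0 : 0 <= Om u v * (v - u) `^ alpha.
    by rewrite mulr_ge0 ?powR_ge0//; apply: OS.1 => //; exact: ltW.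
  apply: (@le_trans _ _ ((y * (Om u v * (v - u) `^ alpha) `^ (k%:R / p)) `^ r)).
    apply: ge0_ler_powR; rewrite ?nnegrE ?gap_ge0 ?(ltW r0)//; last exact: Og.
    by rewrite mulr_ge0 ?powR_ge0// ltW.
  rewrite powRM ?powR_ge0 ?(ltW y0)// -powRrM -rV mulVf ?gt_eqF// powRr1//.
  by rewrite mulrA.
rewrite rho_V_kE.
apply: (le_trans (mono kp0 SV0 (V_sum_le_control incr_gap_agree wS wV))).
have OmT0 : 0 <= Om 0 T by exact: OS.1.
rewrite poweR_EFin lee_fin powRM ?powR_ge0// -powRrM -rV mulfV ?gt_eqF// powRr1 ?(ltW y0)//.
rewrite mulrC; apply: ler_wpM2r; first exact: ltW.
have r1 : r^-1 <= 1.
  by rewrite rV ler_pdivrMr// mul1r (le_trans (level_le_q kN))// ltW.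
have rV0 : 0 <= r^-1 by rewrite invr_ge0 ltW.
apply: (@le_trans _ _ ((1 + C) `^ r^-1)).
  by apply: ge0_ler_powR; rewrite ?nnegrE ?addr_ge0//; lra.
rewrite -[leRHS]powRr1 ?addr_ge0//; apply: ler_powR => //; lra.
Qed.

End Level.

Lemma bigmaxe_le (F H : nat -> \bar R) (c : R) a b : 0 <= c ->
  (forall k, (a <= k)%N -> (k < b)%N -> (F k <= c%:E * H k)%E) ->
  (\big[maxe/0%E]_(a <= k < b) F k <= c%:E * \big[maxe/0%E]_(a <= k < b) H k)%E.
Proof.
move=> c0 FH; rewrite big_nat; apply: bigmax_le.
  by rewrite mule_ge0 ?lee_fin//; apply: bigmax_ge_id.
move=> k /andP[ak kb]; apply: (le_trans (FH k ak kb)).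
apply: lee_wpmul2l; first by rewrite lee_fin.
by apply: le_bigmax_seq => //; rewrite mem_index_iota ak.
Qed.

Lemma bigmaxe_term (F : nat -> \bar R) k a b : (a <= k)%N -> (k < b)%N ->
  (F k <= \big[maxe/0%E]_(a <= k < b) F k)%E.
Proof. by move=> ak kb; apply: le_bigmax_seq => //; rewrite mem_index_iota ak. Qed.

(** The bound of [level_induction] is linear in [y]; since [y] must be
   positive and the N-distance may vanish, that distance is approached from
   above. *)
Lemma rho_V_le_Nh (b : R) : 0 < b -> exists2 C : R, 1 <= C &
  forall X1 X2 : R -> G,
    Nh_space dcc delta p T X1 -> Nh_space dcc delta p T X2 ->
    (Nh_norm dcc delta p X1 0 T <= b%:E)%E -> (Nh_norm dcc delta p X2 0 T <= b%:E)%E ->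
    (rho_V delta p T (fun t => val (X1 t)) (fun t => val (X2 t)) <=
     C%:E * rho_Nh delta p T (fun t => val (X1 t)) (fun t => val (X2 t)))%E.
Proof.
move=> b0.
pose Cp : R := chain_cst delta p * b `^ p.
have Cp0 : 0 <= Cp by rewrite mulr_ge0 ?powR_ge0.
have Np : N%:R <= p by rewrite (le_trans (level_le_q (leqnn N)))// ltW.
have [C C0 Cind] := @level_induction R T n N p alpha (Cp + Cp) N T_gt0 alpha0 p0 Np (addr_ge0 Cp0 Cp0).
have C11 : 1 <= 1 + C by rewrite lerDl.
have C1pos : 0 < 1 + C by rewrite (lt_le_trans ltr01).
exists (1 + C) => // X1 X2 [c1 _] [c2 _] n1 n2.
set Y1 := fun t => val (X1 t); set Y2 := fun t => val (X2 t).
have ctl (X : R -> G) : continuous_path dcc T X -> (Nh_norm dcc delta p X 0 T <= b%:E)%E ->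
    exists w, [/\ superadditive 0 T w,
      V_controlled 0 T (fun u v => dcc (X (clamp T u)) (X (clamp T v))) p alpha w & w 0 T <= Cp].
  move=> cX nX; apply: (@metric_N_sum_V_control R _ dcc T q delta p) => //.
  - by move=> x y; exact: cc_dist_ge0.
  - by move=> x; exact: cc_distxx.
  - by move=> x y; exact: cc_distC.
  - by move=> x y z; exact: cc_dist_triangle.
  have S0 : (0 <= sup_partition (gapNp (fun u v => dcc (X u) (X v)) p delta) 0 T)%E.
    by apply: sup_partition_ge0; [exact: gapNp_ge0|exact: ltW].
  rewrite NhnormE in nX; set S := sup_partition _ _ _ in nX S0 *.
  have -> : S = poweR (poweR S p^-1) p.
    by rewrite -poweRrM mulVf ?gt_eqF// poweRe1.
  rewrite -poweR_EFin; apply: gt0_ler_poweR; rewrite ?in_itv /= ?leey ?andbT ?poweR_ge0 ?lee_fin//; exact: ltW.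
have [w1 [w1S w1V w1B]] := ctl X1 c1 n1; have [w2 [w2S w2V w2B]] := ctl X2 c2 n2.
have key (y : R) : 0 < y -> (rho_Nh delta p T Y1 Y2 <= y%:E)%E ->
    (rho_V delta p T Y1 Y2 <= ((1 + C) * y)%:E)%E.
  move=> y0 Ny.
  have wNex k : exists w, (0 < k)%N -> (k <= N)%N -> [/\ superadditive 0 T w,
      w 0 T <= y `^ (p / k%:R) & N_controlled 0 T (gap k X1 X2) (p / k%:R) alpha w].
    have [/andP[k0 kN]|nk] := boolP ((0 < k)%N && (k <= N)%N); last first.
      by exists (fun _ _ => 0) => k0 kN; rewrite k0 kN in nk.
    have [w Hw] := rho_Nh_control c1 c2 k0 y0 (le_trans (bigmaxe_term _ k0 (leq_ltn_trans kN (ltnSn N))) Ny).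
    by exists w.
  have [wN wNP] := choice wNex.
  have dat : level_data p alpha (Cp + Cp) y X1 X2 (fun u v => w1 u v + w2 u v) wN.
    split => //.
    - by split; [exact: superadditiveD|exact: lerD].
    - move=> u v u0 uv vT; apply: (le_trans (w1V u v u0 uv vT)).
      by apply: ler_wpM2r; [exact: powR_ge0|rewrite lerDl; apply: w2S.1 => //; exact: ltW].
    - move=> u v u0 uv vT; apply: (le_trans (w2V u v u0 uv vT)).
      by apply: ler_wpM2r; [exact: powR_ge0|rewrite lerDr; apply: w1S.1 => //; exact: ltW].
  have [Om [OS OC _ Og]] := Cind X1 X2 y _ wN y0 dat.
  rewrite /rho_V big_nat; apply: bigmax_le.
    by rewrite lee_fin mulr_ge0// ltW.
  move=> k /andP[k0 kN]; rewrite ltnS in kN.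
  by apply: (rho_V_bound k0 kN C0 y0 OS OC); exact: Og.
have N0 : (0 <= rho_Nh delta p T Y1 Y2)%E by apply: bigmax_ge_id.
case NE : (rho_Nh delta p T Y1 Y2) key N0 => [y| |] // key N0; last first.
  by rewrite gt0_muley ?leey// lte_fin.
apply/lee_addgt0Pr => e e0; rewrite -EFinM -EFinD.
have := key (y + e / (1 + C)); rewrite lee_fin in N0.
have e'0 : 0 < e / (1 + C) by rewrite divr_gt0.
rewrite lee_fin lerDl (ltW e'0) ltr_wpDl// => /(_ isT isT).
by rewrite mulrDr [_ * (e / _)]mulrC divfK// gt_eqF.
Qed.

(** Each of the three distances lies between rho_V / C and 2 rho_V. *)
Lemma rho_equivalence (b : R) : 0 < b -> exists2 C : R, 1 <= C &
  forall X1 X2 : R -> G,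
    Nh_space dcc delta p T X1 -> Nh_space dcc delta p T X2 ->
    (Nh_norm dcc delta p X1 0 T <= b%:E)%E -> (Nh_norm dcc delta p X2 0 T <= b%:E)%E ->
    let Y1 := fun t => val (X1 t) in
    let Y2 := fun t => val (X2 t) in
    let rhos := [:: rho_V delta p T Y1 Y2; rho_Vt delta p T Y1 Y2;
                    rho_Nh delta p T Y1 Y2] in
    forall x y : \bar R, x \in rhos -> y \in rhos -> (x <= C%:E * y)%E.
Proof.
move=> b0; have [C C1 HC] := rho_V_le_Nh b0.
have C0 : 0 <= C by rewrite (le_trans ler01).
exists (2 * C); first lra.
move=> X1 X2 s1 s2 n1 n2 Y1 Y2.
have [c1 _] := s1; have [c2 _] := s2.
have VN : (rho_V delta p T Y1 Y2 <= C%:E * rho_Nh delta p T Y1 Y2)%E by exact: HC.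
have VT : (rho_V delta p T Y1 Y2 <= rho_Vt delta p T Y1 Y2)%E.
  rewrite -[leRHS]mul1e; apply: bigmaxe_le => // k k0 kN; rewrite mul1e.
  exact: rho_V_le_Vt_k.
have TV : (rho_Vt delta p T Y1 Y2 <= 2%:E * rho_V delta p T Y1 Y2)%E.
  by apply: bigmaxe_le => // k k0 kN; apply: rho_Vt_le_V_k.
have NV : (rho_Nh delta p T Y1 Y2 <= rho_V delta p T Y1 Y2)%E.
  rewrite -[leRHS]mul1e; apply: bigmaxe_le => // k k0 kN; rewrite mul1e.
  exact: rho_Nh_le_V_k.
have V0 : (0 <= rho_V delta p T Y1 Y2)%E by apply: bigmax_ge_id.
have T0 : (0 <= rho_Vt delta p T Y1 Y2)%E by apply: bigmax_ge_id.
have up x : x \in [:: rho_V delta p T Y1 Y2; rho_Vt delta p T Y1 Y2; rho_Nh delta p T Y1 Y2] ->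
    (x <= 2%:E * rho_V delta p T Y1 Y2)%E.
  have V2 : (rho_V delta p T Y1 Y2 <= 2%:E * rho_V delta p T Y1 Y2)%E.
    by apply: lee_pemull; rewrite // lee_fin ler1n.
  rewrite !inE => /or3P[] /eqP -> //.
  exact: le_trans NV V2.
have down x : x \in [:: rho_V delta p T Y1 Y2; rho_Vt delta p T Y1 Y2; rho_Nh delta p T Y1 Y2] ->
    (rho_V delta p T Y1 Y2 <= C%:E * x)%E.
  rewrite !inE => /or3P[] /eqP -> //; first by apply: lee_pemull; rewrite // lee_fin.
  by apply: (le_trans VT); apply: lee_pemull; rewrite // lee_fin.
move=> rhos x y xr yr; apply: (le_trans (up x xr)).
by rewrite EFinM -muleA; apply: lee_wpmul2l; [rewrite lee_fin|exact: down].
Qed.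

End RoughPathDistances.

Theorem theorem1p2 (R : realType) (T q delta p : R)
    (T_gt0 : 0 < T) (q_gt1 : 1 < q) (deltaE : delta = 1 / q) (q_lt_p : q < p) :
  let N := Num.truncn q in
  [/\ (forall E : metricType R,
        Nh_space (@mdist R E) delta p T = V_space (@mdist R E) delta p T /\
        V_space (@mdist R E) delta p T = Vt_space (@mdist R E) delta p T),
      (forall n : nat,
        Nh_space (cc_dist T n N) delta p T = V_space (cc_dist T n N) delta p T /\
        V_space (cc_dist T n N) delta p T = Vt_space (cc_dist T n N) delta p T) &
      (forall (n : nat) (b : R), 0 < b ->
        exists2 C : R, 1 <= C &
          forall X1 X2 : R -> GN T n N,
          Nh_space (cc_dist T n N) delta p T X1 ->
          Nh_space (cc_dist T n N) delta p T X2 ->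
          (Nh_norm (cc_dist T n N) delta p X1 0 T <= b%:E)%E ->
          (Nh_norm (cc_dist T n N) delta p X2 0 T <= b%:E)%E ->
          let Y1 := fun t => val (X1 t) in
          let Y2 := fun t => val (X2 t) in
          let rhos := [:: rho_V delta p T Y1 Y2; rho_Vt delta p T Y1 Y2;
                          rho_Nh delta p T Y1 Y2] in
          forall x y : \bar R, x \in rhos -> y \in rhos -> (x <= C%:E * y)%E)].
Proof.
move=> N; split=> [E|n|n b b0].
- apply: (metric_spaces_coincide _ _ _ _ T_gt0 q_gt1 deltaE q_lt_p).
  + by move=> x y; exact: mdist_ge0.
  + by move=> x; exact: mdistxx.
  + by move=> x y; exact: metric_sym.
  + by move=> x y z; exact: metric_triangle.
- apply: (metric_spaces_coincide _ _ _ _ T_gt0 q_gt1 deltaE q_lt_p).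
  + by move=> x y; exact: cc_dist_ge0.
  + by move=> x; exact: cc_distxx.
  + by move=> x y; exact: cc_distC.
  + by move=> x y z; exact: cc_dist_triangle.
- exact: (rho_equivalence T_gt0 q_gt1 deltaE q_lt_p b0).
Qed.
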